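(* Let $\mu\in\Lambda_l$, $\nu\in\Lambda_n$ with $|\mu|=|\nu|=d$, let $A,B\in\mathrm{Col}(\mu,\nu)$, and put $x=d(\gamma(A))$, $y=d(\gamma(B))$. Then $$k_{A,B}(q)=(-q)^{\ell(x)-\ell(y)}\sum_{z\in S_\nu}(-1)^{\ell(z)}P_{zx,y}(q^2),$$ $$k^*_{A,B}(q)=(-q)^{\ell(x)-\ell(y)}\sum_{z\in\mathcal D_\nu\cap S_\nu xS_\mu}(-1)^{\ell(z)+\ell(y)}P_{zw_d,yw_d}(q^{-2}).$$
   Context: **Basics.** Work over $\mathbb Q(q)$, $q$ an indeterminate; the bar on $\mathbb Q(q)$ is the field automorphism with $\overline q=q^{-1}$; an additive map $f$ of $\mathbb Q(q)$-spaces is antilinear if $f(cv)=\overline cf(v)$. $\Lambda_n=\mathbb Z_{\ge0}^n$, $|\lambda|=\sum_i\lambda_i$. $S_d$ acts on the left on $\{1,\dots,d\}$ with basic transpositions $s_i$, length $\ell$, longest element $w_d$. For $\lambda$ with $|\lambda|=d$, $S_\lambda=S_{\lambda_1}\times S_{\lambda_2}\times\cdots\subseteq S_d$ is the standard parabolic subgroup and $\mathcal D_\lambda$ is the set of minimal length $S_\lambda\backslash S_d$-coset representatives. $I_n=\{1,\dots,n\}$ and $S_d$ acts on the right on $I_n^d$ by $(\alpha\cdot x)_i=\alpha_{xi}$. The weight of $\alpha\in I_n^d$ has $i$th entry $\#\{k:\alpha_k=i\}$; $I_\nu$ is the set of multi-indexes of weight $\nu$. For $\alpha\in I_\nu$,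 $d(\alpha)$ is the unique element of $\mathcal D_\nu$ such that $\alpha\cdot d(\alpha)^{-1}$ is weakly increasing. $P_{x,y}(t)\in\mathbb Z[t]$ $(x,y\in S_d)$ are the original Kazhdan–Lusztig polynomials of $S_d$ (with $P_{x,y}=0$ unless $x$ is below $y$ in the usual Bruhat order). **Tensor space.** $\mathcal V_n$ has basis $v_1,\dots,v_n$; $T^d(\mathcal V_n)=\mathcal V_n^{\otimes d}$; $M_\alpha=v_{\alpha_1}\otimes\cdots\otimes v_{\alpha_d}$, $M^*_\alpha=v_{\alpha_d}\otimes\cdots\otimes v_{\alpha_1}$. The Hecke algebra $\mathcal H_d$ has basis $H_x$ $(x\in S_d)$, with $H_xH_y=H_{xy}$ if $\ell(xy)=\ell(x)+\ell(y)$ and $H_i^2=1-(q-q^{-1})H_i$, where $H_i=H_{s_i}$. It acts on the right on $T^d(\mathcal V_n)$ by: $M_\alpha H_i=M_{\alpha\cdot s_i}$ if $\alpha_i<\alpha_{i+1}$; $q^{-1}M_\alpha$ if $\alpha_i=\alpha_{i+1}$; $M_{\alpha\cdot s_i}-(q-q^{-1})M_\alpha$ if $\alpha_i>\alpha_{i+1}$. The bar involution of $\mathcal H_d$ is the antilinear automorphism with $\overline{H_w}=H_{w^{-1}}^{-1}$. The bar involution on $T^d(\mathcal V_n)$ is the unique antilinear involution with $\overline{M_\alpha}=M_\alpha$ for weakly increasing $\alpha$ and $\overline{vh}=\overline v\,\overline h$ for $h\in\mathcal H_d$ (it coincides with the one defined by Lusztig's quasi-$R$-matrix). **Tableaux.**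 The column diagram of $\mu\in\Lambda_l$ has $\mu_i$ boxes in the $i$th column from the left, all columns starting from the bottom. $\mathrm{Col}(\mu,\nu)$ is the set of fillings of it with exactly $\nu_j$ entries equal to $j$ $(1\le j\le n)$, strictly increasing up columns. $\gamma(A)$ (column reading) is obtained by reading entries down columns from top to bottom starting with the leftmost column. $A\sim_{\mathrm{col}}B$ means $B$ is obtained from $A$ by permuting entries within columns; $\ell'(A,B)$ is then the minimal number of transpositions of neighbouring entries in the same column needed to get $B$ from $A$. **Exterior powers.** Let $Y_d=\sum_{w\in S_d}(-q)^{\ell(w)-\ell(w_d)}H_w$, $\bigwedge^d(\mathcal V_n)=T^d(\mathcal V_n)Y_d$, $\bigwedge^\mu(\mathcal V_n)=\bigwedge^{\mu_1}(\mathcal V_n)\otimes\cdots\otimes\bigwedge^{\mu_l}(\mathcal V_n)\subseteq T^d(\mathcal V_n)$, which is stable under the bar involution. For $A\in\mathrm{Col}(\mu,\nu)$ let $N_A=\sum_{B\sim_{\mathrm{col}}A}(-q)^{-\ell'(A,B)}M_{\gamma(B)}\in\bigwedge^\mu(\mathcal V_n)$, and let $K_A$ be the unique bar invariant element of $N_A+\sum_{B\in\mathrm{Col}(\mu,\nu)}q^{-1}\mathbb Z[q^{-1}]N_B$. Let $J$ be the two-sided ideal of the tensor algebra generated by $v_j\otimes v_i+q\,v_i\otimes v_j$ $(i<j)$ and $v_i\otimes v_i$, $\widetilde{\bigwedge}^d(\mathcal V_n)=T^d(\mathcal V_n)/(J\cap T^d(\mathcal V_n))$, and $\widetilde{\bigwedge}^\mu(\mathcal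 V_n)=\widetilde{\bigwedge}^{\mu_l}(\mathcal V_n)\otimes\cdots\otimes\widetilde{\bigwedge}^{\mu_1}(\mathcal V_n)$, a quotient of $T^d(\mathcal V_n)$ to which the bar involution descends. For $A\in\mathrm{Col}(\mu,\nu)$ let $N^*_A$ be the image of $M^*_{\gamma(A)}$, and let $K^*_A$ be the unique bar invariant element of $N^*_A+\sum_{B\in\mathrm{Col}(\mu,\nu)}q\mathbb Z[q]N^*_B$. The $N_A$ and the $N_A^*$ are linearly independent, and $k_{A,B}(q)\in\mathbb Z[q^{-1}]$, $k^*_{A,B}(q)\in\mathbb Z[q]$ are defined by $K_B=\sum_{A}k_{A,B}(q)N_A$ and $K^*_B=\sum_{A}k^*_{A,B}(q)N^*_A$, sums over $A\in\mathrm{Col}(\mu,\nu)$. *)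

(* Defs.v *)
From HB Require Import structures.
From Stdlib Require Import ClassicalEpsilon.
From mathcomp Require Import all_boot all_order all_fingroup all_algebra.
From mathcomp Require Import monalg.

Set Implicit Arguments.
Unset Strict Implicit.
Unset Printing Implicit Defensive.

Import GRing.Theory.
Local Open Scope ring_scope.

(* Objects that are specified as "the unique ... such that ..." are taken with *)
(* Hilbert's epsilon applied to the defining properties.                       *)

Definition Qq : fieldType := {fraction {poly rat}}.

Definition q : Qq := tofrac 'X.

Definition ratC (c : rat) : Qq := tofrac c%:P.

(* f(q) |-> f(q^-1), computed on a representative numerator/denominator pair. *)
Definition fbar (f : Qq) : Qq :=
  let r := generic_quotient.repr f in
  (map_poly ratC \n_r).[q^-1] / (map_poly ratC \d_r).[q^-1].

Definition antilinear (U V : lmodType Qq) (f : U -> V) : Prop :=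
  {morph f : u v / u + v} /\ forall (c : Qq) v, f (c *: v) = fbar c *: f v.

Definition peval (p : {poly int}) (c : Qq) : Qq := (map_poly intr p).[c].

(* Length of a shortest e-path from x to y (#|T| if there is none; a shortest *)
(* path always has fewer than #|T| steps).                                    *)
Definition gdist (T : finType) (e : rel T) (x y : T) : nat :=
  find (fun r => [exists p : r.-tuple T, path e x p && (last x p == y)])
       (iota 0 #|T|).

Section SymmetricGroup.

Variable d : nat.
Implicit Types x y w s : 'S_d.

(* The product for which S_d acts on the left: (pmul x y) i = x (y i), whereas *)
(* (x * y)%g i = y (x i).                                                      *)
Definition pmul x y : 'S_d := (y * x)%g.

Definition adjacent (i j : 'I_d) : bool := j == i.+1 :> nat.

Definition basic_transp s : bool :=
  [exists i, exists j, adjacent i j && (s == tperm i j)].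

Definition ell w : nat :=
  gdist (fun u v => [exists s, basic_transp s && (v == pmul u s)]) 1%g w.

(* w_d: the longest element is the order-reversing permutation. *)
Definition wlong : 'S_d := perm (@rev_ord_inj d).

Definition bruhat x y : bool :=
  connect (fun u v => [exists i, exists j,
             (v == pmul u (tperm i j)) && (ell u < ell v)%N]) x y.

(* reshape_index lam i is the index of the block of consecutive integers, of *)
(* sizes lam_1, lam_2, ..., that contains i.                                 *)
Definition parab (lam : seq nat) : {set 'S_d} :=
  [set w : 'S_d | [forall i : 'I_d, reshape_index lam (w i) == reshape_index lam i]].

Definition mincoset (lam : seq nat) : {set 'S_d} :=
  [set x : 'S_d | [forall z in parab lam, (ell x <= ell (pmul z x))%N]].

Definition dblcoset (lam : seq nat) x (kap : seq nat) : {set 'S_d} :=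
  [set pmul (pmul z x) w | z in parab lam, w in parab kap].

End SymmetricGroup.

Section Hecke.

Variable d : nat.

Definition hecke : lmodType Qq := {ffun 'S_d -> Qq^o}.

Definition Hb (w : 'S_d) : hecke := [ffun x => (x == w)%:R].

Record is_hecke_product (m : hecke -> hecke -> hecke) : Prop := {
  hecke_linl : forall h, linear (m^~ h);
  hecke_linr : forall h, linear (m h);
  hecke_assoc : associative m;
  hecke_unitl : left_id (Hb 1%g) m;
  hecke_unitr : right_id (Hb 1%g) m;
  hecke_length : forall x y : 'S_d, ell (pmul x y) = (ell x + ell y)%N ->
    m (Hb x) (Hb y) = Hb (pmul x y);
  hecke_quad : forall s : 'S_d, basic_transp s ->
    m (Hb s) (Hb s) = Hb 1%g - (q - q^-1) *: Hb s
}.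

Definition hmul : hecke -> hecke -> hecke :=
  epsilon (inhabits (fun _ _ => 0)) is_hecke_product.

Definition hinv (h : hecke) : hecke :=
  epsilon (inhabits 0) (fun h' => hmul h h' = Hb 1%g /\ hmul h' h = Hb 1%g).

(* The antilinear map with H_w |-> (H_(w^-1))^-1. *)
Definition hbar (h : hecke) : hecke :=
  \sum_(w : 'S_d) fbar (h w) *: hinv (Hb (w^-1)%g).

(* Kazhdan and Lusztig's T_w for the parameter t = q^-2 (t^(1/2) = q^-1): these *)
(* elements satisfy (T_s + 1)(T_s - t) = 0.                                     *)
Definition klT (w : 'S_d) : hecke := q ^- ell w *: Hb w.

(* C_y = sum_x eps_x eps_y t_y^(1/2) t_x^-1 bar(P_(x,y)) T_x, where            *)
(* t_w = t^(ell w), so bar(P_(x,y)(t)) = P_(x,y)(q^2).                         *)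
Definition klC (P : 'S_d -> 'S_d -> {poly int}) (y : 'S_d) : hecke :=
  \sum_(x : 'S_d)
    ((-1) ^+ (ell x + ell y) * q ^- ell y * q ^+ (2 * ell x)
       * peval (P x y) (q ^+ 2)) *: klT x.

(* The characterisation in Theorem 1.1 of Kazhdan and Lusztig's 1979 paper. *)
Record is_KL_family (P : 'S_d -> 'S_d -> {poly int}) : Prop := {
  KL_support : forall x y, ~~ bruhat x y -> P x y = 0;
  KL_diag : forall y, P y y = 1;
  KL_degree : forall x y, bruhat x y -> x != y ->
    ((size (P x y)).-1.*2 + 1 <= ell y - ell x)%N;
  KL_bar : forall y, hbar (klC P y) = klC P y
}.

Definition KL : 'S_d -> 'S_d -> {poly int} :=
  epsilon (inhabits (fun _ _ => 0)) is_KL_family.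

End Hecke.

Section Tensor.

Variables n d : nat.
Implicit Types a : d.-tuple 'I_n.

Definition tact a (x : 'S_d) : d.-tuple 'I_n := [tuple tnth a (x i) | i < d].

Definition wincr a : bool := sorted leq (map val a).

(* d(a); meaningful only when a has weight nu. *)
Definition dperm (nu : seq nat) a : 'S_d :=
  odflt 1%g [pick x in mincoset d nu | wincr (tact a (x^-1)%g)].

(* T^d(V_n), on the basis M_a. *)
Definition tens : lmodType Qq := {ffun d.-tuple 'I_n -> Qq^o}.

Definition M a : tens := [ffun b => (b == a)%:R].

Definition Mstar a : tens := M [tuple of rev a].

Record is_hecke_action (act : tens -> hecke d -> tens) : Prop := {
  act_linl : forall h, linear (act^~ h);
  act_linr : forall v, linear (act v);
  act_one : forall v, act v (Hb 1%g) = v;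
  act_mul : forall v h h', act (act v h) h' = act v (hmul h h');
  act_gen : forall a (i j : 'I_d), adjacent i j ->
    act (M a) (Hb (tperm i j)) =
      if (tnth a i < tnth a j)%N then M (tact a (tperm i j))
      else if tnth a i == tnth a j then q^-1 *: M a
      else M (tact a (tperm i j)) - (q - q^-1) *: M a
}.

Definition hact : tens -> hecke d -> tens :=
  epsilon (inhabits (fun v _ => v)) is_hecke_action.

Record is_tensor_bar (psi : tens -> tens) : Prop := {
  tbar_antilinear : antilinear psi;
  tbar_involutive : involutive psi;
  tbar_wincr : forall a, wincr a -> psi (M a) = M a;
  tbar_act : forall v h, psi (hact v h) = hact (psi v) (hbar h)
}.

Definition tbar : tens -> tens := epsilon (inhabits id) is_tensor_bar.

End Tensor.

Section TensorAlgebra.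

Variable n : nat.

(* The tensor algebra of V_n, as the free algebra on v_1, ..., v_n. *)
Definition talg := {malg Qq[{fmonom 'I_n}]}.

Definition tword (s : seq 'I_n) : talg := << FMonom s >>.

Definition temb d (u : tens n d) : talg :=
  \sum_(a : d.-tuple 'I_n) (u a : Qq) *: tword a.

Definition in_tens (d : nat) (x : talg) : Prop :=
  exists u : tens n d, x = temb u.

Inductive Jideal : talg -> Prop :=
| J_lt (i j : 'I_n) : (i < j)%N ->
    Jideal (tword [:: j] * tword [:: i] + q *: (tword [:: i] * tword [:: j]))
| J_eq (i : 'I_n) : Jideal (tword [:: i] * tword [:: i])
| J_zero : Jideal 0
| J_add x y : Jideal x -> Jideal y -> Jideal (x + y)
| J_mull a x : Jideal x -> Jideal (a * x)
| J_mulr x a : Jideal x -> Jideal (x * a).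

(* The kernel of T^d -> W^(mu_l) (x) ... (x) W^(mu_1), d = |mu|, where         *)
(* W^m = T^m / (J /\ T^m): the sum over i of the subspaces                     *)
(* T^(mu_l + ... + mu_(i+1)) (x) (J /\ T^(mu_i)) (x) T^(mu_(i-1) + ... + mu_1) *)
(* (the index i of the code starts at 0).                                      *)
Inductive extker (mu : seq nat) : talg -> Prop :=
| extker_block (i : nat) (a x b : talg) : (i < size mu)%N ->
    in_tens (sumn (drop i.+1 mu)) a ->
    Jideal x -> in_tens (nth 0%N mu i) x ->
    in_tens (sumn (take i mu)) b ->
    extker mu (a * x * b)
| extker_zero : extker mu 0
| extker_add x y : extker mu x -> extker mu y -> extker mu (x + y).

(* u and v have the same image in the quotient. *)
Definition ext_eq (mu : seq nat) d (u v : tens n d) : Prop :=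
  extker mu (temb (u - v)).

End TensorAlgebra.

Section Tableaux.

Variables l n d : nat.
Variable mu : l.-tuple nat.

(* Each column is listed from bottom to top. *)
Definition filling : finType :=
  {dffun forall i : 'I_l, (tnth mu i).-tuple 'I_n}.

Implicit Types A B : filling.

Definition Col (nu : n.-tuple nat) : {set filling} :=
  [set A : filling |
     [forall i, sorted ltn (map val (A i))]
  && [forall j, (\sum_(i < l) count_mem j (A i))%N == tnth nu j]].

Definition colword A : seq 'I_n := flatten [seq rev (A i) | i <- enum 'I_l].

Lemma size_colword A : size (colword A) = sumn mu.
Proof.
rewrite size_flatten /shape -map_comp sumnE big_map.
rewrite -[in RHS](map_tnth_enum mu) sumnE big_map.
by apply: eq_bigr => i _ /=; rewrite size_rev size_tuple.
Qed.

Definition col_sim A B : bool := [forall i, perm_eq (A i) (B i)].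

Definition col_swap A B : bool :=
  [exists c : 'I_l, exists r : 'I_(tnth mu c), exists r' : 'I_(tnth mu c),
    [&& adjacent r r',
        [forall i, (i != c) ==> (B i == A i)]
      & [forall k, tnth (B c) k == tnth (A c) (tperm r r' k)]]].

(* l'(A, B); the intermediate fillings need not have increasing columns. *)
Definition ellcol A B : nat := gdist col_swap A B.

Hypothesis mu_d : sumn mu = d.

Lemma colword_tupleP A : size (colword A) == d.
Proof. by rewrite size_colword mu_d. Qed.

Definition gamma A : d.-tuple 'I_n := Tuple (colword_tupleP A).

Definition Nbas A : tens n d :=
  \sum_(B | col_sim A B) (- q) ^- ellcol A B *: M (gamma B).

(* A representative in tensor space of N*_A. *)
Definition Nstar A : tens n d := Mstar (gamma A).

Variable nu : n.-tuple nat.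

Definition is_Kbas A (v : tens n d) : Prop :=
  tbar v = v /\
  exists f : filling -> {poly int},
    v = Nbas A + \sum_(B in Col nu) (q^-1 * peval (f B) q^-1) *: Nbas B.

Definition Kbas A : tens n d := epsilon (inhabits 0) (is_Kbas A).

(* k_(A,B); the defining equation only determines it for A in Col. *)
Definition kcoef A B : Qq :=
  epsilon (inhabits (fun=> 0))
    (fun k : filling -> Qq =>
       Kbas B = \sum_(C in Col nu) k C *: Nbas C) A.

Definition is_Kstar A (v : tens n d) : Prop :=
  ext_eq mu (tbar v) v /\
  exists f : filling -> {poly int},
    ext_eq mu v (Nstar A + \sum_(B in Col nu) (q * peval (f B) q) *: Nstar B).

(* A representative in tensor space of K*_A. *)
Definition Kstar A : tens n d := epsilon (inhabits 0) (is_Kstar A).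

(* k*_(A,B); again determined only for A in Col. *)
Definition kstar A B : Qq :=
  epsilon (inhabits (fun=> 0))
    (fun k : filling -> Qq =>
       ext_eq mu (Kstar B) (\sum_(C in Col nu) k C *: Nstar C)) A.

End Tableaux.

(* Main.v *)
Require Import Defs.
From HB Require Import structures.
From Stdlib Require Import ClassicalEpsilon.
From mathcomp Require Import all_boot all_order all_fingroup all_algebra.
From mathcomp Require Import finmap monalg zify ring.

Set Implicit Arguments.
Unset Strict Implicit.
Unset Printing Implicit Defensive.

Import GRing.Theory.
Local Open Scope ring_scope.

(** Both formulas compare coefficients with Kazhdan-Lusztig bases of the whole
    tensor space, and the column-internal part of the sums comes from passing
    to a subspace or to a quotient.

    Let a0 be the weakly increasing word of weight nu. The map h |-> M_(a0) h
    sends H_x to q^(l(d(a)) - l(x)) M_a with a = a0 . x, and it intertwines the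
    bar involutions ([wmap_hact], [tbar_wmap]). So a bar invariant element of
    the Hecke algebra gives one of tensor space. There are two useful choices.

    - The element C_y with y = d(b) gives [Kt b]. Its coefficient at M_c is
      (-q)^(l(d(c)) - l(d(b))) times the alternating sum of P_(zw,y)(q^2) over z
      in S_nu, where w = d(c) ([Kt_coef]).
    - The element C'_u with u the longest element of S_nu d(b) has coefficients
      that are, up to powers of q, constant on the cosets of S_nu. Its image is
      therefore a scalar multiple of an element [Lt b], with coefficients
      q^(l(u) - l(x)) P_(x,u)(q^-2) for x longest in its coset and with
      coefficient 1 at M_b; comparing these coefficients shows that the scalar,
      hence also [Lt b], is bar invariant ([wmap_Cp], [Lt_bar]).

    For the first formula let b be the column reading of B. The columns of B
    increase, so each H_s that exchanges neighbours in a column acts on [Kt b]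
    by -q ([Kt_eigen]), because P_(xs,y) = P_(x,y) when ys < y. A common
    eigenvector of these H_s is determined by its coefficients at the readings
    of the column strict fillings A, and these are its coefficients on the N_A
    ([eigen_expand]). Hence [Kt b] is K_B, and k_(A,B) is its coefficient at the
    reading of A.

    For the second formula let [phi A] be the sum of the coefficients at the
    reversed readings of the fillings C obtained from A by permuting entries
    within columns, weighted by powers of -q. This functional kills the kernel
    of the quotient map ([extker_fA]). Conversely, a vector killed by every
    [phi A] is a sum of elements v (H_s + q) with s internal to a column
    ([W_phi0]); such elements lie in the kernel ([W_extker]), and their span is
    stable under the bar involution ([W_tbar]), since H_s + q is bar invariant.
    So the [phi A] are coordinates on the quotient in the basis N*_A
    ([ext_eqP]). In these coordinates the image of [Lt b], with b the reversed
    reading of B, satisfies the conditions that characterise K*_B, and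
    k*_(A,B) = phi A (Lt b) is a sum over the fillings C as above. The map that
    sends C to d(gamma(C)) identifies this with the sum over the elements of
    D_nu in the double coset S_nu x S_mu ([sim_mincoset]).

    The objects involved are chosen by epsilon from their defining properties,
    so each of them needs an existence proof and a uniqueness proof. All the
    uniqueness proofs for bar invariant elements are instances of
    [bar_triangular_eq0]: a coordinate vector fixed by a unitriangular
    antilinear map vanishes if its entries lie in q^-1 Z[q^-1]. *)

(** * The bar involution of the scalars, and integrality *)

Definition tfr (p : {poly rat}) : Qq := tofrac p.

HB.instance Definition _ := GRing.RMorphism.copy tfr (@FracField.tofrac {poly rat}).

Lemma tfr_inj : injective tfr.
Proof. by move=> x y /eqP; rewrite /tfr tofrac_eq => /eqP. Qed.

Lemma tfr_eq0 p : (tfr p == 0) = (p == 0).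
Proof. exact: tofrac_eq0. Qed.

Lemma frac_repr (f : Qq) :
  f = tfr \n_(generic_quotient.repr f) / tfr \d_(generic_quotient.repr f).
Proof.
have dn0 : \d_(generic_quotient.repr f) != 0 by exact: denom_ratioP.
apply: (canRL (mulfK _)); first by rewrite tfr_eq0.
rewrite /tfr -[X in X * _](generic_quotient.reprK f).
unlock FracField.tofrac; rewrite -[LHS]FracField.pi_mul.
apply/generic_quotient.eqmodP/eqP => /=.
rewrite /FracField.mulf !numden_Ratio ?mulr1 ?oner_neq0 //.
exact: mulrC.
Qed.

Lemma q_neq0 : q != 0.
Proof. by rewrite -[q]/(tfr 'X) tfr_eq0 polyX_eq0. Qed.

Lemma qV_neq0 : q^-1 != 0.
Proof. by rewrite invr_eq0 q_neq0. Qed.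

HB.instance Definition _ := GRing.RMorphism.copy ratC (tfr \o polyC).

Lemma expfV_sub (F : fieldType) (c : F) n i : c != 0 -> (i <= n)%N ->
  c ^+ n * c^-1 ^+ (n - i) = c ^+ i.
Proof.
move=> c0 le_i; rewrite -{1}(subnK le_i) exprD mulrAC exprVn divff ?mul1r //.
by rewrite expf_neq0.
Qed.

(** Evaluation of rational polynomials at a scalar. At q it is the embedding of
    the polynomials in the fractions, and at q^-1 it is the bar involution on
    polynomials; both facts are used to compute with [fbar]. *)
Definition evq (c : Qq) (p : {poly rat}) : Qq := (map_poly ratC p).[c].

Lemma evq_is_zmod c : zmod_morphism (evq c).
Proof. by move=> x y; rewrite /evq rmorphB hornerD hornerN. Qed.
Lemma evq_is_monoid c : monoid_morphism (evq c).
Proof. by split=> [|x y]; rewrite /evq ?rmorph1 ?hornerC // rmorphM hornerM. Qed.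

HB.instance Definition _ c := GRing.isZmodMorphism.Build _ _ (evq c) (evq_is_zmod c).
HB.instance Definition _ c := GRing.isMonoidMorphism.Build _ _ (evq c) (evq_is_monoid c).

Lemma evq_q p : evq q p = tfr p.
Proof.
rewrite -[p]coefK poly_def !rmorph_sum; apply: eq_bigr => i _ /=.
rewrite -mul_polyC !rmorphM /= !rmorphXn /=.
by rewrite /evq map_polyC map_polyX hornerC hornerX.
Qed.

(** Evaluation at c^-1 is evaluation at c of the polynomial with reversed
    coefficients, up to a power of c. This moves questions about q^-1 to q, where
    evaluation is injective. *)
Lemma evq_rev c n (p : {poly rat}) : c != 0 -> (size p <= n.+1)%N ->
  c ^+ n * evq c^-1 p = evq c (\poly_(i < n.+1) p`_(n - i)).
Proof.
move=> c0 sp; rewrite /evq (horner_coef_wide _ (_ : _ <= n.+1)%N); last first.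
  by rewrite size_map_poly.
rewrite (horner_coef_wide _ (_ : _ <= n.+1)%N); last first.
  by rewrite size_map_poly size_poly.
rewrite (reindex_inj rev_ord_inj) mulr_sumr; apply: eq_bigr => i _ /=.
rewrite !coef_map coef_poly /= ltn_ord subSS mulrCA; congr (_ * _).
by rewrite expfV_sub // -ltnS.
Qed.

Lemma tfr_inj0 p : tfr p = 0 -> p = 0.
Proof. by move/eqP; rewrite tfr_eq0 => /eqP. Qed.

Lemma evq_eq0 c p : c = q \/ c = q^-1 -> evq c p = 0 -> p = 0.
Proof.
case=> ->; first by rewrite evq_q; exact: tfr_inj0.
move=> ep; have sp : (size p <= (size p).+1)%N by [].
have := evq_rev q_neq0 sp; rewrite ep mulr0 evq_q => /esym/tfr_inj0/polyP h.
apply/polyP => i; rewrite coef0.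
case: (leqP i (size p)) => [le_i|]; last by move/ltnW => ?; rewrite nth_default.
have := h (size p - i)%N; rewrite coef0 coef_poly ltnS leq_subr.
by rewrite subKn.
Qed.

Lemma evq_neq0 x : x != 0 -> evq q^-1 x != 0.
Proof. by apply: contra => /eqP e; apply/eqP; apply: evq_eq0 e; right. Qed.

(** The value of [fbar] does not depend on the representative: two equal
    fractions have equal cross products, and evaluation at q^-1 preserves them. *)
Lemma fbar_div a b : b != 0 -> fbar (tfr a / tfr b) = evq q^-1 a / evq q^-1 b.
Proof.
move=> b0; rewrite /fbar -!/(evq _ _).
set f := tfr a / tfr b; set r := generic_quotient.repr f.
have d0 : \d_r != 0 by exact: denom_ratioP.
have /tfr_inj e : tfr (a * \d_r) = tfr (\n_r * b).
  have fE : f = tfr \n_r / tfr \d_r by exact: frac_repr.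
  rewrite !(rmorphM tfr); apply/eqP; rewrite -eqr_div ?tfr_eq0 //.
  apply/eqP; exact: fE.
by apply/eqP; rewrite eqr_div ?evq_neq0 // -!rmorphM e.
Qed.

Lemma fbar_tfr a : fbar (tfr a) = evq q^-1 a.
Proof. by rewrite -[tfr a]divr1 -(rmorph1 tfr) fbar_div ?oner_neq0 // rmorph1 divr1. Qed.

Lemma frac_ind (P : Qq -> Prop) :
  (forall a b, b != 0 -> P (tfr a / tfr b)) -> forall f, P f.
Proof. by move=> h f; rewrite (frac_repr f); apply: h; exact: denom_ratioP. Qed.

Lemma fbar_is_zmod : zmod_morphism fbar.
Proof.
elim/frac_ind => a b b0; elim/frac_ind => c e e0.
rewrite -mulNr addf_div ?tfr_eq0 // -rmorphN -!rmorphM -rmorphD.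
rewrite !fbar_div ?mulf_neq0 // -mulNr addf_div ?evq_neq0 //.
by rewrite rmorphD !rmorphM rmorphN.
Qed.

Lemma fbar_is_monoid : monoid_morphism fbar.
Proof.
split; first by rewrite -{1}(rmorph1 tfr) fbar_tfr rmorph1.
elim/frac_ind => a b b0; elim/frac_ind => c e e0.
rewrite mulf_div -!rmorphM !fbar_div ?mulf_neq0 // mulf_div.
by rewrite !rmorphM.
Qed.

HB.instance Definition _ := GRing.isZmodMorphism.Build _ _ fbar fbar_is_zmod.
HB.instance Definition _ := GRing.isMonoidMorphism.Build _ _ fbar fbar_is_monoid.

Lemma fbar_q : fbar q = q^-1.
Proof. by rewrite fbar_tfr /evq map_polyX hornerX. Qed.

Lemma fbar_peval p c : fbar (peval p c) = peval p (fbar c).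
Proof.
rewrite /peval -horner_map -map_poly_comp; congr horner; apply: eq_map_poly => x /=.
exact: rmorph_int.
Qed.

Lemma fbarK : involutive fbar.
Proof.
elim/frac_ind => a b b0; rewrite fbar_div // fmorph_div.
suff h x : fbar (evq q^-1 x) = tfr x by rewrite /= !h.
rewrite -evq_q /evq -horner_map /= fmorphV /= fbar_q invrK -map_poly_comp.
congr horner; apply: eq_map_poly => y /=.
by rewrite /ratC fbar_tfr /evq map_polyC hornerC.
Qed.

Lemma pevalD p r c : peval (p + r) c = peval p c + peval r c.
Proof. by rewrite /peval rmorphD hornerD. Qed.
Lemma pevalN p c : peval (- p) c = - peval p c.
Proof. by rewrite /peval rmorphN hornerN. Qed.
Lemma pevalM p r c : peval (p * r) c = peval p c * peval r c.
Proof. by rewrite /peval rmorphM hornerM. Qed.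
Lemma peval0 c : peval 0 c = 0.
Proof. by rewrite /peval rmorph0 horner0. Qed.
Lemma peval1 c : peval 1 c = 1.
Proof. by rewrite /peval rmorph1 hornerC. Qed.
Lemma pevalX c : peval 'X c = c.
Proof. by rewrite /peval map_polyX hornerX. Qed.
Lemma pevalXn n c : peval 'X^n c = c ^+ n.
Proof. by rewrite /peval map_polyXn hornerXn. Qed.
Lemma pevalZ (m : int) p c : peval (m%:P * p) c = m%:~R * peval p c.
Proof. by rewrite pevalM {1}/peval map_polyC hornerC. Qed.
Lemma peval_sum (I : Type) (s : seq I) (P : pred I) F c :
  peval (\sum_(i <- s | P i) F i) c = \sum_(i <- s | P i) peval (F i) c.
Proof.
by apply: (big_morph (fun p => peval p c)) => [x y|]; rewrite ?pevalD ?peval0.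
Qed.

Definition ratp (p : {poly int}) : {poly rat} := map_poly intr p.

Lemma ratp_eq0 p : ratp p = 0 -> p = 0.
Proof.
move/polyP => h; apply/polyP => i; have := h i.
by rewrite coef_map !coef0 => /eqP; rewrite intr_eq0 => /eqP.
Qed.

Lemma peval_evq p c : peval p c = evq c (ratp p).
Proof.
rewrite /peval /evq /ratp -map_poly_comp; congr horner; apply: eq_map_poly => x /=.
by rewrite rmorph_int.
Qed.

(** A polynomial in q^-1 without constant term and a polynomial in q without
    constant term can only agree if both are 0. *)
Lemma qV_poly_eq0 p r : q^-1 * peval p q^-1 = q * peval r q -> r = 0 /\ p = 0.
Proof.
rewrite !peval_evq => e.
suff r0 : r = 0.
  split=> //; move: e; rewrite r0 /ratp rmorph0 [evq q 0]rmorph0 mulr0 => /eqP.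
  rewrite mulf_eq0 (negPf qV_neq0) /= => /eqP h.
  by apply: ratp_eq0; apply: evq_eq0 h; right.
(* Multiplied by q^n, the left side has degree at most n, and the right side is
   divisible by q^(n + 2). *)
apply: ratp_eq0; move: (ratp r) (ratp p) e => R P e; set n := size P.
have sp : (size P <= n.+1)%N by exact: leqnSn.
have := evq_rev q_neq0 sp.
have -> : evq q^-1 P = q ^+ 2 * evq q R.
  by rewrite expr2 -mulrA -e mulVKf ?q_neq0.
rewrite mulrA -exprD !evq_q -[q]/(tfr 'X) -rmorphXn -rmorphM => /tfr_inj/polyP h.
apply/polyP => i; rewrite coef0; have := h (n + 2 + i)%N.
rewrite coefXnM coef_poly ltnNge leq_addr /= addKn => ->.
by case: ltnP => //; rewrite !ltnS -addnA leqNgt /= -{1}[n]addn0 ltn_add2l.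
Qed.

Lemma peval_sqr_eq0 p : peval p (q ^+ 2) = 0 -> p = 0.
Proof.
rewrite peval_evq -[q]/(tfr 'X) -rmorphXn => e; apply: ratp_eq0.
move: (ratp p) e => P e; have {}e : tfr (P \Po 'X^2) = 0.
  rewrite -e comp_polyE [in RHS]/evq horner_coef rmorph_sum.
  rewrite size_map_poly; apply: eq_bigr => i _ /=.
  by rewrite -mul_polyC rmorphM rmorphXn coef_map.
move/tfr_inj0/eqP: e; rewrite comp_poly_eq0 ?size_polyXn // => /eqP.
exact.
Qed.

(** The sets q^-1 Z[q^-1] and q Z[q], in which the coefficients of canonical
    bases other than the leading one are required to lie. *)
Definition negZ (c : Qq) := exists f : {poly int}, c = q^-1 * peval f q^-1.

Definition posZ (c : Qq) := exists f : {poly int}, c = q * peval f q.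

Lemma negZ_bar0 c : negZ c -> fbar c = c -> c = 0.
Proof.
case=> f ->; rewrite rmorphM /= fmorphV /= fbar_peval fmorphV /= fbar_q invrK.
by move/esym/qV_poly_eq0 => [_ ->]; rewrite peval0 mulr0.
Qed.

Lemma posZ_bar c : posZ c -> negZ (fbar c).
Proof. by case=> f ->; exists f; rewrite rmorphM /= fbar_peval fbar_q. Qed.

Lemma posZ_bar0 c : posZ c -> fbar c = c -> c = 0.
Proof. by move=> /posZ_bar h e; apply: negZ_bar0 => //; rewrite -e. Qed.

Lemma negZ0 : negZ 0. Proof. by exists 0; rewrite peval0 mulr0. Qed.
Lemma negZD x y : negZ x -> negZ y -> negZ (x + y).
Proof. by move=> [f ->] [g ->]; exists (f + g); rewrite pevalD mulrDr. Qed.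
Lemma negZ_sum (I : Type) (s : seq I) (P : pred I) F :
  (forall i, P i -> negZ (F i)) -> negZ (\sum_(i <- s | P i) F i).
Proof. by move=> h; apply: (big_ind negZ negZ0 negZD). Qed.
Lemma negZM (m : int) x : negZ x -> negZ (m%:~R * x).
Proof. by move=> [f ->]; exists (m%:P * f); rewrite pevalZ mulrCA. Qed.
Lemma negZN x : negZ x -> negZ (- x).
Proof. by move/(negZM (-1)); rewrite mulrN1z mulN1r. Qed.
Lemma negZ_exp n x : negZ x -> negZ (q ^- n * x).
Proof.
by move=> [f ->]; exists ('X^n * f); rewrite pevalM pevalXn mulrCA exprVn.
Qed.
Lemma negZ_sign (n : nat) x : negZ x -> negZ ((-1) ^+ n * x).
Proof. by move/(negZM ((-1) ^+ n)); rewrite rmorphXn rmorphN1. Qed.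
Lemma negZ_qV n : (0 < n)%N -> negZ (q ^- n).
Proof. by case: n => // n _; exists 'X^n; rewrite pevalXn -exprS exprVn. Qed.

Lemma posZ_negZ c : negZ (fbar c) -> posZ c.
Proof.
case=> f /(congr1 fbar); rewrite fbarK => ->; exists f.
by rewrite rmorphM /= fbar_peval fmorphV /= fbar_q invrK.
Qed.

(** The degree bound on Kazhdan-Lusztig polynomials is what makes their
    normalised values at q^2 lie in q^-1 Z[q^-1]. *)
Lemma negZ_sqr (p : {poly int}) m : ((size p).*2 <= m.+1)%N ->
  negZ (q ^- m * peval p (q ^+ 2)).
Proof.
move=> sp; rewrite -[p]coefK poly_def peval_sum mulr_sumr; apply: negZ_sum => i _.
rewrite -mul_polyC pevalZ pevalXn -exprM mulrCA; apply: negZM.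
have le_im : (i.*2 < m)%N by have := ltn_ord i; lia.
rewrite mul2n -(subnK (ltnW le_im)) exprD invfM -mulrA mulVf ?expf_neq0 ?q_neq0 //.
by rewrite mulr1; apply: negZ_qV; rewrite subn_gt0.
Qed.

(** The uniqueness half of the theory of canonical bases. By descending
    induction on h, all the terms but the diagonal one vanish in the sum for
    c a, so that c a is bar invariant. *)
Lemma bar_triangular_eq0 (T : finType) (h : T -> nat) (r : T -> T -> Qq) (c : T -> Qq) :
    (forall a, r a a = 1) -> (forall a b, r a b != 0 -> a = b \/ (h a < h b)%N) ->
    (forall a, c a = \sum_b r a b * fbar (c b)) ->
    (forall a, fbar (c a) = c a -> c a = 0) ->
  forall a, c a = 0.
Proof.
move=> r1 rlt ce c0; pose H := \max_b h b.
suff main k a : (H - h a < k)%N -> c a = 0 by move=> a; exact: (main (H - h a).+1).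
elim: k a => // k IH a hk; apply: c0; rewrite [RHS]ce (bigD1 a) //= r1 mul1r.
rewrite big1 ?addr0 // => b ba.
have [->|/rlt [e|lt]] := eqVneq (r a b) 0; first by rewrite mul0r.
  by rewrite e eqxx in ba.
rewrite IH ?rmorph0 ?mulr0 //.
have : (h b <= H)%N by apply: leq_bigmax.
by move: lt hk; lia.
Qed.

(** * Length, inversions and the Bruhat order *)

(** Distances in a graph from a potential: f grows by at most one along each
    edge, so that paths have at least f y steps; and each vertex other than x has
    a predecessor at which f is smaller by one, so that f y steps suffice. The
    predicate P restricts this to a part of the graph that no edge leaves. *)
Lemma gdist_potential (T : finType) (e : rel T) (x : T) (P : pred T) (f : T -> nat) :
    f x = 0%N -> P x ->
    (forall u v, P u -> e u v -> P v /\ (f v <= (f u).+1)%N) ->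
    (forall y, P y -> y != x -> exists u, [/\ P u, e u y & f y = (f u).+1]) ->
  forall y, P y -> gdist e x y = f y.
Proof.
move=> fx Px up down y Py.
have low r (p : r.-tuple T) : path e x p -> (f (last x p) <= r)%N.
  case: p => p /= /eqP <- {r}.
  suff: forall u, P u -> path e u p -> (f (last u p) <= f u + size p)%N.
    by move/(_ x Px); rewrite fx.
  elim: p => [|v p IH] u Pu /=; first by rewrite addn0.
  by case/andP => /(up _ _ Pu) [Pv fv] /(IH _ Pv); lia.
have ex : forall z, P z -> exists p, [/\ path e x p, last x p = z, size p = f z
    & map f (x :: p) = iota 0 (f z).+1].
  move=> z; have [n] := ubnP (f z); elim: n z => // n IH z fz Pz.
  have [->|/(down z Pz) [u [Pu euz fzu]]] := eqVneq z x.
    by exists [::]; rewrite /= fx.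
  have [|p [p1 p2 p3 p4]] := IH u _ Pu; first by rewrite fzu in fz.
  exists (rcons p z); rewrite rcons_path last_rcons size_rcons p1 p2 p3 fzu; split=> //.
  by rewrite -rcons_cons map_rcons p4 fzu -[in RHS]addn1 iotaD -cats1.
have [p [p1 p2 p3 p4]] := ex y Py.
(* The search for the distance only covers numbers below #|T|; the path found has
   distinct values of f, hence distinct vertices. *)
have fT : (f y < #|T|)%N.
  have u : uniq (x :: p) by apply: (map_uniq (f := f)); rewrite p4 iota_uniq.
  have := max_card (mem (x :: p)); rewrite (card_uniqP u) /= p3.
  by [].
rewrite /gdist; set a := (fun r => _).
have ay : a (f y).
  apply/existsP; exists (tcast p3 (in_tuple p)).
  by rewrite val_tcast /= p1 p2 eqxx.
have na r : (r < f y)%N -> a r = false.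
  move=> lt; apply/existsP => -[t /andP[/low h /eqP e']]; move: h; rewrite e'.
  by rewrite leqNgt lt.
have hs : has a (iota 0 #|T|) by apply/hasP; exists (f y); rewrite ?mem_iota.
have := nth_find 0 hs; have := hs; rewrite has_find size_iota => lt.
rewrite nth_iota // add0n => af.
apply/eqP; rewrite eqn_leq; apply/andP; split.
  rewrite leqNgt; apply/negP => /(before_find 0); rewrite nth_iota //.
  by rewrite add0n ay.
by rewrite leqNgt; apply/negP => /na; rewrite af.
Qed.

Section Inversions.

Variable d : nat.
Implicit Types (f g : 'I_d -> nat) (i j k : 'I_d) (w u v s : 'S_d).

(** Inversions of a function on positions rather than of a permutation, so that
    the same lemmas serve for lengths, for words and for fillings. *)
Definition invn f : nat := \sum_(p : 'I_d * 'I_d) ((p.1 < p.2) && (f p.2 < f p.1))%N.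

Lemma eq_inv f g : f =1 g -> invn f = invn g.
Proof. by move=> e; apply: eq_bigr => p _; rewrite !e. Qed.

Lemma adj_lt i j : adjacent i j -> (i < j)%N.
Proof. by rewrite /adjacent => /eqP ->. Qed.

Lemma adj_neq i j : adjacent i j -> i != j.
Proof. by move/adj_lt; apply: contraTneq => ->; rewrite ltnn. Qed.

(** An adjacent transposition changes the order of only one pair of positions. *)
Lemma tperm_adj_lt i j a b : adjacent i j -> a != b ->
  (tperm i j a < tperm i j b)%N = if (a == i) && (b == j) then false
     else if (a == j) && (b == i) then true else (a < b)%N.
Proof.
move=> /eqP e nab.
have h x : tperm i j x = (if x == i :> nat then i.+1 else if x == i.+1 :> nat then i : nat
                          else x) :> nat.
  rewrite -e; case: tpermP => [->|->|/eqP xi /eqP xj].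
  - by rewrite eqxx.
  - by rewrite eqxx; case: eqP => // ->.
  - by rewrite -!(inj_eq val_inj) /= in xi xj; rewrite (negPf xi) (negPf xj).
rewrite !h -!(inj_eq val_inj) /= e; move: nab; rewrite -(inj_eq val_inj) /=.
by do !(case: eqP => //=); lia.
Qed.

(** The other pairs of positions are permuted by the transposition without a
    change of their order. *)
Lemma inv_adj_up f i j : adjacent i j -> (f i < f j)%N ->
  invn (f \o tperm i j) = (invn f).+1.
Proof.
move=> adj lt; pose s := tperm i j; have ij := adj_lt adj.
have nij := adj_neq adj.
pose h (p : 'I_d * 'I_d) := (s p.1, s p.2).
have hK : involutive h by case=> a b; rewrite /h /= !tpermK.
rewrite /invn (bigD1 (i, j)) //= tpermL tpermR ij lt [X in (X + _)%N]/= add1n.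
congr _.+1; rewrite [RHS](bigD1 (i, j)) //= ij ltnNge (ltnW lt) add0n.
rewrite (reindex_inj (inv_inj hK)) /=.
rewrite [LHS](bigID (fun p => p == (i, j))) [RHS](bigID (fun p => p == (j, i))) /=.
rewrite big1 ?add0n; last first.
  by case=> a b /= /andP[_ /eqP[-> ->]]; rewrite tpermL tpermR ltnNge (ltnW ij).
rewrite [in RHS]big1 ?add0n; last first.
  by case=> a b /= /andP[_ /eqP[-> ->]]; rewrite ltnNge (ltnW ij).
apply: eq_big => [[a b]|[a b]] /=.
  rewrite /h !xpair_eqE /= andbC.
  by rewrite !(can2_eq (tpermK i j) (tpermK i j)) tpermL tpermR.
rewrite /h !xpair_eqE /= !(can2_eq (tpermK i j) (tpermK i j)) tpermL tpermR.
move=> /andP[n1 n2]; rewrite !tpermK; congr (nat_of_bool _).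
have [->|nab] := eqVneq a b; first by rewrite !ltnn.
by rewrite tperm_adj_lt // (negPf n1) (negPf n2).
Qed.

Lemma inv_adj_down f i j : adjacent i j -> (f j < f i)%N ->
  invn f = (invn (f \o tperm i j)).+1.
Proof.
move=> adj lt; rewrite -(inv_adj_up adj) /= ?tpermL ?tpermR //.
by apply: eq_inv => x /=; rewrite tpermK.
Qed.

Lemma inv_adj_eq f i j : f i = f j -> f \o tperm i j =1 f.
Proof. by move=> e x /=; case: tpermP => // ->. Qed.

Lemma inv_adj_le f i j : adjacent i j -> (invn (f \o tperm i j) <= (invn f).+1)%N.
Proof.
move=> adj; case: (ltngtP (f i) (f j)) => [/(inv_adj_up adj) -> //| |].
  by move/(inv_adj_down adj) ->; apply/leqW.
by move/inv_adj_eq/eq_inv ->.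
Qed.

Definition pinv w := invn (fun i => w i).

Lemma pinv_pmul w u : pinv (pmul w u) = invn ((fun i => w i : nat) \o u).
Proof. by apply: eq_inv => i /=; rewrite permE. Qed.

Lemma adj_chain f : (forall i j, adjacent i j -> (f i < f j)%N) ->
  forall i j, (i < j)%N -> (f i < f j)%N.
Proof.
move=> h i j; have [n] := ubnP (j - i); elim: n i j => // n IH i j lt_n ij.
have hk : (i.+1 < d)%N by exact: leq_ltn_trans (ltn_ord j).
pose k : 'I_d := Ordinal hk.
have ik : (f i < f k)%N by apply: h; rewrite /adjacent.
have [e|/eqP ne] := eqVneq k j; first by rewrite -e.
apply: (ltn_trans ik); apply: IH => /=; first by move: lt_n ij; lia.
have : k != j :> nat by apply/eqP => /val_inj.
by rewrite /=; move: ij; lia.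
Qed.

(** The value of a permutation at i is the number of smaller values. *)
Lemma perm_order_inj u v :
  (forall i j, (u i < u j)%N = (v i < v j)%N) -> u = v.
Proof.
move=> h; apply/permP => i; apply: val_inj => /=.
have rank w : w i = #|[set j | (w j < w i)%N]| :> nat.
  rewrite -(card_imset _ (@perm_inj _ w)).
  have -> : w @: [set j | (w j < w i)%N] = [set k : 'I_d | (k < w i)%N].
    apply/setP => k; apply/imsetP/idP => [[j] |]; first by rewrite !inE => ? ->.
    by rewrite inE => lt; exists ((w^-1)%g k); rewrite ?inE permKV.
  have le : (w i <= d)%N by apply: ltnW.
  have -> : [set k : 'I_d | (k < w i)%N] = [set widen_ord le x | x : 'I_(w i)].
    apply/setP => k; rewrite inE; apply/idP/imsetP => [lt|[x _ ->]] /=; last exact: ltn_ord.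
    by exists (Ordinal lt) => //; apply: val_inj.
  rewrite card_imset ?card_ord // => x y /(congr1 val) /= e; exact: val_inj.
rewrite (rank u) (rank v); apply: eq_card => j; rewrite !inE; exact: h.
Qed.

Lemma perm_incr1 w : (forall i j, adjacent i j -> (w i < w j)%N) -> w = 1%g.
Proof.
move=> h; apply: perm_order_inj => i j; rewrite !perm1.
have up := adj_chain h.
case: (ltngtP i j) => [/up //|/up lt|/val_inj ->]; last by rewrite ltnn.
by apply/negbTE; rewrite -leqNgt ltnW.
Qed.

Lemma perm_descent w : w != 1%g -> exists i j, adjacent i j /\ (w j < w i)%N.
Proof.
move=> w1; apply: NNPP => h; case/eqP: w1; apply: perm_incr1 => i j adj.
rewrite ltn_neqAle; apply/andP; split.
  by apply: contra (adj_neq adj) => /eqP/val_inj/perm_inj ->.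
by rewrite leqNgt; apply/negP => lt; apply: h; exists i, j.
Qed.

Lemma basicP s : reflect (exists i j, adjacent i j /\ s = tperm i j) (basic_transp s).
Proof.
apply: (iffP existsP) => [[i /existsP [j /andP[a /eqP e]]]|[i [j [a e]]]].
  by exists i, j.
by exists i; apply/existsP; exists j; rewrite a e eqxx.
Qed.

Lemma adj_basic i j : adjacent i j -> basic_transp (tperm i j).
Proof. by move=> a; apply/basicP; exists i, j. Qed.

(** The length counts inversions: multiplication by an adjacent transposition
    changes their number by one, and a permutation other than 1 has a descent. *)
Lemma ellE w : ell w = pinv w.
Proof.
apply: (gdist_potential (P := predT)) => //.
- rewrite /pinv /invn big1 // => -[i j] _ /=; rewrite !perm1.
  by case: ltngtP.
- move=> u v _ /existsP[s /andP[/basicP[i [j [adj ->]]] /eqP ->]]; split=> //.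
  by rewrite pinv_pmul; apply: inv_adj_le.
- move=> y _ /perm_descent [i [j [adj lt]]]; exists (pmul y (tperm i j)); split=> //.
    apply/existsP; exists (tperm i j); rewrite adj_basic //=.
    by rewrite /pmul mulgA tperm2 mul1g.
  by rewrite pinv_pmul -inv_adj_down.
Qed.

Lemma ell_up w i j : adjacent i j -> (w i < w j)%N ->
  ell (pmul w (tperm i j)) = (ell w).+1.
Proof. by move=> a lt; rewrite !ellE pinv_pmul inv_adj_up. Qed.

Lemma ell_down w i j : adjacent i j -> (w j < w i)%N ->
  ell w = (ell (pmul w (tperm i j))).+1.
Proof. by move=> a lt; rewrite !ellE pinv_pmul -inv_adj_down. Qed.

Lemma perm_adj_neq w i j : adjacent i j -> (w i < w j)%N = ~~ (w j < w i)%N.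
Proof.
move=> a; case: (ltngtP (w i) (w j)) => // /val_inj/perm_inj e.
by have := adj_neq a; rewrite e eqxx.
Qed.

Lemma ell_updown w i j : adjacent i j ->
  (ell w < ell (pmul w (tperm i j)))%N = (w i < w j)%N.
Proof.
move=> a; case: (boolP (w i < w j)%N) => [/(ell_up a) ->|]; first exact: ltnSn.
by rewrite (perm_adj_neq w a) negbK => /(ell_down a) ->; lia.
Qed.

Lemma inv_pinv w : pinv (w^-1)%g = pinv w.
Proof.
rewrite /pinv /invn.
pose h (p : 'I_d * 'I_d) := (w p.2, w p.1).
pose k (p : 'I_d * 'I_d) := ((w^-1)%g p.2, (w^-1)%g p.1).
have hK : cancel h k by case=> a b; rewrite /h /k /= !permK.
have kK : cancel k h by case=> a b; rewrite /h /k /= !permKV.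
rewrite (reindex h) /=; last by exists k => x _.
by apply: eq_bigr => p _; rewrite /h /= !permK andbC.
Qed.

Lemma ellV w : ell (w^-1)%g = ell w.
Proof. by rewrite !ellE inv_pinv. Qed.

Lemma ell1 : ell (1%g : 'S_d) = 0%N.
Proof.
rewrite ellE /pinv /invn big1 // => -[i j] _ /=; rewrite !perm1.
by case: ltngtP.
Qed.

Lemma basicV s : basic_transp s -> (s^-1)%g = s.
Proof. by case/basicP => i [j [_ ->]]; rewrite tpermV. Qed.

Lemma basic2 s : basic_transp s -> (s * s)%g = 1%g.
Proof. by case/basicP => i [j [_ ->]]; rewrite tperm2. Qed.

Lemma ell_basic s : basic_transp s -> ell s = 1%N.
Proof.
case/basicP => i [j [a ->]].
have -> : tperm i j = pmul 1%g (tperm i j) by rewrite /pmul mulg1.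
by rewrite ell_up // ?ell1 // !perm1 adj_lt.
Qed.

Lemma ell_parity w : odd (ell w) = odd_perm w.
Proof.
have [n] := ubnP (ell w); elim: n w => // n IH w lt_n.
have [->|/perm_descent [i [j [a lt]]]] := eqVneq w 1%g; first by rewrite ell1 odd_perm1.
have e := ell_down a lt; rewrite e /= IH; last by rewrite -ltnS -e.
by rewrite /pmul odd_permM odd_tperm (adj_neq a) addTb negbK.
Qed.

Lemma sign_ellM (R : pzRingType) u v :
  (-1) ^+ ell (pmul u v) = (-1) ^+ ell u * (-1) ^+ ell v :> R.
Proof.
rewrite -[LHS]signr_odd -[X in _ = X * _]signr_odd -[X in _ = _ * X]signr_odd.
by rewrite !ell_parity /pmul odd_permM -signr_addb addbC.
Qed.

Lemma inv_adj f i j : adjacent i j ->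
  (invn (f \o tperm i j) + (f j < f i) = invn f + (f i < f j))%N.
Proof.
move=> a; case: ltngtP => h.
- by rewrite (inv_adj_down a h) addn0 addn1.
- by rewrite (inv_adj_up a h) addn0 addn1.
- by rewrite (eq_inv (inv_adj_eq (esym h))).
Qed.

(** A transposition of positions further apart is conjugate, by an adjacent
    transposition, to one that is closer; induction on the distance applies. *)
Lemma inv_tperm_up f i j : (i < j)%N -> (f i < f j)%N ->
  (invn f < invn (f \o tperm i j))%N.
Proof.
have [n] := ubnP (j - i); elim: n f j => // n IH f j lt_n ij lt.
have hk : (j.-1 < d)%N by apply: leq_ltn_trans (leq_pred _) (ltn_ord j).
pose k : 'I_d := Ordinal hk.
have kj : adjacent k j by rewrite /adjacent /=; move: ij; lia.
have [e|nik] := eqVneq i k.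
  by have := inv_adj f kj; rewrite -e lt ltnNge (ltnW lt) /=; lia.
have ik : (i < k)%N.
  by move: nik; rewrite -(inj_eq val_inj) /=; move: ij; lia.
have nij : i != j by rewrite -(inj_eq val_inj) /=; move: ij; lia.
(* k is the left neighbour of j, and (i j) = (k j) (i k) (k j). *)
pose s := tperm k j.
have si : s i = i by rewrite tpermD // eq_sym.
have tE : tperm i j = (s * tperm i k * s)%g.
  have : (tperm i k ^ s)%g = tperm i j by rewrite tpermJ si tpermL.
  by rewrite /conjg tpermV mulgA => ->.
have -> : invn (f \o tperm i j) = invn (((f \o s) \o tperm i k) \o s).
  by apply: eq_inv => x; rewrite tE /= !permM.
have lt1 : (invn (f \o s) < invn ((f \o s) \o tperm i k))%N.
  by apply: IH => //=; rewrite ?si ?tpermL //; move: lt_n ij ik => /=; lia.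
have gk : ((f \o s) \o tperm i k) k = f i by rewrite /= tpermR si.
have gj : ((f \o s) \o tperm i k) j = f k.
  by rewrite /= tpermD ?tpermR // adj_neq.
have := inv_adj f kj; have := inv_adj ((f \o s) \o tperm i k) kj.
rewrite gk gj -/s.
by move: lt lt1; case: ltngtP; case: ltngtP => //=; lia.
Qed.

Lemma ell_tperm w i j : (i < j)%N ->
  (ell w < ell (pmul w (tperm i j)))%N = (w i < w j)%N.
Proof.
move=> ij; rewrite !ellE pinv_pmul.
case: (ltngtP (w i) (w j)) => [lt|lt|/val_inj/perm_inj e].
- exact: inv_tperm_up.
- apply/negbTE; rewrite -leqNgt ltnW //.
  have -> : pinv w = invn (((fun i => w i : nat) \o tperm i j) \o tperm i j).
    by apply: eq_inv => x /=; rewrite tpermK.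
  by apply: inv_tperm_up => //=; rewrite tpermL tpermR.
- by move: ij; rewrite e ltnn.
Qed.

Lemma ell_tperm_neq w i j : i != j ->
  (ell w < ell (pmul w (tperm i j)))%N = ((i < j)%N == (w i < w j)%N).
Proof.
move=> nij; have nv : (i : nat) != j by rewrite (inj_eq val_inj).
have nw : (w i : nat) != w j by rewrite (inj_eq val_inj) (inj_eq perm_inj).
case: (ltngtP i j) nv => // lt _; first by rewrite ell_tperm.
by rewrite tpermC ell_tperm //; case: ltngtP nw.
Qed.

Implicit Types (x y z : 'S_d).

Lemma bruhat_ell x y : bruhat x y -> x = y \/ (ell x < ell y)%N.
Proof.
case/connectP => p; elim: p x => [|z p IH] x /=; first by left.
move=> /andP[/existsP[i /existsP[j /andP[_ lt]]] pth] e; right.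
by case: (IH z pth e) => [<- //|lt2]; exact: ltn_trans lt lt2.
Qed.

Lemma bruhat_refl x : bruhat x x. Proof. exact: connect0. Qed.
Lemma bruhat_trans y x z : bruhat x y -> bruhat y z -> bruhat x z.
Proof. exact: connect_trans. Qed.

Lemma bruhat_refln x i j : (ell x < ell (pmul x (tperm i j)))%N ->
  bruhat x (pmul x (tperm i j)).
Proof. by move=> lt; apply: connect1; apply/existsP; exists i; apply/existsP; exists j; rewrite eqxx. Qed.

(** The lifting property, along a chain of reflections: conjugation by an
    adjacent transposition s preserves the direction of each reflection, except
    for the reflection that s itself defines. *)
Lemma bruhat_lift x y i j : adjacent i j -> bruhat x y ->
  bruhat (pmul x (tperm i j)) y \/ bruhat (pmul x (tperm i j)) (pmul y (tperm i j)).
Proof.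
move=> a /connectP [p]; set s := tperm i j.
elim: p x => [|z p IH] x /=; first by move=> _ ->; right; exact: bruhat_refl.
case/andP => /existsP[k /existsP[l /andP[/eqP zE lt]]] pth yE.
have zy : bruhat z y by apply/connectP; exists p.
have nkl : k != l.
  apply: contraTneq lt => e; rewrite zE e tperm1 /pmul mul1g ltnn //.
have {IH} := IH _ pth yE.
(* In the exceptional case the first reflection of the chain is s itself. *)
have [e|ne] := eqVneq (pmul x s) z; first by move=> _; left; rewrite e.
have st : bruhat (pmul x s) (pmul z s).
  have zs : pmul z s = pmul (pmul x s) (tperm (s k) (s l)).
    rewrite zE /pmul -tpermJ /conjg tpermV !mulgA; congr (_ * _)%g.
    by rewrite -!mulgA tperm2 mulg1.
  rewrite zs; apply: bruhat_refln; move: lt.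
  rewrite zE !ell_tperm_neq ?(inj_eq perm_inj) // /pmul !permM !tpermK => /eqP <-.
  rewrite tperm_adj_lt //.
  case: ifP => [/andP[/eqP ek /eqP el]|_].
    by move: ne; rewrite zE ek el eqxx.
  case: ifP => // /andP[/eqP ek /eqP el].
  by move: ne; rewrite zE ek el [tperm j i]tpermC eqxx.
case=> h; [left|right]; exact: bruhat_trans h.
Qed.

Definition asc f : nat := \sum_(p : 'I_d * 'I_d) ((p.1 < p.2) && (f p.1 < f p.2))%N.
(** The pairs of positions with distinct values. Their number is invariant under
    permutations, and reversal exchanges inversions and non-inversions among
    them; so lengths before and after multiplication by w_d add up to it. *)
Definition dpairs f : nat := \sum_(p : 'I_d * 'I_d) ((p.1 < p.2) && (f p.1 != f p.2))%N.

Lemma inv_asc f : (invn f + asc f)%N = dpairs f.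
Proof.
rewrite -big_split; apply: eq_bigr => p _ /=.
by case: (p.1 < p.2)%N => //=; case: (ltngtP (f p.1) (f p.2)).
Qed.

Lemma inv_rev f : invn (f \o @rev_ord d) = asc f.
Proof.
pose h (p : 'I_d * 'I_d) := (rev_ord p.2, rev_ord p.1).
have hK : involutive h by case=> a b; rewrite /h /= !rev_ordK.
rewrite /invn (reindex_inj (inv_inj hK)); apply: eq_bigr => -[a b] _ /=.
rewrite !rev_ordK; congr (nat_of_bool (_ && _)).
by have := ltn_ord a; have := ltn_ord b; lia.
Qed.

Lemma dpairs_perm f w : dpairs (f \o w) = dpairs f.
Proof.
have dbl g : (dpairs g).*2 = \sum_(p : 'I_d * 'I_d) (g p.1 != g p.2 : nat).
  pose h (p : 'I_d * 'I_d) := (p.2, p.1).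
  have hK : involutive h by case.
  rewrite -addnn {2}/dpairs (reindex_inj (inv_inj hK)) -big_split.
  apply: eq_bigr => -[a b] _ /=; case: (ltngtP a b) => //=.
    by rewrite addn0.
  + by rewrite eq_sym.
  + by move/val_inj => ->; rewrite eqxx.
apply: double_inj; rewrite !dbl.
rewrite [RHS](reindex (fun p => (w p.1, w p.2))) //=.
exists (fun p => ((w^-1)%g p.1, (w^-1)%g p.2)) => -[a b] _ /=; by rewrite ?permK ?permKV.
Qed.

Lemma wlongE i : wlong d i = rev_ord i. Proof. by rewrite permE. Qed.

Lemma ell_wlong w : (ell (pmul w (wlong d)) + ell w = dpairs (fun i : 'I_d => i))%N.
Proof.
rewrite !ellE pinv_pmul; set f := fun i => _.
have -> : invn (f \o wlong d) = invn (f \o @rev_ord d).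
  by apply: eq_inv => x /=; rewrite wlongE.
by rewrite inv_rev addnC inv_asc -(dpairs_perm (fun i : 'I_d => i) w).
Qed.

End Inversions.

(** * Words and minimal coset representatives *)

(** A strict total order on positions is the order of the values of a unique
    permutation, which sends a position to its rank. *)
Lemma strict_total_rank (d : nat) (lt : rel 'I_d) :
    irreflexive lt -> transitive lt -> (forall i j, i != j -> lt i j || lt j i) ->
  exists u : 'S_d, forall i j, (u i < u j)%N = lt i j.
Proof.
move=> irr tr tot; pose r i := #|[set j | lt j i]|.
have rd i : (r i < d)%N.
  rewrite -[X in (_ < X)%N](card_ord d); apply: proper_card.
  by apply/properP; split=> [|]; [exact/subsetP | exists i; rewrite ?inE ?irr].
have mono i j : lt i j -> (r i < r j)%N.
  move=> ij; apply: proper_card; apply/properP; split.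
    by apply/subsetP => k; rewrite !inE => /tr; exact.
  by exists i; rewrite !inE ?irr.
have rE i j : (r i < r j)%N = lt i j.
  have [->|/tot/orP[h|h]] := eqVneq i j; first by rewrite ltnn irr.
    by rewrite h mono.
  rewrite ltnNge (ltnW (mono _ _ h)) /=; apply/esym/negbTE/negP => h2.
  by have := tr _ _ _ h h2; rewrite irr.
have rinj : injective (fun i => Ordinal (rd i)).
  move=> i j /(congr1 val) /= e; apply/eqP; apply: contraT => /tot.
  by rewrite -!rE e ltnn.
by exists (perm rinj) => i j; rewrite !permE /= rE.
Qed.

Section Tuples.

Variables n d : nat.
Implicit Types (a b : d.-tuple 'I_n) (u w x y z : 'S_d) (i j k : 'I_d).

(** Letters as natural numbers. *)
Definition av a i : nat := tnth a i.

Definition lexlt a i j : bool :=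
  ((av a i < av a j) || ((av a i == av a j) && (i < j)))%N.

Lemma std_ex a : exists u : 'S_d, [forall i, forall j, (u i < u j)%N == lexlt a i j].
Proof.
have [|||u h] := @strict_total_rank d (lexlt a).
- by move=> i; rewrite /lexlt !ltnn andbF.
- move=> j i k; rewrite /lexlt; move: (av a i) (av a j) (av a k) => p r t; lia.
- move=> i j; rewrite -(inj_eq val_inj) /lexlt /=.
  by move: (av a i) (av a j) => p r; lia.
by exists u; apply/forallP => i; apply/forallP => j; rewrite h.
Qed.

(** The standardisation of a word: letters are ranked by size, and equal letters
    from left to right. It is the permutation d(a) (see [dpermE]), and it is
    defined without reference to the weight of a. *)
Definition std a : 'S_d := xchoose (std_ex a).

Lemma std_lt a i j : (std a i < std a j)%N = lexlt a i j.
Proof. by have /forallP/(_ i)/forallP/(_ j)/eqP := xchooseP (std_ex a). Qed.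

Lemma std_uniq a u : (forall i j, (u i < u j)%N = lexlt a i j) -> u = std a.
Proof. by move=> h; apply: perm_order_inj => i j; rewrite h std_lt. Qed.

Definition invt a := invn (av a).

Lemma tactE a x i : tnth (tact a x) i = tnth a (x i).
Proof. by rewrite tnth_mktuple. Qed.

Lemma av_tact a x : av (tact a x) =1 av a \o x.
Proof. by move=> i; rewrite /av tactE. Qed.

Lemma tactM a x y : tact (tact a x) y = tact a (pmul x y).
Proof. by apply: eq_from_tnth => i; rewrite !tactE permM. Qed.

Lemma tact1 a : tact a 1%g = a.
Proof. by apply: eq_from_tnth => i; rewrite !tactE perm1. Qed.

Lemma tactK a x : tact (tact a x) (x^-1)%g = a.
Proof. by rewrite tactM /pmul mulVg tact1. Qed.

Lemma tactKV a x : tact (tact a (x^-1)%g) x = a.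
Proof. by rewrite tactM /pmul mulgV tact1. Qed.

Lemma tact_inj x : injective (fun a => tact a x).
Proof. by move=> a b /(congr1 (fun c => tact c (x^-1)%g)); rewrite !tactK. Qed.

Lemma ell_std a : ell (std a) = invt a.
Proof.
rewrite ellE; apply: eq_bigr => -[i j] _ /=; rewrite std_lt /lexlt.
by case: (ltngtP i j) => //= ij; rewrite andbF orbF.
Qed.

(** The weakly increasing rearrangement. *)
Definition sorta a := tact a ((std a)^-1)%g.

Lemma sortaK a : tact (sorta a) (std a) = a.
Proof. exact: tactKV. Qed.

Lemma av_nth a i : av a i = nth 0%N (map val a) i.
Proof.
have x0 := tnth a i; rewrite (nth_map x0) ?size_tuple ?ltn_ord //.
by rewrite /av (tnth_nth x0).
Qed.

Lemma wincrP a : reflect (forall i j, (i < j)%N -> (av a i <= av a j)%N) (wincr a).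
Proof.
rewrite /wincr (sorted_pairwise leq_trans).
have sz : size (map val a) = d by rewrite size_map size_tuple.
apply: (iffP (pairwiseP 0%N)) => h.
  by move=> i j ij; rewrite !av_nth; apply: h; rewrite ?inE ?sz.
move=> i j; rewrite !inE !sz => hi hj ij.
by have := h (Ordinal hi) (Ordinal hj) ij; rewrite !av_nth.
Qed.

Lemma wincr_sorta a : wincr (sorta a).
Proof.
apply/wincrP => i j ij; rewrite !av_tact /=.
have : lexlt a ((std a)^-1%g i) ((std a)^-1%g j) by rewrite -std_lt !permKV.
by case/orP => [/ltnW //|/andP[/eqP -> _]].
Qed.

Lemma wincr_uniq a w : wincr a -> wincr (tact a w) -> tact a w = a.
Proof.
move=> sa sb; apply: val_inj; apply: (inj_map val_inj).
apply: (sorted_eq leq_trans anti_leq) => //; apply: perm_map.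
by apply/tuple_permP; exists w.
Qed.

Lemma std_wincr a : wincr a -> std a = 1%g.
Proof.
move/wincrP => h; apply/esym/std_uniq => i j; rewrite !perm1 /lexlt.
case: (ltngtP i j) => [/h|/h|/val_inj ->]; last by rewrite ltnn eqxx.
  by rewrite leq_eqVlt andbT orbC.
by rewrite andbF orbF ltnNge => ->.
Qed.

Lemma sorta_wincr a : wincr a -> sorta a = a.
Proof. by move=> h; rewrite /sorta std_wincr // invg1 tact1. Qed.

Lemma sorta_tact a w : sorta (tact a w) = sorta a.
Proof.
have h : tact (sorta a) (pmul (pmul (std a) w) ((std (tact a w))^-1)%g) = sorta (tact a w).
  by rewrite -!tactM sortaK.
by rewrite -h; apply: wincr_uniq; rewrite ?wincr_sorta // h wincr_sorta.
Qed.

Lemma invt_tact a w : invt (tact a w) = invn (av a \o w).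
Proof. exact/eq_inv/av_tact. Qed.

Lemma invt_term a x (p : 'I_d * 'I_d) : wincr a ->
  (((p.1 < p.2) && (av (tact a x) p.2 < av (tact a x) p.1)) <=
   ((p.1 < p.2) && (x p.2 < x p.1)))%N.
Proof.
move/wincrP => h; case: (p.1 < p.2)%N => //=; rewrite !av_tact /=.
case: (ltngtP (x p.2) (x p.1)) => // [|/h|/val_inj ->]; rewrite ?leq_b1 ?ltnn //.
by rewrite ltnNge => ->.
Qed.

(** An inversion of a0 . x is an inversion of x when a0 is weakly increasing. *)
Lemma invt_le_ell a x : wincr a -> (invt (tact a x) <= ell x)%N.
Proof. by move=> h; rewrite ellE; apply: leq_sum => p _; apply: invt_term. Qed.

(** Equality holds in [invt_le_ell] only if x has no inversion between equal
    letters, which characterises the standardisation. *)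
Lemma invt_eq_ell a x : wincr a -> invt (tact a x) = ell x -> x = std (tact a x).
Proof.
move=> h; rewrite ellE /pinv /invt /invn => /eqP.
pose E1 (p : 'I_d * 'I_d) : nat := (p.1 < p.2)%N && (av (tact a x) p.2 < av (tact a x) p.1)%N.
pose E2 (p : 'I_d * 'I_d) : nat := (p.1 < p.2)%N && (x p.2 < x p.1)%N.
have le p : true -> (E1 p <= E2 p ?= iff (E1 p == E2 p))%N.
  by move=> _; split; first exact: invt_term.
rewrite (leqif_sum le) => /forallP e.
have {}e i j : (i < j)%N -> (x j < x i)%N = (av (tact a x) j < av (tact a x) i)%N.
  by move=> ij; have := e (i, j); rewrite /E1 /E2 /= ij /=; do 2 case: (_ < _)%N.
apply: std_uniq => i j; rewrite /lexlt.
case: (ltngtP i j) => [ij|ji|/val_inj ->]; last by rewrite !ltnn eqxx.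
  have : (x i : nat) != x j by rewrite (inj_eq val_inj) (inj_eq perm_inj) -(inj_eq val_inj) neq_ltn ij.
  have := e _ _ ij; move: (av _ i) (av _ j) (x i : nat) (x j : nat) => p r t u; lia.
by have := e _ _ ji => ->; rewrite andbF orbF.
Qed.

Lemma std_tact_adj a i j : adjacent i j -> av a i != av a j ->
  std (tact a (tperm i j)) = pmul (std a) (tperm i j).
Proof.
move=> adj ne; apply/esym/std_uniq => k l; rewrite !permM std_lt /lexlt !av_tact /=.
have [->|nkl] := eqVneq k l; first by rewrite !ltnn.
rewrite tperm_adj_lt //.
case: ifP => [/andP[/eqP-> /eqP->]|_].
  by rewrite tpermL tpermR eq_sym (negPf ne).
by case: ifP => // /andP[/eqP-> /eqP->]; rewrite tpermL tpermR (negPf ne).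
Qed.

(** Equal letters at adjacent positions get consecutive ranks. *)
Lemma std_adj_eq a i j : adjacent i j -> av a i = av a j -> adjacent (std a i) (std a j).
Proof.
move=> adj e; have lt : (std a i < std a j)%N by rewrite std_lt /lexlt e eqxx adj_lt // orbT.
apply: contraT => h; have {}h : ((std a i).+1 < std a j)%N.
  by move: h lt; rewrite /adjacent; lia.
pose z := ((std a)^-1)%g (Ordinal (ltn_trans h (ltn_ord _))).
have z1 : (std a i < std a z)%N by rewrite permKV /=.
have z2 : (std a z < std a j)%N by rewrite permKV /=.
move: z1 z2; rewrite !std_lt /lexlt e; move: adj => /eqP.
by move: (av a z) (av a j) => p r; lia.
Qed.

Lemma std_conj a i j :
  pmul (std a) (tperm i j) = pmul (tperm (std a i) (std a j)) (std a).
Proof. by rewrite /pmul -tpermJ /conjg !mulgA mulgV mul1g. Qed.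

Lemma invt_dpairs a : (invt (tact a (wlong d)) + invt a = dpairs (av a))%N.
Proof.
have -> : invt (tact a (wlong d)) = asc (av a).
  by rewrite -inv_rev; apply: eq_inv => i; rewrite av_tact /= wlongE.
by rewrite addnC inv_asc.
Qed.

Lemma dpairs_tact a w : dpairs (av (tact a w)) = dpairs (av a).
Proof.
rewrite -[RHS](dpairs_perm (av a) w); apply: eq_bigr => p _.
by rewrite !av_tact.
Qed.

Lemma rev_tuple_wlong a : [tuple of rev a] = tact a (wlong d).
Proof.
apply: eq_from_tnth => i; rewrite tactE wlongE.
have x0 := tnth a i.
by rewrite !(tnth_nth x0) /= nth_rev ?size_tuple.
Qed.

Variable nu : n.-tuple nat.
Hypothesis nu_d : sumn nu = d.

Definition weight a := forall j : 'I_n, count_mem j a = tnth nu j.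

Lemma weight_tact a w : weight (tact a w) -> weight a.
Proof.
move=> h j; rewrite -h; apply/seq.permP; rewrite perm_sym; by apply/tuple_permP; exists w.
Qed.

Lemma weight_tact_iff a w : weight (tact a w) <-> weight a.
Proof. by split; [exact: weight_tact | rewrite -{1}(tactK a w); exact: weight_tact]. Qed.

(** Both sides are the weakly increasing word in which each letter j occurs
    nu_j times. *)
Lemma weight_wincr a i : weight a -> wincr a -> av a i = reshape_index nu i.
Proof.
move=> wa sa; pose s' := flatten [seq nseq (tnth nu j) (j : nat) | j : 'I_n <- enum 'I_n].
have sh : shape [seq nseq (tnth nu j) (j : nat) | j : 'I_n <- enum 'I_n] = nu.
  rewrite /shape -map_comp -[RHS]map_tnth_enum; apply: eq_map => j /=.
  by rewrite size_nseq.
have e : map val a = s'.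
  apply: (sorted_eq leq_trans anti_leq) => //.
    rewrite (sorted_pairwise leq_trans) /s'.
    have : sorted ltn (map val (enum 'I_n)) by rewrite val_enum_ord iota_ltn_sorted.
    elim: (enum 'I_n) => //= j s IH; rewrite path_sortedE; last exact: ltn_trans.
    case/andP => /allP lt /IH {}IH; rewrite pairwise_cat IH andbT.
    apply/andP; split; last by elim: (tnth nu j) => //= m ->; rewrite all_nseq leqnn orbT.
    apply/allrelP => u v /nseqP[-> _] /flatten_mapP[k ks /nseqP[-> _]].
    by apply/ltnW/lt/map_f.
    (* Counting is additive over the letters of the alphabet. *)
  apply/seq.permP => P.
  have key (T : eqType) (s : seq T) (Q : pred T) (en : seq T) : uniq en -> {subset s <= en} ->
      count Q s = (\sum_(j <- en) Q j * count_mem j s)%N.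
    move=> uen sub; elim: s sub => [|x s IH] sub /=.
      by rewrite big1 // => j _; rewrite muln0.
    rewrite IH; last by move=> y ys; apply: sub; rewrite inE ys orbT.
    under [RHS]eq_bigr => j _ do rewrite mulnDr.
    rewrite big_split /=; congr (_ + _)%N.
    rewrite (bigD1_seq x) //=; last by apply: sub; rewrite inE eqxx.
    rewrite eqxx muln1 big1 ?addn0 // => j /negPf; rewrite eq_sym => ->.
    by rewrite muln0.
  rewrite count_map (key _ _ _ (enum 'I_n)) ?enum_uniq //; last by move=> y; rewrite mem_enum.
  rewrite count_flatten sumnE !big_map; apply: eq_bigr => j _.
  by rewrite wa count_nseq mulnC.
have hi : (i < size (map val a))%N by rewrite size_map size_tuple.
rewrite av_nth e nth_flatten sh.
have hr : (reshape_index nu i < n)%N.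
  by rewrite -[X in (_ < X)%N](size_tuple nu) reshape_indexP // nu_d.
rewrite (nth_map (Ordinal hr)) ?size_enum_ord // (nth_enum_ord _ hr).
rewrite nth_nseq; case: ifP => // /negP [].
have -> : tnth nu (nth (Ordinal hr) (enum 'I_n) (reshape_index nu i))
    = nth 0%N nu (reshape_index nu i).
  by rewrite (tnth_nth 0%N) (nth_enum_ord _ hr).
by apply: reshape_offsetP; rewrite nu_d.
Qed.

(** S_nu consists of the permutations that preserve the blocks of equal letters
    of the weakly increasing word of weight nu. *)
Lemma parab_stab a z : weight a -> wincr a -> (z \in parab d nu) = (tact a z == a).
Proof.
move=> wa sa; rewrite inE; apply/forallP/eqP => [h|h i].
  apply: eq_from_tnth => i; rewrite tactE; apply: val_inj => /=.
  by rewrite -!/(av a _) !weight_wincr //; exact/eqP.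
by rewrite -!(weight_wincr _ wa sa) -[in X in _ == X]h av_tact.
Qed.

Lemma std_mincoset a : weight a -> std a \in mincoset d nu.
Proof.
move=> wa; rewrite inE; apply/forallP => z; apply/implyP.
have ws : weight (sorta a) by apply/weight_tact_iff.
rewrite (parab_stab _ ws) ?wincr_sorta // => /eqP e.
have -> : ell (std a) = invt (tact (sorta a) (pmul z (std a))).
  by rewrite -tactM e sortaK ell_std.
exact/invt_le_ell/wincr_sorta.
Qed.

(** An element of minimal length in S_nu x is no longer than d(a0 . x), which
    lies in the same coset; so [invt_eq_ell] applies. *)
Lemma mincoset_std a x : weight a -> wincr a -> x \in mincoset d nu ->
  x = std (tact a x).
Proof.
move=> wa sa; rewrite inE => /forallP h.
apply: invt_eq_ell => //; apply/eqP; rewrite eqn_leq invt_le_ell //=.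
set b := tact a x; have zz : pmul (pmul (std b) (x^-1)%g) x = std b.
  by rewrite /pmul mulgA mulgV mul1g.
rewrite -ell_std -zz; move/implyP: (h (pmul (std b) (x^-1)%g)); apply.
rewrite (parab_stab _ wa sa); apply/eqP.
have sb : sorta b = a by rewrite sorta_tact sorta_wincr.
by rewrite -{1}sb -tactM sortaK /b tactK.
Qed.

Lemma dpermE a : weight a -> dperm nu a = std a.
Proof.
move=> wa; rewrite /dperm; case: pickP => [x /andP[xm xw] /=|].
  have wx : weight (tact a (x^-1)%g) by apply/weight_tact_iff.
  by rewrite (mincoset_std wx xw xm) tactKV.
by move/(_ (std a)); rewrite std_mincoset //= -/(sorta a) wincr_sorta.
Qed.

End Tuples.

(** * The Hecke algebra *)

(* Conversion problems between vectors would otherwise unfold scalars and lengths. *)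
Opaque Qq ell q.

Section Semilinear.

(** Linear and antilinear maps are treated together: s is the identity or the
    bar involution. *)
Definition semilin (s : Qq -> Qq) (U V : lmodType Qq) (f : U -> V) : Prop :=
  {morph f : u v / u + v} /\ forall (c : Qq) v, f (c *: v) = s c *: f v.

Implicit Types (U V W : lmodType Qq) (T : finType).

Lemma linear_semilin U V (f : U -> V) : linear f <-> semilin id f.
Proof.
split=> [lf|[fD fZ] a u v]; last by rewrite fD fZ.
have f0 : f 0 = 0.
  have := lf 0 0 0; rewrite !scale0r !add0r => e.
  by apply: (addrI (f 0)); rewrite addr0 -{1}[f 0]scale1r -lf scale1r addr0.
split=> [u v|c v]; first by rewrite -[u]scale1r lf !scale1r.
by rewrite -[c *: v]addr0 lf f0 addr0.
Qed.

Lemma semilin_comp s t U V W (f : U -> V) (g : V -> W) :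
  semilin s f -> semilin t g -> semilin (t \o s) (g \o f).
Proof. by move=> [fD fZ] [gD gZ]; split=> [u v|c v] /=; rewrite ?fD ?gD ?fZ ?gZ. Qed.

Section One.
Variables (s : {rmorphism Qq -> Qq}) (U V : lmodType Qq) (f : U -> V).
Hypothesis lf : semilin s f.

Lemma semilin0 : f 0 = 0.
Proof. by case: lf => _ fZ; rewrite -(scale0r 0) fZ rmorph0 !scale0r. Qed.

Lemma semilinN v : f (- v) = - f v.
Proof. by case: lf => _ fZ; rewrite -scaleN1r fZ rmorphN1 scaleN1r. Qed.

Lemma semilinB u v : f (u - v) = f u - f v.
Proof. by rewrite (proj1 lf) semilinN. Qed.

Lemma semilin_sum (I : Type) (r : seq I) (P : pred I) (v : I -> U) :
  f (\sum_(i <- r | P i) v i) = \sum_(i <- r | P i) f (v i).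
Proof. by apply: (big_morph f (proj1 lf)); exact: semilin0. Qed.
End One.

(** The basis vectors of a space of finite functions; the bases H_w and M_a are
    instances by conversion. *)
Definition dl T (t : T) : {ffun T -> Qq^o} := [ffun x => (x == t)%:R].

Lemma ffun_dl T (v : {ffun T -> Qq^o}) : v = \sum_t (v t : Qq) *: dl t.
Proof.
apply/ffunP => x; rewrite sum_ffunE (bigD1 x) //= !ffunE eqxx [_ *: _]mulr1 big1 ?addr0 //.
by move=> y ne; rewrite !ffunE eq_sym (negPf ne) [_ *: _]mulr0.
Qed.

Lemma semilin_ext (s : {rmorphism Qq -> Qq}) T V (f g : {ffun T -> Qq^o} -> V) :
  semilin s f -> semilin s g -> (forall t, f (dl t) = g (dl t)) -> f =1 g.
Proof.
move=> lf lg e v; rewrite (ffun_dl v) (semilin_sum lf) (semilin_sum lg).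
by apply: eq_bigr => t _; rewrite (proj2 lf) (proj2 lg) e.
Qed.

Definition linext (s : Qq -> Qq) T V (F : T -> V) (v : {ffun T -> Qq^o}) : V :=
  \sum_t s (v t) *: F t.

Lemma linext_semilin (s : {rmorphism Qq -> Qq}) T V (F : T -> V) : semilin s (linext s F).
Proof.
split=> [u v|c v]; rewrite /linext.
  by rewrite -big_split; apply: eq_bigr => t _; rewrite ffunE rmorphD scalerDl.
by rewrite scaler_sumr; apply: eq_bigr => t _; rewrite ffunE rmorphM scalerA.
Qed.

Lemma linext_dl (s : {rmorphism Qq -> Qq}) T V (F : T -> V) t : linext s F (dl t) = F t.
Proof.
rewrite /linext (bigD1 t) //= ffunE eqxx rmorph1 scale1r big1 ?addr0 //.
by move=> y ne; rewrite ffunE (negPf ne) rmorph0 scale0r.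
Qed.

Lemma semilin_id U : semilin id (@id U). Proof. by []. Qed.

Lemma semilin_eqS (s t : Qq -> Qq) U V (f : U -> V) : s =1 t -> semilin s f -> semilin t f.
Proof. by move=> e [fD fZ]; split=> // c v; rewrite fZ e. Qed.

End Semilinear.

Notation ridq := (idfun : {rmorphism Qq -> Qq}).
Notation rbar := (fbar : {rmorphism Qq -> Qq}).

Lemma scale_swap (R : comNzRingType) (V : lmodType R) (A B C X : V) (a b : R) :
  A - b *: B - a *: (C - b *: X) = A - a *: C - b *: (B - a *: X).
Proof.
by rewrite !scalerBr !opprB !scalerA [b * a]mulrC [LHS](AC (2*2) ((1*4)*(3*2))).
Qed.

Lemma linZ (U V : lmodType Qq) (f : U -> V) c v : semilin ridq f -> f (c *: v) = c *: f v.
Proof. by case=> _ ->. Qed.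

Lemma barZ (U V : lmodType Qq) (f : U -> V) c v :
  semilin rbar f -> f (c *: v) = fbar c *: f v.
Proof. by case=> _ ->. Qed.

Lemma semiD s (U V : lmodType Qq) (f : U -> V) u v : semilin s f -> f (u + v) = f u + f v.
Proof. by case=> ->. Qed.

Fact hc_key : unit. Proof. exact tt. Qed.

(** The constant q - q^-1. It is locked because otherwise the conversion of vectors
    unfolds it into fractions of polynomials. *)
Definition hc : Qq := locked_with hc_key (q - q^-1).

Lemma hcE : hc = q - q^-1. Proof. by rewrite /hc unlock. Qed.

Section HeckeProduct.

Variable d : nat.
Implicit Types (w u v x y s t : 'S_d) (i j : 'I_d).
Local Notation H := (hecke d).
Local Notation c0 := hc.

Lemma pmulK w s : basic_transp s -> pmul (pmul w s) s = w.
Proof. by move=> bs; rewrite /pmul mulgA basic2 // mul1g. Qed.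

Lemma pmulKl w s : basic_transp s -> pmul s (pmul s w) = w.
Proof. by move=> bs; rewrite /pmul -mulgA basic2 // mulg1. Qed.

Lemma pmulA w u v : pmul (pmul w u) v = pmul w (pmul u v).
Proof. by rewrite /pmul mulgA. Qed.

Lemma pmulV w u : ((pmul w u)^-1)%g = pmul (u^-1)%g (w^-1)%g.
Proof. by rewrite /pmul invMg. Qed.

Lemma pmul1 w : pmul w 1%g = w. Proof. exact: mul1g. Qed.
Lemma pmul1l w : pmul 1%g w = w. Proof. exact: mulg1. Qed.

Lemma ell_pmul_basic w s : basic_transp s ->
  if (ell w < ell (pmul w s))%N then ell (pmul w s) = (ell w).+1
  else ell w = (ell (pmul w s)).+1.
Proof.
case/basicP => i [j [a ->]]; rewrite ell_updown //.
by case: ifP => [/(ell_up a) //|/negbT]; rewrite (perm_adj_neq w a) negbK => /(ell_down a).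
Qed.

Lemma ell_down_basic w s : basic_transp s -> (ell w < ell (pmul w s))%N = false ->
  ell w = (ell (pmul w s)).+1.
Proof. by move=> bs lt; have := ell_pmul_basic w bs; rewrite lt. Qed.

(** Induction on length by right multiplication with descents. *)
Lemma ell_ind (P : 'S_d -> Prop) : P 1%g ->
  (forall w s, basic_transp s -> ell w = (ell (pmul w s)).+1 -> P (pmul w s) -> P w) ->
  forall w, P w.
Proof.
move=> P1 PS w; have [n] := ubnP (ell w); elim: n w => // n IH w lt_n.
have [->//|/perm_descent [i [j [a lt]]]] := eqVneq w 1%g.
have e := ell_down a lt; apply: (PS _ _ (adj_basic a) e); apply: IH.
by rewrite -ltnS -e.
Qed.

Lemma ell_indl (P : 'S_d -> Prop) : P 1%g ->
  (forall w s, basic_transp s -> ell w = (ell (pmul s w)).+1 -> P (pmul s w) -> P w) ->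
  forall w, P w.
Proof.
move=> P1 PS w; rewrite -[w]invgK; elim/ell_ind: (w^-1)%g => [|{}w s bs e IH].
  by rewrite invg1.
have e2 : ((pmul w s)^-1)%g = pmul s (w^-1)%g by rewrite pmulV basicV.
by apply: (PS _ s bs); rewrite -e2 ?ellV.
Qed.

(** Applies the operators of a reduced word of w, in the order of the word. The
    reduced word is the one given by the choice of a descent at each step. *)
Fixpoint wop (V : Type) (op : 'S_d -> V -> V) (k : nat) (w : 'S_d) (v : V) : V :=
  if k is k'.+1 then
    if [pick s | basic_transp s && (ell (pmul w s) < ell w)%N] is Some s
    then op s (wop op k' (pmul w s) v) else v
  else v.

Definition wordop (V : Type) op w (v : V) := wop op (ell w) w v.

Lemma wordop1 (V : Type) op (v : V) : wordop op 1%g v = v.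
Proof. by rewrite /wordop ell1. Qed.

Lemma wordop_rec w : w != 1%g -> exists s, [/\ basic_transp s, ell w = (ell (pmul w s)).+1
  & forall (V : Type) op (v : V), wordop op w v = op s (wordop op (pmul w s) v)].
Proof.
case/perm_descent => i [j [a lt]]; have e := ell_down a lt.
have [s ht hs] : exists2 s, basic_transp s && (ell (pmul w s) < ell w)%N
    & [pick s | basic_transp s && (ell (pmul w s) < ell w)%N] = Some s.
  case: pickP => [s ht|/(_ (tperm i j))]; first by exists s.
  by rewrite adj_basic //= e ltnS leqnn.
have /andP[bs lts] := ht.
have e2 : ell w = (ell (pmul w s)).+1.
  by apply: ell_down_basic => //; apply/negbTE; rewrite -leqNgt ltnW.
by exists s; split=> // V op v; rewrite /wordop e2 /= hs.
Qed.

Lemma ell_eq0 w : ell w = 0%N -> w = 1%g.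
Proof.
move=> e; apply/eqP; apply: contraT => /perm_descent [i [j [a lt]]].
by have := ell_down a lt; rewrite e.
Qed.

Lemma wordop_s (V : Type) op s (v : V) : basic_transp s -> wordop op s v = op s v.
Proof.
move=> bs; have : s != 1%g by apply/eqP => e; have := ell_basic bs; rewrite e ell1.
case/wordop_rec => t [bt e hw]; rewrite hw.
have es : pmul s t = 1%g by apply: ell_eq0; move: e; rewrite (ell_basic bs) => -[].
by rewrite es wordop1 -[X in op X v](pmulK t bs) -[X in _ = op X v](pmulK s bt) es pmul1l pmulK.
Qed.

(** The coefficients of the quadratic relation in the right and left regular
    representations. *)
Definition bR s x : Qq := if (ell x < ell (pmul x s))%N then 0 else c0.
Definition bL s x : Qq := if (ell x < ell (pmul s x))%N then 0 else c0.

Lemma dl_Hb w : dl w = Hb w. Proof. by []. Qed.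

Lemma Rop_ex s : {f : H -> H | semilin ridq f &
  forall x, f (Hb x) = Hb (pmul x s) - bR s x *: Hb x}.
Proof.
exists (linext ridq (fun x => Hb (pmul x s) - bR s x *: Hb x)); first exact: linext_semilin.
exact: linext_dl.
Qed.

Lemma Lop_ex s : {f : H -> H | semilin ridq f &
  forall x, f (Hb x) = Hb (pmul s x) - bL s x *: Hb x}.
Proof.
exists (linext ridq (fun x => Hb (pmul s x) - bL s x *: Hb x)); first exact: linext_semilin.
exact: linext_dl.
Qed.

(** Right and left multiplication by H_s on the basis. They are projections of
    opaque existence proofs so that they do not unfold. *)
Definition Rop s : H -> H := s2val (Rop_ex s).
Definition Lop s : H -> H := s2val (Lop_ex s).

Lemma Rop_lin s : semilin ridq (Rop s). Proof. exact: s2valP. Qed.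
Lemma Lop_lin s : semilin ridq (Lop s). Proof. exact: s2valP. Qed.

Lemma RopE s x : Rop s (Hb x) = Hb (pmul x s) - bR s x *: Hb x.
Proof. exact: (s2valP' (Rop_ex s)). Qed.
Lemma LopE s x : Lop s (Hb x) = Hb (pmul s x) - bL s x *: Hb x.
Proof. exact: (s2valP' (Lop_ex s)). Qed.

Lemma ell_left s x : basic_transp s -> ell (pmul s x) = ell (pmul (x^-1)%g s).
Proof. by move=> bs; rewrite -ellV pmulV (basicV bs). Qed.

Lemma bLE s x : basic_transp s -> bL s x = bR s (x^-1)%g.
Proof. by move=> bs; rewrite /bL /bR ellV (ell_left x bs). Qed.

(** If sx differs from xt then multiplication by s on the left does not change
    whether t is a descent of x on the right, and conversely. *)
Lemma updown_comm s t x : basic_transp s -> basic_transp t -> pmul s x != pmul x t ->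
  bR t (pmul s x) = bR t x /\ bL s (pmul x t) = bL s x.
Proof.
have key s' t' y : basic_transp s' -> basic_transp t' -> pmul s' y != pmul y t' ->
    bR t' (pmul s' y) = bR t' y.
  case/basicP => i [j [a ->]]; case/basicP => k [l [b ->]] ne.
  rewrite /bR !ell_updown //; congr (if _ then _ else _); rewrite !permM.
  rewrite tperm_adj_lt ?(inj_eq perm_inj) ?adj_neq //.
  case: ifP => [/andP[/eqP e1 /eqP e2]|_].
    by case/eqP: ne; rewrite /pmul -e1 -e2 -tpermJ /conjg !mulgA mulgV mul1g.
  case: ifP => // /andP[/eqP e1 /eqP e2].
  by case/eqP: ne; rewrite /pmul -e1 -e2 tpermC -tpermJ /conjg !mulgA mulgV mul1g.
move=> bs bt ne; split; first exact: key.
rewrite !(bLE _ bs) pmulV (basicV bt); apply: key => //.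
apply: contra ne => /eqP /(congr1 (fun z => z^-1)%g).
by rewrite !pmulV !invgK (basicV bs) (basicV bt) => ->.
Qed.

(** Left and right multiplications commute. This replaces the braid relations in
    the construction of the product. *)
Lemma Lop_Rop s t h : basic_transp s -> basic_transp t -> Rop t (Lop s h) = Lop s (Rop t h).
Proof.
move=> bs bt; move: h; apply: (@semilin_ext ridq).
- exact: (semilin_comp (Lop_lin s) (Rop_lin t)).
- exact: (semilin_comp (Rop_lin t) (Lop_lin s)).
move=> x; rewrite dl_Hb LopE RopE (semilinB (Rop_lin t)) (semilinB (Lop_lin s)).
rewrite (linZ _ _ (Rop_lin t)) (linZ _ _ (Lop_lin s)) !(LopE, RopE) pmulA.
have [e|ne] := eqVneq (pmul s x) (pmul x t); last first.
  have [-> ->] := updown_comm bs bt ne.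
  exact: scale_swap.
have eb : bR t x = bL s x by rewrite /bR /bL e.
have eb2 : bR t (pmul s x) = bL s (pmul x t).
  by rewrite /bR /bL -pmulA e.
by rewrite eb eb2 e.
Qed.

Lemma Rop2 s h : basic_transp s -> Rop s (Rop s h) = h - c0 *: Rop s h.
Proof.
move=> bs; move: h; apply: (@semilin_ext ridq).
- exact: (semilin_comp (Rop_lin s) (Rop_lin s)).
- have [D Z] := Rop_lin s; split=> [u v|c v].
    by rewrite D scalerDr opprD addrACA.
  by rewrite Z scalerBr !scalerA mulrC.
move=> x; rewrite dl_Hb.
case: (boolP (ell x < ell (pmul x s))%N) => up.
  have e1 : Rop s (Hb x) = Hb (pmul x s) by rewrite RopE /bR up scale0r subr0.
  have e2 : Rop s (Hb (pmul x s)) = Hb x - c0 *: Hb (pmul x s).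
    by rewrite RopE /bR (pmulK _ bs) ltnNge (ltnW up).
  by rewrite e1 e2.
have dn : (ell (pmul x s) < ell x)%N.
  by rewrite [X in (_ < X)%N](ell_down_basic bs (negbTE up)).
have e1 : Rop s (Hb x) = Hb (pmul x s) - c0 *: Hb x by rewrite RopE /bR (negPf up).
have e2 : Rop s (Hb (pmul x s)) = Hb x by rewrite RopE /bR (pmulK _ bs) dn scale0r subr0.
apply: etrans (congr1 (Rop s) e1) _.
rewrite (semilinB (Rop_lin s)) e2 (linZ _ _ (Rop_lin s)); reflexivity.
Qed.

(** The product: h = H_w acts on the right through a reduced word of w. Since left
    multiplications commute with it and generate everything from 1, it does not
    depend on the choice of reduced words. *)
Definition hprod (a h : H) : H := linext ridq (fun w => wordop Rop w a) h.

Lemma wordop_ind (P : 'S_d -> Prop) : P 1%g ->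
  (forall w s, basic_transp s -> ell w = (ell (pmul w s)).+1 ->
    (forall (V : Type) op (v : V), wordop op w v = op s (wordop op (pmul w s) v)) ->
    P (pmul w s) -> P w) ->
  forall w, P w.
Proof.
move=> P1 PS w; have [n] := ubnP (ell w); elim: n w => // n IH w lt_n.
have [->//|/wordop_rec [s [bs e h]]] := eqVneq w 1%g.
by apply: (PS w s) => //; apply: IH; rewrite -ltnS -e.
Qed.

Lemma wordop_lin w : semilin ridq (wordop Rop w).
Proof.
elim/wordop_ind: w => [|w s bs e h [D Z]]; first by split=> [u v|c v]; rewrite !wordop1.
by split=> [u v|c v]; rewrite !h ?D ?Z ?(semiD _ _ (Rop_lin s)) ?(linZ _ _ (Rop_lin s)).
Qed.

Lemma hprod_linr a : semilin ridq (hprod a).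
Proof. exact: linext_semilin. Qed.

Lemma hprod_linl h : semilin ridq (hprod^~ h).
Proof.
rewrite /hprod /linext; split=> [u v|c v].
  by rewrite -big_split; apply: eq_bigr => w _; rewrite (semiD _ _ (wordop_lin w)) scalerDr.
rewrite scaler_sumr; apply: eq_bigr => w _.
by rewrite (linZ _ _ (wordop_lin w)) !scalerA mulrC.
Qed.

Lemma hprod_dl a w : hprod a (Hb w) = wordop Rop w a.
Proof. by rewrite -dl_Hb; exact: linext_dl. Qed.

Lemma Rop_up w s : basic_transp s -> ell (pmul w s) = (ell w).+1 ->
  Rop s (Hb w) = Hb (pmul w s).
Proof. by move=> bs e; rewrite RopE /bR e ltnSn scale0r subr0. Qed.

Lemma Lop_up w s : basic_transp s -> ell (pmul s w) = (ell w).+1 ->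
  Lop s (Hb w) = Hb (pmul s w).
Proof. by move=> bs e; rewrite LopE /bL e ltnSn scale0r subr0. Qed.

(** Right multiplication by H_y along a reduced word gives H_(xy) when lengths
    add up: each step then goes up. *)
Lemma wordop_Rop1 x y : ell (pmul x y) = (ell x + ell y)%N ->
  wordop Rop y (Hb x) = Hb (pmul x y).
Proof.
elim/wordop_ind: y => [|y s bs e h IH] exy; first by rewrite wordop1 pmul1.
have exy2 := ell_pmul_basic (pmul x y) bs.
have le : (ell (pmul x (pmul y s)) <= ell x + ell (pmul y s))%N.
  have ell_sub u v : (ell (pmul u v) <= ell u + ell v)%N.
    elim/ell_ind: v => [|v t bt et]; first by rewrite pmul1 leq_addr.
    have := ell_pmul_basic (pmul u v) bt; rewrite pmulA.
    by case: ifP => _; rewrite et; lia.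
  exact: ell_sub.
have e2 : ell (pmul x y) = (ell (pmul x (pmul y s))).+1.
  by move: exy2; rewrite pmulA; case: ifP => _; move: le; rewrite exy e; lia.
have ep : pmul (pmul x (pmul y s)) s = pmul x y by rewrite pmulA (pmulK _ bs).
have e3 : ell (pmul x (pmul y s)) = (ell x + ell (pmul y s))%N.
  by clear -e2 exy e; lia.
by rewrite h (IH e3) (Rop_up bs) ep.
Qed.

Lemma wordop_Lop s w h : basic_transp s ->
  wordop Rop w (Lop s h) = Lop s (wordop Rop w h).
Proof.
move=> bs; elim/wordop_ind: w h => [|w t bt e hw IH] h; first by rewrite !wordop1.
by rewrite !hw IH Lop_Rop.
Qed.

Lemma hprod_Lop s a h : basic_transp s -> hprod (Lop s a) h = Lop s (hprod a h).
Proof.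
move=> bs; rewrite /hprod /linext (semilin_sum (Lop_lin s)); apply: eq_bigr => w _.
by rewrite (linZ _ _ (Lop_lin s)) wordop_Lop.
Qed.

Lemma hprod_unitl h : hprod (Hb 1%g) h = h.
Proof.
move: h; apply: (semilin_ext (hprod_linr _) (semilin_id _)) => w.
by rewrite dl_Hb hprod_dl wordop_Rop1 ?pmul1l // ell1.
Qed.

(** Associativity with a generator: reduce to a = 1 by writing H_x as left
    multiplications applied to 1, which commute with both sides. *)
Lemma hprod_Rop s a h : basic_transp s -> hprod a (Rop s h) = Rop s (hprod a h).
Proof.
move=> bs; move: a; apply: (@semilin_ext ridq _ _ _ (fun a => Rop s (hprod a h))).
- exact: hprod_linl.
- exact: (semilin_comp (hprod_linl h) (Rop_lin s)).
move=> x; rewrite dl_Hb; elim/ell_indl: x => [|x t bt e IH]; first by rewrite !hprod_unitl.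
have -> : Hb x = Lop t (Hb (pmul t x)).
  have e2 : ell (pmul t (pmul t x)) = (ell (pmul t x)).+1 by rewrite (pmulKl _ bt).
  by rewrite (Lop_up bt e2) (pmulKl _ bt).
by rewrite !hprod_Lop // IH Lop_Rop.
Qed.

Lemma hprod_wordop w a h : hprod a (wordop Rop w h) = wordop Rop w (hprod a h).
Proof.
elim/wordop_ind: w => [|w s bs e hw IH]; first by rewrite !wordop1.
by rewrite !hw hprod_Rop // IH.
Qed.

Lemma hprodP : is_hecke_product hprod.
Proof.
split.
- by move=> h; apply/linear_semilin; exact: hprod_linl.
- by move=> h; apply/linear_semilin; exact: hprod_linr.
- move=> a b c; move: c; apply: (@semilin_ext ridq _ _ (fun c => hprod a (hprod b c))).
  + exact: (semilin_comp (hprod_linr b) (hprod_linr a)).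
  + exact: hprod_linr.
  by move=> w; rewrite dl_Hb !hprod_dl hprod_wordop.
- exact: hprod_unitl.
- by move=> h; rewrite hprod_dl wordop1.
- by move=> x y e; rewrite hprod_dl wordop_Rop1.
move=> s bs; rewrite hprod_dl.
have hs : Rop s (Hb 1%g) = Hb s.
  by rewrite Rop_up // ?pmul1l // ell1 ell_basic.
rewrite -hcE (wordop_s _ _ bs) -{1}hs (Rop2 _ bs).
by rewrite hs.
Qed.

Lemma hmulP : is_hecke_product (@hmul d).
Proof. by apply: epsilon_spec; exists hprod; exact: hprodP. Qed.

Section AnyProduct.

Variable m : H -> H -> H.
Hypothesis hm : is_hecke_product m.

Lemma mlinl h : semilin ridq (m^~ h).
Proof. by apply/linear_semilin; case: hm. Qed.
Lemma mlinr h : semilin ridq (m h).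
Proof. by apply/linear_semilin; case: hm. Qed.

Lemma mHb_up w s : basic_transp s -> ell (pmul w s) = (ell w).+1 ->
  m (Hb w) (Hb s) = Hb (pmul w s).
Proof. by move=> bs e; apply: (hecke_length hm); rewrite e (ell_basic bs) addn1. Qed.

Lemma mHb_down w s : basic_transp s -> ell w = (ell (pmul w s)).+1 ->
  m (Hb w) (Hb s) = Hb (pmul w s) - c0 *: Hb w.
Proof.
move=> bs e; have hw : Hb w = m (Hb (pmul w s)) (Hb s) by rewrite mHb_up ?pmulK.
rewrite [in LHS]hw -(hecke_assoc hm) (hecke_quad hm bs) -hcE (semilinB (mlinr _)).
by rewrite (linZ _ _ (mlinr _)) (hecke_unitr hm) -hw.
Qed.

Lemma mRop h s : basic_transp s -> m h (Hb s) = Rop s h.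
Proof.
move=> bs; move: h; apply: (semilin_ext (mlinl _) (Rop_lin s)) => w.
rewrite dl_Hb RopE /bR; have := ell_pmul_basic w bs.
case: ifP => _ e; first by rewrite mHb_up // scale0r subr0.
by rewrite mHb_down.
Qed.
End AnyProduct.

(** The axioms determine the product, by induction on the length of the second
    factor. So a product transported along a bijective linear map agrees with the
    original one as soon as it satisfies the axioms, which gives the
    multiplicativity of [hiota] and [jop] below. *)
Lemma hecke_product_uniq m m' : is_hecke_product m -> is_hecke_product m' ->
  forall a b : H, m a b = m' a b.
Proof.
move=> hm hm' a; apply: (semilin_ext (mlinr hm a) (mlinr hm' a)) => w; rewrite dl_Hb.
elim/ell_ind: w => [|w s bs e IH]; first by rewrite (hecke_unitr hm) (hecke_unitr hm').
have ew : ell (pmul (pmul w s) s) = (ell (pmul w s)).+1 by rewrite pmulK.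
have h1 := mHb_up hm bs ew; have h2 := mHb_up hm' bs ew.
rewrite pmulK // in h1 h2.
rewrite -{1}h1 -h2 (hecke_assoc hm) (hecke_assoc hm') IH.
by rewrite (mRop hm _ bs) (mRop hm' _ bs).
Qed.
End HeckeProduct.

(** * The bar involution of the Hecke algebra *)

Lemma fbar_hc : fbar hc = - hc.
Proof. by rewrite hcE rmorphB /= fmorphV /= fbar_q invrK opprB. Qed.

Lemma fbar_sign (n : nat) : fbar ((-1) ^+ n) = (-1) ^+ n.
Proof. by rewrite rmorphXn rmorphN1. Qed.

Lemma semilin_barbar (U V W : lmodType Qq) (f : U -> V) (g : V -> W) :
  semilin rbar f -> semilin rbar g -> semilin ridq (g \o f).
Proof. by move=> lf lg; apply: semilin_eqS (semilin_comp lf lg); exact: fbarK. Qed.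

Lemma semilin_idbar (U V W : lmodType Qq) (f : U -> V) (g : V -> W) :
  semilin ridq f -> semilin rbar g -> semilin rbar (g \o f).
Proof. by move=> lf lg; apply: semilin_eqS (semilin_comp lf lg). Qed.

Lemma semilin_barid (U V W : lmodType Qq) (f : U -> V) (g : V -> W) :
  semilin rbar f -> semilin ridq g -> semilin rbar (g \o f).
Proof. by move=> lf lg; apply: semilin_eqS (semilin_comp lf lg). Qed.

Lemma semilin_idid (U V W : lmodType Qq) (f : U -> V) (g : V -> W) :
  semilin ridq f -> semilin ridq g -> semilin ridq (g \o f).
Proof. by move=> lf lg; apply: semilin_eqS (semilin_comp lf lg). Qed.

Section HeckeBar.

Variable d : nat.
Implicit Types (w u v x y s t : 'S_d).
Local Notation H := (hecke d).
Local Notation one := (Hb (1%g : 'S_d)).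
Implicit Types (a b c h : H).

Local Notation hmP := (hmulP d).

Definition hmul_linl h := mlinl hmP h.
Definition hmul_linr h := mlinr hmP h.
Definition hmulA := hecke_assoc hmP.
Definition hmul1l := hecke_unitl hmP.
Definition hmul1r := hecke_unitr hmP.

Lemma hmulDl a b c : hmul (a + b) c = hmul a c + hmul b c.
Proof. exact: (semiD _ _ (hmul_linl c)). Qed.
Lemma hmulDr a b c : hmul a (b + c) = hmul a b + hmul a c.
Proof. exact: (semiD _ _ (hmul_linr a)). Qed.
Lemma hmulZl k a b : hmul (k *: a) b = k *: hmul a b.
Proof. exact: (linZ _ _ (hmul_linl b)). Qed.
Lemma hmulZr k a b : hmul a (k *: b) = k *: hmul a b.
Proof. exact: (linZ _ _ (hmul_linr a)). Qed.

Lemma hquad s : basic_transp s -> hmul (Hb s) (Hb s) = one - hc *: Hb s.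
Proof. by move=> bs; rewrite (hecke_quad hmP bs) hcE. Qed.

Definition hiota_ex : {f : H -> H | semilin ridq f & forall w, f (Hb w) = Hb (w^-1)%g}.
Proof.
by exists (linext ridq (fun w => Hb (w^-1)%g)); [exact: linext_semilin | exact: linext_dl].
Qed.
(** The linear anti-automorphism H_w |-> H_(w^-1). *)
Definition hiota : H -> H := s2val hiota_ex.
Lemma hiota_lin : semilin ridq hiota. Proof. exact: s2valP. Qed.
Lemma hiotaE w : hiota (Hb w) = Hb (w^-1)%g. Proof. exact: (s2valP' hiota_ex). Qed.

Lemma hiotaK : involutive hiota.
Proof.
apply: (semilin_ext (semilin_idid hiota_lin hiota_lin) (semilin_id _)) => w.
by rewrite dl_Hb /= !hiotaE invgK.
Qed.

(** The opposite product, transported along [hiota], satisfies the axioms of a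
    Hecke product. *)
Lemma hiotaM a b : hiota (hmul a b) = hmul (hiota b) (hiota a).
Proof.
suff hm' : is_hecke_product (fun a b : H => hiota (hmul (hiota b) (hiota a))).
  by have := hecke_product_uniq hm' hmP (hiota b) (hiota a); rewrite !hiotaK.
split.
- move=> h; apply/linear_semilin.
  exact: (semilin_idid (semilin_idid hiota_lin (hmul_linr (hiota h))) hiota_lin).
- move=> h; apply/linear_semilin.
  exact: (semilin_idid (semilin_idid hiota_lin (hmul_linl (hiota h))) hiota_lin).
- by move=> x y z; rewrite !hiotaK hmulA.
- by move=> h; rewrite hiotaE invg1 hmul1r hiotaK.
- by move=> h; rewrite hiotaE invg1 hmul1l hiotaK.
- move=> x y e; rewrite !hiotaE (hecke_length hmP).
    by rewrite -pmulV hiotaE invgK.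
  by rewrite -pmulV !ellV e addnC.
move=> s bs; rewrite !hiotaE (basicV bs) (hquad bs) -hcE.
by rewrite (semilinB hiota_lin) (linZ _ _ hiota_lin) !hiotaE (basicV bs) invg1.
Qed.

Definition jop_ex : {f : H -> H | semilin rbar f & forall w, f (Hb w) = (-1) ^+ ell w *: Hb w}.
Proof.
by exists (linext rbar (fun w => (-1) ^+ ell w *: Hb w));
  [exact: linext_semilin | exact: linext_dl].
Qed.
(** The antilinear automorphism with H_w |-> (-1)^l(w) H_w, which exchanges the
    two Kazhdan-Lusztig bases up to sign. *)
Definition jop : H -> H := s2val jop_ex.
Lemma jop_lin : semilin rbar jop. Proof. exact: s2valP. Qed.
Lemma jopE w : jop (Hb w) = (-1) ^+ ell w *: Hb w. Proof. exact: (s2valP' jop_ex). Qed.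

Lemma scale_signK (V : lmodType Qq) (n : nat) (v : V) : (-1) ^+ n *: ((-1) ^+ n *: v) = v.
Proof. by rewrite scalerA -exprMn mulrNN mulr1 expr1n scale1r. Qed.

Lemma jopK : involutive jop.
Proof.
apply: (semilin_ext (semilin_barbar jop_lin jop_lin) (semilin_id _)) => w.
by rewrite dl_Hb /= jopE (barZ _ _ jop_lin) fbar_sign jopE scale_signK.
Qed.

(** The product transported along [jop] satisfies the axioms of a Hecke product;
    the quadratic relation is preserved because q - q^-1 changes sign under the
    bar involution. *)
Lemma jopM a b : jop (hmul a b) = hmul (jop a) (jop b).
Proof.
suff hm' : is_hecke_product (fun a b : H => jop (hmul (jop a) (jop b))).
  by have := hecke_product_uniq hm' hmP (jop a) (jop b); rewrite !jopK.
split.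
- move=> h; apply/linear_semilin.
  exact: (semilin_barbar (semilin_barid jop_lin (hmul_linl (jop h))) jop_lin).
- move=> h; apply/linear_semilin.
  exact: (semilin_barbar (semilin_barid jop_lin (hmul_linr (jop h))) jop_lin).
- by move=> x y z; rewrite !jopK hmulA.
- by move=> h; rewrite jopE ell1 expr0 scale1r hmul1l jopK.
- by move=> h; rewrite jopE ell1 expr0 scale1r hmul1r jopK.
- move=> x y e; rewrite !jopE hmulZl hmulZr (hecke_length hmP e).
  rewrite scalerA (barZ _ _ jop_lin) rmorphM /= !fbar_sign jopE e exprD.
  by rewrite -scalerA [X in _ *: X]scalerA [X in _ *: (X *: _)]mulrA
    [X in _ *: ((X * _) *: _)]mulrC -!scalerA scale_signK scale_signK.
move=> s bs; rewrite !jopE hmulZl hmulZr scale_signK (hquad bs) -hcE.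
rewrite (semilinB jop_lin) (barZ _ _ jop_lin) !jopE fbar_hc (ell_basic bs) ell1.
by rewrite expr0 expr1 scale1r scaleN1r scalerN scaleNr opprK.
Qed.

Definition hunit a := exists b, hmul a b = one /\ hmul b a = one.

Lemma hinvE a b : hmul a b = one -> hmul b a = one -> hinv a = b.
Proof.
move=> ab ba; have [ac ca] : hmul a (hinv a) = one /\ hmul (hinv a) a = one.
  by apply: (epsilon_spec (inhabits (0 : H))
      (fun h' => hmul a h' = one /\ hmul h' a = one)); exists b.
by rewrite -[hinv a]hmul1r -ab hmulA ca hmul1l.
Qed.

Lemma hunitP a : hunit a -> hmul a (hinv a) = one /\ hmul (hinv a) a = one.
Proof. by case=> b [ab ba]; rewrite (hinvE ab ba). Qed.

Lemma hinvM a b : hunit a -> hunit b ->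
  hunit (hmul a b) /\ hinv (hmul a b) = hmul (hinv b) (hinv a).
Proof.
move=> /hunitP [a1 a2] /hunitP [b1 b2].
have e1 : hmul (hmul a b) (hmul (hinv b) (hinv a)) = one.
  by rewrite hmulA -[X in hmul X _]hmulA b1 hmul1r a1.
have e2 : hmul (hmul (hinv b) (hinv a)) (hmul a b) = one.
  by rewrite hmulA -[X in hmul X _]hmulA a2 hmul1r b2.
by split; [exists (hmul (hinv b) (hinv a)) | exact: hinvE].
Qed.

Lemma Hs_inv s : basic_transp s -> hinv (Hb s) = Hb s + hc *: one /\ hunit (Hb s).
Proof.
move=> bs.
have e1 : hmul (Hb s) (Hb s + hc *: one) = one.
  by rewrite hmulDr hmulZr hmul1r (hquad bs) subrK.
have e2 : hmul (Hb s + hc *: one) (Hb s) = one.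
  by rewrite hmulDl hmulZl hmul1l (hquad bs) subrK.
by split; [exact: hinvE | exists (Hb s + hc *: one)].
Qed.

Lemma Hb_unit w : hunit (Hb w).
Proof.
elim/ell_ind: w => [|w s bs e IH]; first by exists one; rewrite hmul1l.
have e2 : ell (pmul (pmul w s) s) = (ell (pmul w s)).+1 by rewrite (pmulK _ bs).
rewrite -[w](pmulK _ bs) -(mHb_up hmP bs e2).
by have [_ us] := Hs_inv bs; have [] := hinvM IH us.
Qed.

(** The bar conjugate of H_w. *)
Definition Jb w : H := hinv (Hb (w^-1)%g).

Lemma Jb_mul x y : ell (pmul x y) = (ell x + ell y)%N -> Jb (pmul x y) = hmul (Jb x) (Jb y).
Proof.
move=> e; rewrite /Jb pmulV -(hecke_length hmP) -?pmulV ?ellV ?e 1?addnC //.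
by have [_ ->] := hinvM (Hb_unit (y^-1)%g) (Hb_unit (x^-1)%g).
Qed.

Lemma Jb1 : Jb 1%g = one.
Proof. by rewrite /Jb invg1; apply: hinvE; exact: hmul1l. Qed.

Lemma Jb_s s : basic_transp s -> Jb s = Hb s + hc *: one.
Proof. by move=> bs; rewrite /Jb (basicV bs); have [] := Hs_inv bs. Qed.

Lemma Jb_up w s : basic_transp s -> ell (pmul w s) = (ell w).+1 ->
  Jb (pmul w s) = hmul (Jb w) (Jb s).
Proof. by move=> bs e; apply: Jb_mul; rewrite e (ell_basic bs) addn1. Qed.

Lemma Jb_down w s : basic_transp s -> ell w = (ell (pmul w s)).+1 ->
  Jb w = hmul (Jb (pmul w s)) (Jb s).
Proof. by move=> bs e; rewrite -(Jb_up bs) (pmulK _ bs). Qed.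

Lemma Jb_sq s : basic_transp s -> hmul (Jb s) (Jb s) = one + hc *: Jb s.
Proof.
move=> bs; rewrite {1}(Jb_s bs) hmulDl hmulZl hmul1l; congr (_ + _).
by have [] := hunitP (Hb_unit s); rewrite /Jb (basicV bs).
Qed.

Lemma hbar_lin : semilin rbar (@hbar d).
Proof. exact: (linext_semilin rbar Jb). Qed.

Lemma hbar_Hb w : hbar (Hb w) = Jb w.
Proof. exact: (linext_dl rbar Jb w). Qed.

(** When s is a descent of w this uses the quadratic relation for the inverse of
    H_s, in which q - q^-1 appears with the opposite sign. *)
Lemma hbar_mul_s h s : basic_transp s -> hbar (hmul h (Hb s)) = hmul (hbar h) (Jb s).
Proof.
move=> bs; move: h; apply: (@semilin_ext rbar _ _ (fun h => hbar (hmul h (Hb s)))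
  (fun h => hmul (hbar h) (Jb s))).
- exact: (semilin_idbar (hmul_linl (Hb s)) hbar_lin).
- exact: (semilin_barid hbar_lin (hmul_linl (Jb s))).
move=> w; rewrite dl_Hb hbar_Hb; have := ell_pmul_basic w bs; case: ifP => _ e.
  by rewrite (mHb_up hmP bs e) hbar_Hb (Jb_up bs e).
rewrite (mHb_down hmP bs e) (semilinB hbar_lin) (barZ _ _ hbar_lin) fbar_hc !hbar_Hb.
rewrite [in RHS](Jb_down bs e) -hmulA (Jb_sq bs) hmulDr hmulZr hmul1r.
by rewrite -(Jb_down bs e) scaleNr opprK.
Qed.

Lemma hbarM a b : hbar (hmul a b) = hmul (hbar a) (hbar b).
Proof.
move: b; apply: (@semilin_ext rbar _ _ (fun b => hbar (hmul a b))
  (fun b => hmul (hbar a) (hbar b))).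
- exact: (semilin_idbar (hmul_linr a) hbar_lin).
- exact: (semilin_barid hbar_lin (hmul_linr (hbar a))).
move=> w; rewrite dl_Hb; elim/ell_ind: w => [|w s bs e IH].
  by rewrite hbar_Hb Jb1 !hmul1r.
have e2 : ell (pmul (pmul w s) s) = (ell (pmul w s)).+1 by rewrite (pmulK _ bs).
rewrite -[w](pmulK _ bs) -(mHb_up hmP bs e2) hmulA.
by rewrite !(hbar_mul_s _ bs) IH hmulA.
Qed.

Lemma hbarK : involutive (@hbar d).
Proof.
apply: (semilin_ext (semilin_barbar hbar_lin hbar_lin) (semilin_id _)) => w.
rewrite dl_Hb /= hbar_Hb; elim/ell_ind: w => [|w s bs e IH].
  by rewrite Jb1 hbar_Hb Jb1.
have e2 : ell (pmul (pmul w s) s) = (ell (pmul w s)).+1 by rewrite (pmulK _ bs).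
rewrite (Jb_down bs e) hbarM IH {1}(Jb_s bs) (semiD _ _ hbar_lin) (barZ _ _ hbar_lin).
rewrite fbar_hc !hbar_Hb Jb1 (Jb_s bs) scaleNr addrK.
by rewrite (mHb_up hmP bs e2) (pmulK _ bs).
Qed.

Lemma hbar_hiota h : hbar (hiota h) = hiota (hbar h).
Proof.
move: h; apply: (semilin_ext (semilin_idbar hiota_lin hbar_lin)
  (semilin_barid hbar_lin hiota_lin)) => w.
rewrite dl_Hb /= hiotaE !hbar_Hb {1}/Jb invgK.
have [u1 u2] := hunitP (Hb_unit (w^-1)%g).
have e1 := congr1 hiota u1; have e2 := congr1 hiota u2.
rewrite !hiotaM !hiotaE invgK invg1 in e1 e2.
exact: hinvE.
Qed.

Lemma hbar_jop h : hbar (jop h) = jop (hbar h).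
Proof.
move: h; apply: (semilin_ext (semilin_barbar jop_lin hbar_lin)
  (semilin_barbar hbar_lin jop_lin)) => w.
rewrite dl_Hb /= jopE (barZ _ _ hbar_lin) fbar_sign !hbar_Hb.
have [u1 u2] := hunitP (Hb_unit (w^-1)%g).
have e1 := congr1 jop u1; have e2 := congr1 jop u2.
rewrite !jopM !jopE ellV ell1 expr0 scale1r ?hmulZl ?hmulZr in e1 e2.
rewrite -[jop _](scale_signK (ell w)); congr (_ *: _).
by apply: hinvE; rewrite ?hmulZl ?hmulZr.
Qed.

(** Vanishing on all elements of length at least n, the form in which the
    unitriangularity of the bar involution is proved by induction. *)
Definition low n h := forall x, (n <= ell x)%N -> h x = 0.

Lemma low_Rop n h s : basic_transp s -> low n h -> low n.+1 (Rop s h).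
Proof.
move=> bs lh x lx; rewrite (ffun_dl h) (semilin_sum (Rop_lin s)) sum_ffunE big1 // => y _.
rewrite (linZ _ _ (Rop_lin s)) dl_Hb RopE !ffunE.
case: (leqP n (ell y)) => [/lh ->|ly]; first by rewrite [_ *: _]mul0r.
have ey := ell_pmul_basic y bs.
have -> : (x == pmul y s) = false.
  by apply/negbTE/eqP => ex; move: ey lx ly; rewrite -ex; case: ifP => _; lia.
have -> : (x == y) = false by apply/negbTE/eqP => ex; move: lx ly; rewrite -ex; lia.
by rewrite [bR s y *: _]mulr0 subr0 [_ *: _]mulr0.
Qed.

(** H_w and its bar conjugate differ by terms of smaller length: right
    multiplication by H_s raises lengths by at most one. *)
Lemma Jb_low w : low (ell w) (Jb w - Hb w).
Proof.
elim/ell_ind: w => [|w s bs e IH]; first by rewrite Jb1 subrr => x _; rewrite ffunE.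
have e2 : ell (pmul (pmul w s) s) = (ell (pmul w s)).+1 by rewrite (pmulK _ bs).
set r := Jb (pmul w s) - Hb (pmul w s) in IH.
have -> : Jb w - Hb w = Rop s r + hc *: Jb (pmul w s).
  rewrite (Jb_down bs e) (Jb_s bs) hmulDr hmulZr hmul1r (mRop hmP _ bs) addrAC.
  congr (_ + _); rewrite /r (semilinB (Rop_lin s)); congr (_ - _).
  by rewrite (Rop_up bs e2) (pmulK _ bs).
move=> x lx; rewrite ffunE (low_Rop bs IH); last by rewrite -e.
rewrite add0r ffunE; have h : r x = 0 by apply: IH; rewrite -ltnS -e; apply: leqW.
move: h; rewrite /r !ffunE.
have -> : (x == pmul w s) = false by apply/negbTE/eqP => ex; move: lx; rewrite e ex; lia.
by rewrite subr0 => ->; rewrite [_ *: _]mulr0.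
Qed.

Lemma Jb_diag w : (Jb w w : Qq) = 1.
Proof. by apply/eqP; rewrite -subr_eq0; have := Jb_low (leqnn (ell w)); rewrite !ffunE eqxx => ->. Qed.

Lemma Jb_tri w x : (Jb w x : Qq) != 0 -> x = w \/ (ell x < ell w)%N.
Proof.
have [|le] := ltnP (ell x) (ell w); first by right.
have [-> | ne] := eqVneq x w; first by left.
by have := Jb_low le; rewrite !ffunE (negPf ne) subr0 => ->; rewrite eqxx.
Qed.

End HeckeBar.

(** * Kazhdan-Lusztig polynomials *)

Definition mq : Qq := - q.

Lemma mq_neq0 : mq != 0. Proof. by rewrite oppr_eq0 q_neq0. Qed.

Lemma mqE : mq = -1 * q. Proof. by rewrite mulN1r. Qed.

Lemma mq_even k : mq ^+ k.*2 = (q ^+ 2) ^+ k.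
Proof. by rewrite -mul2n exprM sqrrN. Qed.

(** (-q)^(a - b) without truncated subtraction or integer exponents. *)
Definition mqr (a b : nat) : Qq := mq ^+ a / mq ^+ b.

Lemma mqr_refl a : mqr a a = 1.
Proof. by rewrite /mqr divff // expf_neq0 // mq_neq0. Qed.

Lemma mqrS a b : mqr a.+1 b = mq * mqr a b.
Proof. by rewrite /mqr exprS mulrA. Qed.

Lemma mqr_sub a b : (a <= b)%N -> mqr a b = (-1) ^+ (b - a) * q ^- (b - a).
Proof.
move=> le; rewrite /mqr -{1}(subnKC le) exprD invfM mulrA divff ?expf_neq0 ?mq_neq0 //.
by rewrite mul1r mqE exprMn invfM -exprVn invrN1.
Qed.

Lemma mqrM a b c : mqr a b * mqr b c = mqr a c.
Proof. by rewrite /mqr mulrA divfK // expf_neq0 // mq_neq0. Qed.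

Lemma kl_scalar (F : fieldType) (x : F) a b : x != 0 ->
  (-1) ^+ (a + b) * x ^- b * x ^+ (2 * a) / x ^+ a = (-1 * x) ^+ a / (-1 * x) ^+ b.
Proof.
move=> x0; have e : x ^+ (2 * a) / x ^+ a = x ^+ a.
  by rewrite mulnC exprM expr2 mulfK // expf_neq0.
rewrite -!mulrA e !exprMn exprD invfM -[((-1) ^+ b)^-1]exprVn invrN1 mulrA.
by rewrite [LHS](AC (3*1) ((1*4)*(2*3))).
Qed.

Lemma mqr_step (F : fieldType) (a b x : F) (p r : F) : x != 0 -> b != 0 ->
  a * - x / b * r - x^-1 * (a / b * p) = a / (b * - x) * (p + x ^+ 2 * r).
Proof. by move=> x0 b0; field; rewrite oppr_eq0 x0 b0. Qed.

Lemma mqr_step2 (F : fieldType) (a b x : F) (p r : F) : x != 0 -> b != 0 ->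
  a / b * r - x * (a * - x / b * p) = a * - x / (b * - x) * (r + x ^+ 2 * p).
Proof. by move=> x0 b0; field; rewrite oppr_eq0 x0 b0. Qed.

Lemma eigen_scalar (F : fieldType) (x r : F) : x != 0 ->
  r - (x - x^-1) * (- x * r) = - x * (- x * r).
Proof. by move=> x0; field. Qed.

Lemma mqr_up a b (p r : Qq) :
  mqr a.+1 b * r - q^-1 * (mqr a b * p) = mqr a b.+1 * (p + q ^+ 2 * r).
Proof.
rewrite /mqr ![mq ^+ _.+1]exprSr -[mq]/(- q).
exact: (mqr_step _ _ _ q_neq0 (expf_neq0 b mq_neq0)).
Qed.

Lemma mqr_dn a b (p r : Qq) :
  mqr a b * r - q * (mqr a.+1 b * p) = mqr a.+1 b.+1 * (r + q ^+ 2 * p).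
Proof.
rewrite /mqr ![mq ^+ _.+1]exprSr -[mq]/(- q).
exact: (mqr_step2 _ _ _ q_neq0 (expf_neq0 b mq_neq0)).
Qed.

Section KLBasis.

Variable d : nat.
Implicit Types (w u v x y z s t : 'S_d).
Local Notation H := (hecke d).
Local Notation one := (Hb (1%g : 'S_d)).
Implicit Types (p : 'S_d -> {poly int}) (h : H).
Local Notation hmP := (hmulP d).

(** The coefficient of H_x in C_y for a candidate p for the family P_(.,y): in the
    basis H_x the normalisation of Kazhdan and Lusztig simplifies to
    (-q)^(l(x) - l(y)) p_x(q^2). *)
Definition kcf y p x : Qq := mqr (ell x) (ell y) * peval (p x) (q ^+ 2).

Definition Cel y p : H := [ffun x => kcf y p x].

Lemma klC_coef P y : klC P y = Cel y (P^~ y).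
Proof.
apply/ffunP => x; rewrite /klC sum_ffunE (bigD1 x) //= big1 ?addr0.
  rewrite /klT !ffunE eqxx [_ *: 1]mulr1 -[LHS]/(_ * _) /kcf mulrAC; congr (_ * _).
  by rewrite /mqr mqE kl_scalar // q_neq0.
by move=> y' ne; rewrite /klT !ffunE eq_sym (negPf ne) mulr0n !scaler0.
Qed.

Lemma Cel_sum y p : Cel y p = \sum_x kcf y p x *: Hb x.
Proof. by rewrite {1}(ffun_dl (Cel y p)); apply: eq_bigr => x _; rewrite ffunE. Qed.

Lemma Rop_coef s h x : basic_transp s -> (Rop s h x : Qq) = h (pmul x s) - bR s x * h x.
Proof.
move=> bs; rewrite {1}(ffun_dl h) (semilin_sum (Rop_lin s)) sum_ffunE.
have e (y : 'S_d) : (Rop s ((h y : Qq) *: dl y) x : Qq)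
    = (h y : Qq) * (y == pmul x s)%:R - (bR s y * (h y : Qq)) * (y == x)%:R.
  rewrite (linZ _ _ (Rop_lin s)) dl_Hb RopE !ffunE -[LHS]/(_ * (_ - _ * _)).
  have -> : (x == pmul y s) = (y == pmul x s).
    by apply/eqP/eqP => ->; rewrite (pmulK _ bs).
  by rewrite [x == y]eq_sym mulrBr mulrA [h y * bR s y]mulrC.
under eq_bigr => y _ do rewrite e.
rewrite big_split sumrN /=; congr (_ - _).
  rewrite (bigD1 (pmul x s)) //= eqxx mulr1 big1 ?addr0 // => y /negPf ->.
  by rewrite mulr0.
rewrite (bigD1 x) //= eqxx mulr1 big1 ?addr0 // => y /negPf ->.
by rewrite mulr0.
Qed.

(** The element C_s. *)
Definition Cs s : H := Hb s - q^-1 *: one.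

Lemma hbar_Cs s : basic_transp s -> hbar (Cs s) = Cs s.
Proof.
move=> bs; rewrite (semilinB (hbar_lin d)) (barZ _ _ (hbar_lin d)) !hbar_Hb Jb1 (Jb_s bs).
rewrite fmorphV /= fbar_q invrK hcE /Cs scalerBl -!addrA; congr (_ + _).
by rewrite addrC subrK.
Qed.

Lemma hmul_Cs_coef s h x : basic_transp s ->
  (hmul h (Cs s) x : Qq) = h (pmul x s) - (if (ell x < ell (pmul x s))%N then q^-1 else q) * h x.
Proof.
move=> bs; rewrite (semilinB (hmul_linr h)) hmulZr hmul1r (mRop hmP h bs).
rewrite ffunE (Rop_coef _ _ bs) !ffunE -addrA; congr (_ + _).
rewrite [q^-1 *: _]/(_ * _) -opprD -mulrDl; congr (- (_ * _)).
by rewrite /bR; case: ifP => _; rewrite ?add0r // hcE subrK.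
Qed.

(** The polynomials that belong to the product C_y C_s. *)
Definition upd s p x : {poly int} :=
  if (ell x < ell (pmul x s))%N then p x + 'X * p (pmul x s) else p (pmul x s) + 'X * p x.

Lemma Cel_Cs y s p : basic_transp s -> ell (pmul y s) = (ell y).+1 ->
  hmul (Cel y p) (Cs s) = Cel (pmul y s) (upd s p).
Proof.
move=> bs ey; apply/ffunP => x; rewrite (hmul_Cs_coef _ _ bs) !ffunE /kcf /upd ey.
have ex := ell_pmul_basic x bs; move: ex; case: ifP => _ ex.
  by rewrite ex pevalD pevalM pevalX mqr_up.
by rewrite ex pevalD pevalM pevalX mqr_dn.
Qed.

(** The degree bound deg p_x <= (l(y) - l(x) - 1)/2, as the vanishing of
    coefficients; this form has no exception for p_x = 0, and it also says that
    p_x vanishes if l(x) >= l(y) and x differs from y. *)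
Definition degcond y p := forall x i, x != y -> (ell y <= ell x + i.*2)%N -> (p x)`_i = 0.

(** The conditions that determine the family P_(.,y) (see [good_uniq]). *)
Record good y p : Prop := {
  good_diag : p y = 1;
  good_deg : degcond y p;
  good_bar : hbar (Cel y p) = Cel y p }.

Definition supp y p := forall x, ~~ bruhat x y -> p x = 0.

(** The invariance P_(xs,y) = P_(x,y) at each descent s of y. *)
Definition rinv y p := forall s, basic_transp s -> (ell (pmul y s) < ell y)%N ->
  forall x, p (pmul x s) = p x.

Lemma degcond_ge y p x : degcond y p -> x != y -> (ell y <= ell x)%N -> p x = 0.
Proof.
by move=> dp ne le; apply/polyP => i; rewrite coef0 dp // (leq_trans le) // leq_addr.
Qed.

Lemma deg_negZ a b (P : {poly int}) :
  (forall i, (b <= a + i.*2)%N -> P`_i = 0) -> negZ (mqr a b * peval P (q ^+ 2)).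
Proof.
move=> h; have [le|lt] := leqP b a.
  have -> : P = 0 by apply/polyP => i; rewrite coef0 h // (leq_trans le) // leq_addr.
  by rewrite peval0 mulr0; exact: negZ0.
rewrite mqr_sub ?(ltnW lt) // -mulrA; apply/negZ_sign/negZ_sqr.
have [->|P0] := eqVneq P 0; first by rewrite size_poly0.
have := lead_coef_eq0 P; rewrite (negPf P0) lead_coefE.
have [le|lt2 _] := leqP b (a + (size P).-1.*2); first by rewrite h // eqxx.
by move: lt lt2; rewrite -(prednK (_ : 0 < size P)%N) ?lt0n ?size_poly_eq0 //=; lia.
Qed.

Lemma hbar_expand h a : (hbar h a : Qq) = \sum_(b : 'S_d) (Jb b a : Qq) * fbar (h b).
Proof.
by rewrite /hbar sum_ffunE; apply: eq_bigr => b _; rewrite !ffunE mulrC.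
Qed.

Lemma hbar_fixed_eq0 h : hbar h = h -> (forall a, negZ (h a)) -> forall a, h a = 0.
Proof.
move=> hh hn; apply: (bar_triangular_eq0 (h := @ell d) (r := fun a b : 'S_d => (Jb b a : Qq))
  (c := fun a => (h a : Qq))).
- exact: Jb_diag.
- by move=> a b /Jb_tri.
- by move=> a; rewrite -hbar_expand hh.
- by move=> a; apply: negZ_bar0.
Qed.

Lemma good_uniq y p p' : good y p -> good y p' -> p =1 p'.
Proof.
move=> gp gp'; pose h := Cel y p - Cel y p'.
have hE a : h a = mqr (ell a) (ell y) * peval (p a - p' a) (q ^+ 2).
  by rewrite /h !ffunE -mulrBr pevalD pevalN.
have h0 : forall a, h a = 0.
  apply: hbar_fixed_eq0 => [|a].
    by rewrite (semilinB (hbar_lin d)) (good_bar gp) (good_bar gp').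
  rewrite hE; have [->|ne] := eqVneq a y.
    by rewrite (good_diag gp) (good_diag gp') subrr peval0 mulr0; exact: negZ0.
  by apply: deg_negZ => i le; rewrite coefB (good_deg gp ne le) (good_deg gp' ne le) subrr.
move=> a; apply/eqP; rewrite -subr_eq0; apply/eqP/peval_sqr_eq0.
have /eqP := h0 a; rewrite hE mulf_eq0 /mqr mulf_eq0 invr_eq0 !expf_eq0.
by rewrite (negPf mq_neq0) !andbF => /eqP.
Qed.

Section Step.

Variables (y s : 'S_d) (p : 'S_d -> {poly int}) (Pf : 'S_d -> 'S_d -> {poly int}).
Hypotheses (bs : basic_transp s) (ey : ell (pmul y s) = (ell y).+1) (gp : good y p) (sp : supp y p).
Hypothesis gPf : forall z, (ell z < ell y)%N -> [/\ good z (Pf z), supp z (Pf z) & rinv z (Pf z)].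

Let gPf1 z (lz : (ell z < ell y)%N) : good z (Pf z). Proof. by have [] := gPf lz. Qed.

(** The leading coefficient of P_(z,y) where its degree attains the bound, for the
    z with zs < z: the multiples of C_z to be subtracted from C_y C_s. *)
Definition klmu z : int :=
  if [&& (ell (pmul z s) < ell z)%N, (ell z < ell y)%N & odd (ell y - ell z)]
  then (p z)`_((ell y - ell z).-1./2) else 0.

(** The exponent k with q^(2k) = q^(l(y) + 1 - l(z)), the ratio of the
    normalisations of C_z and of C_(ys), when l(y) - l(z) is odd. *)
Definition kexp z : nat := ((ell y).+1 - ell z)./2.

(** The inductive step of Kazhdan and Lusztig: C_y C_s corrected by the terms that
    violate the degree bound. *)
Definition stp x : {poly int} :=
  upd s p x - \sum_z (klmu z)%:P * ('X^(kexp z) * Pf z x).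

Lemma klmuP z : klmu z != 0 ->
  [/\ (ell (pmul z s) < ell z)%N, (ell z < ell y)%N, ((kexp z).*2 + ell z = (ell y).+1)%N,
      klmu z = (p z)`_((kexp z).-1) & p z != 0].
Proof.
rewrite /klmu; case: ifP => [/and3P[h1 h2 h3] h4|]; last by rewrite eqxx.
have e : ((kexp z).*2 + ell z = (ell y).+1)%N by rewrite /kexp; move: h2 h3; lia.
split=> //.
- by congr (_`_ _); move: e h2 h3; lia.
- by apply: contraNneq h4 => ->; rewrite coef0.
Qed.

Lemma stp_Cel : Cel (pmul y s) stp =
  hmul (Cel y p) (Cs s) - \sum_z (klmu z)%:~R *: Cel z (Pf z).
Proof.
rewrite (Cel_Cs _ bs ey); apply/ffunP => x; rewrite !ffunE sum_ffunE /kcf /stp.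
rewrite pevalD pevalN mulrDr mulrN peval_sum mulr_sumr; congr (_ - _).
apply: eq_bigr => z _; rewrite !ffunE pevalZ pevalM pevalXn mulrCA.
rewrite -[RHS]/(_ * _) /kcf.
have [->|/klmuP [_ _ e _ _]] := eqVneq (klmu z) 0; first by rewrite !mul0r.
congr (_ * _); rewrite mulrA; congr (_ * _).
have e2 : mqr (ell z) ((kexp z).*2 + ell z) * mq ^+ (kexp z).*2 = 1.
  by rewrite /mqr exprD invfM mulrA mulrAC mulfVK ?mulfV // expf_neq0 // mq_neq0.
by rewrite -mq_even ey -e -(mqrM (ell x) (ell z) (_ + _)) -mulrA e2 mulr1.
Qed.

Lemma stp_bar : hbar (Cel (pmul y s) stp) = Cel (pmul y s) stp.
Proof.
rewrite stp_Cel (semilinB (hbar_lin d)) hbarM (hbar_Cs bs) (good_bar gp).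
congr (_ - _); rewrite (semilin_sum (hbar_lin d)); apply: eq_bigr => z _.
rewrite (barZ _ _ (hbar_lin d)).
have [->|/klmuP [_ lz _ _ _]] := eqVneq (klmu z) 0; first by rewrite rmorph0 !scale0r.
by rewrite rmorph_int (good_bar (gPf1 lz)).
Qed.

Lemma upd_inv x : upd s p (pmul x s) = upd s p x.
Proof.
rewrite /upd (pmulK _ bs); have := ell_pmul_basic x bs; case: ifP => _ ->.
  by rewrite ltnNge leqnSn.
by rewrite ltnSn.
Qed.

Lemma stp_inv x : stp (pmul x s) = stp x.
Proof.
rewrite /stp upd_inv; congr (_ - _); apply: eq_bigr => z _.
have [->|/klmuP [dz lz _ _ _]] := eqVneq (klmu z) 0; first by rewrite !mul0r.
by have [_ _ r] := gPf lz; rewrite (r _ bs dz).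
Qed.

Lemma stp_supp x : ~~ bruhat x (pmul y s) -> stp x = 0.
Proof.
move=> nb; have yys : bruhat y (pmul y s).
  have [i [j [_ es]]] := elimT (basicP s) bs.
  by rewrite es; apply: bruhat_refln; rewrite -es ey.
have n1 : ~~ bruhat x y by apply: contra nb => h; exact: bruhat_trans h yys.
have n2 : ~~ bruhat (pmul x s) y.
  apply: contra nb => h; have [i [j [aij es]]] := elimT (basicP s) bs.
  have := bruhat_lift aij h; rewrite -es (pmulK _ bs) => -[h2|//].
  exact: bruhat_trans h2 yys.
have u0 : upd s p x = 0.
  by rewrite /upd (sp n1) (sp n2) mulr0 addr0; case: ifP.
rewrite /stp u0 big1 ?subr0 // => z _.
have [->|/klmuP [_ lz _ _ pz]] := eqVneq (klmu z) 0; first by rewrite mul0r.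
have zy : bruhat z y by apply: contraNT pz => /sp ->.
have nxz : ~~ bruhat x z by apply: contra n1 => h; exact: bruhat_trans h zy.
by have [_ r _] := gPf lz; rewrite (r _ nxz) !mulr0.
Qed.

Lemma ell_neq z x : ell z != ell x -> z != x.
Proof. by apply: contraNneq => ->. Qed.

Lemma stp_diag : stp (pmul y s) = 1.
Proof.
rewrite stp_inv /stp /upd ey ltnSn (good_diag gp).
have ny : pmul y s != y by apply: ell_neq; rewrite ey; lia.
rewrite (degcond_ge (good_deg gp) ny); last by rewrite ey.
rewrite mulr0 addr0 big1 ?subr0 // => z _.
have [->|/klmuP [_ lz _ _ _]] := eqVneq (klmu z) 0; first by rewrite mul0r.
have nz : y != z by apply: ell_neq; move: lz; lia.
by rewrite (degcond_ge (good_deg (gPf1 lz)) nz) ?mulr0 // ltnW.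
Qed.

Lemma stp_term x i z : z != x -> ((ell y).+1 <= ell x + i.*2)%N ->
  ((klmu z)%:P * ('X^(kexp z) * Pf z x))`_i = 0.
Proof.
move=> ne le; have [->|/klmuP [_ lz e _ _]] := eqVneq (klmu z) 0; first by rewrite mul0r coef0.
rewrite coefCM coefXnM; case: ltnP => h; first by rewrite mulr0.
rewrite (good_deg (gPf1 lz)) ?mulr0 1?eq_sym //.
by move: e le h; lia.
Qed.

(** At x with xs > x both terms of [upd] satisfy the bound. At x with xs < x the
    second term exceeds it by one exactly when [klmu] is not 0, and then the
    leading coefficient is cancelled by the summand z = x; the other summands
    satisfy the bound. *)
Lemma stp_deg : degcond (pmul y s) stp.
Proof.
move=> x i nx; rewrite ey => le; rewrite coefB coef_sum (bigD1 x) //=.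
rewrite big1 ?addr0; last by move=> z nz; exact: stp_term.
have ex := ell_pmul_basic x bs; rewrite /upd; move: ex; case: ifP => lt ex.
  have -> : klmu x = 0 by rewrite /klmu ltnNge (ltnW lt).
  rewrite mul0r coef0 subr0 coefD coefXM.
  have -> : (p x)`_i = 0.
    have [exy|nxy] := eqVneq x y.
      rewrite exy (good_diag gp) coef1; case: i le => [|i] //.
      by rewrite exy; lia.
    by apply: (good_deg gp nxy); move: le; lia.
  case: i le => [|i] le; first by rewrite addr0.
  rewrite add0r /=; apply: (good_deg gp).
    by apply: contra nx => /eqP <-; rewrite (pmulK _ bs).
  by rewrite ex; move: le; lia.
have nxy : x != y by apply: contraFneq lt => ->; rewrite ey.
rewrite coefD (good_deg gp) ?add0r; last 2 first.
- by apply: contra nx => /eqP <-; rewrite (pmulK _ bs).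
- by clear -ex le; lia.
have [h2|h2] := leqP (ell y).+2 (ell x + i.*2).
  have -> : ('X * p x)`_i = 0.
    rewrite coefXM; case: i h2 {le} => // i h2 /=.
    by apply: (good_deg gp nxy); move: h2; lia.
  have [->|/klmuP [_ lz e _ _]] := eqVneq (klmu x) 0; first by rewrite mul0r coef0 subr0.
  rewrite coefCM coefXnM (good_diag (gPf1 lz)) coef1; case: ltnP => h3.
    by rewrite mulr0 subr0.
  have -> : (i - kexp x == 0)%N = false by move: h3 h2 e; lia.
  by rewrite mulr0 subr0.
have ei : (ell x + i.*2 = (ell y).+1)%N by move: le h2; lia.
case: i {le h2} ei => [|i] ei.
  have -> : klmu x = 0 by rewrite /klmu; case: ifP => // /and3P [_]; move: ei; lia.
  by rewrite coefXM mul0r coef0 subr0.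
have lxy : (ell x < ell y)%N by move: ei; lia.
have -> : klmu x = (p x)`_i.
  have dx : (ell (pmul x s) < ell x)%N by rewrite ex.
  have od : odd (ell y - ell x) by move: ei; lia.
  rewrite /klmu lxy dx od /=.
  by congr (_`_ _); move: ei; lia.
have -> : kexp x = i.+1 by rewrite /kexp; move: ei; lia.
rewrite coefXM /= coefCM coefXnM ltnn subnn (good_diag (gPf1 lxy)) coef1.
by rewrite mulr1 subrr.
Qed.

Lemma stp_good : good (pmul y s) stp.
Proof. by split; [exact: stp_diag|exact: stp_deg|exact: stp_bar]. Qed.

End Step.

Definition Pf y : 'S_d -> {poly int} :=
  epsilon (inhabits (fun _ => 0)) (fun p => [/\ good y p, supp y p & rinv y p]).

Lemma good1 : good 1%g (fun x => (x == 1%g)%:R).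
Proof.
have C1 : Cel 1%g (fun x => (x == 1%g)%:R) = one.
  apply/ffunP => x; rewrite !ffunE /kcf; have [->|_] := eqVneq x 1%g.
    by rewrite mqr_refl peval1 mulr1.
  by rewrite peval0 mulr0.
split.
- by rewrite eqxx.
- by move=> x i ne _; rewrite (negPf ne) coef0.
- by rewrite C1 hbar_Hb Jb1.
Qed.

(** Induction on l(y). The invariance holds by construction for the descent used
    in the step, and for any other descent because the result does not depend on
    the descent, by uniqueness. *)
Lemma Pf_spec y : [/\ good y (Pf y), supp y (Pf y) & rinv y (Pf y)].
Proof.
have [n] := ubnP (ell y); elim: n y => // n IH y lt_n.
apply: (epsilon_spec (inhabits (fun _ => 0)) (fun p => [/\ good y p, supp y p & rinv y p])).
have [->|/perm_descent [i [j [a lt]]]] := eqVneq y 1%g.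
  exists (fun x => (x == 1%g)%:R); split; first exact: good1.
    by move=> x; have [->|//] := eqVneq x 1%g; rewrite bruhat_refl.
  by move=> s _; rewrite ell1.
have key s : basic_transp s -> (ell (pmul y s) < ell y)%N ->
    exists p, [/\ good y p, supp y p & forall x, p (pmul x s) = p x].
  move=> bs lts; have ey : ell (pmul (pmul y s) s) = (ell (pmul y s)).+1.
    by rewrite (pmulK _ bs); apply: ell_down_basic => //; apply/negbTE; rewrite -leqNgt ltnW.
  have ly : (ell (pmul y s) < n)%N by apply: leq_trans lts _; rewrite -ltnS.
  have gP z : (ell z < ell (pmul y s))%N -> [/\ good z (Pf z), supp z (Pf z) & rinv z (Pf z)].
    by move=> lz; apply: IH; exact: ltn_trans lz ly.
  have [g sg _] := IH _ ly.
  exists (stp (pmul y s) s (Pf (pmul y s)) Pf); split; last by move=> x; exact: stp_inv.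
    by rewrite -{1}[y](pmulK _ bs); exact: stp_good.
  by rewrite -{1}[y](pmulK _ bs); exact: stp_supp.
have ay := adj_basic a.
have lta : (ell (pmul y (tperm i j)) < ell y)%N by rewrite (ell_down a lt).
have [p [gp sp _]] := key _ ay lta.
exists p; split=> // s bs lts; have [p' [gp' _ h]] := key s bs lts.
by move=> x; rewrite !(good_uniq gp gp').
Qed.

Lemma KL_family_exists : is_KL_family (fun x y : 'S_d => Pf y x).
Proof.
split=> [x y|y|x y b ne|y].
- by have [_ g _] := Pf_spec y; exact: g.
- by have [g _ _] := Pf_spec y; exact: (good_diag g).
- have [g _ _] := Pf_spec y.
  have [e|lt] := bruhat_ell b; first by rewrite e eqxx in ne.
  have [->|P0] := eqVneq (Pf y x) 0; first by rewrite size_poly0 /=; move: lt; lia.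
  have := lead_coef_eq0 (Pf y x); rewrite (negPf P0) lead_coefE.
  have [le|lt2 _] := leqP (ell y) (ell x + (size (Pf y x)).-1.*2).
    by rewrite (good_deg g ne le) eqxx.
  by clear -lt2 lt; move: (_.-1) lt2 => m; lia.
- by rewrite klC_coef; have [g _ _] := Pf_spec y; exact: (good_bar g).
Qed.

Lemma KLP : is_KL_family (@KL d).
Proof.
apply: (epsilon_spec (inhabits (fun _ _ => 0)) (@is_KL_family d)).
by exists (fun x y : 'S_d => Pf y x); exact: KL_family_exists.
Qed.

Lemma KL_good y : good y ((@KL d)^~ y).
Proof.
split.
- exact: (KL_diag KLP).
- move=> x i ne le; have [b|nb] := boolP (bruhat x y); last by rewrite (KL_support KLP nb) coef0.
  have [e|lt] := bruhat_ell b; first by rewrite e eqxx in ne.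
  have := KL_degree KLP b ne => h.
  by apply: nth_default; move: h lt le; case: (size _) => [|m] /=; lia.
- by rewrite -klC_coef; exact: (KL_bar KLP).
Qed.

Lemma KL_rinv y s x : basic_transp s -> (ell (pmul y s) < ell y)%N ->
  KL (pmul x s) y = KL x y.
Proof.
move=> bs lt; have [g _ r] := Pf_spec y.
by rewrite !(good_uniq (KL_good y) g) r.
Qed.

(** The anti-automorphism H_w |-> H_(w^-1) commutes with the bar involution, so
    that it exchanges C_y and C_(y^-1). *)
Lemma KL_inv x y : KL (x^-1)%g (y^-1)%g = KL x y.
Proof.
have g : good y (fun x => KL (x^-1)%g (y^-1)%g).
  have [g1 g2 g4] := KL_good (y^-1)%g.
  have e : Cel y (fun x => KL (x^-1)%g (y^-1)%g) = hiota (Cel (y^-1)%g ((@KL d)^~ (y^-1)%g)).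
    rewrite [in RHS]Cel_sum (semilin_sum (hiota_lin d)) Cel_sum (reindex_inj invg_inj) /=.
    by apply: eq_bigr => z _; rewrite (linZ _ _ (hiota_lin d)) hiotaE /kcf invgK !ellV.
  split; first exact: g1.
    by move=> z i ne le; apply: g2; rewrite ?(inj_eq invg_inj) // !ellV.
  by rewrite e hbar_hiota g4.
by rewrite -(good_uniq g (KL_good y)).
Qed.

Lemma KL_linv y s x : basic_transp s -> (ell (pmul s y) < ell y)%N ->
  KL (pmul s x) y = KL x y.
Proof.
move=> bs lt; rewrite -KL_inv pmulV (basicV bs) KL_rinv ?KL_inv //.
by rewrite -(ell_left y bs) ellV.
Qed.

(** In terms of coefficients, the eigenvalue -q amounts to P_(xs,y) = P_(x,y). *)
Lemma klC_eigen y s : basic_transp s -> (ell (pmul y s) < ell y)%N ->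
  hmul (klC (@KL d) y) (Hb s) = - q *: klC (@KL d) y.
Proof.
move=> bs lt; rewrite (mRop hmP _ bs) klC_coef; apply/ffunP => x.
rewrite (Rop_coef _ _ bs) !ffunE -[RHS]/(_ * _) /kcf (KL_rinv _ bs lt) /bR.
rewrite -[- q]/mq [in LHS]mulrA -mulrBl [RHS]mulrA; congr (_ * _).
have := ell_pmul_basic x bs; case: ifP => _ ->; rewrite mqrS; first by rewrite mul0r subr0.
by rewrite hcE; exact: (eigen_scalar _ q_neq0).
Qed.

End KLBasis.

(** * The Hecke action and the bar involution on tensor space *)

Lemma expr_divS (F : fieldType) (x : F) k l : x != 0 -> x ^+ k.+1 / x ^+ l.+1 = x ^+ k / x ^+ l.
Proof. by move=> x0; rewrite !exprS -mulf_div divff // mul1r. Qed.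

Lemma expr_divSr (F : fieldType) (x : F) k l : x != 0 ->
  x ^+ k / x ^+ l * x^-1 = x ^+ k / x ^+ l.+1.
Proof. by move=> x0; rewrite exprSr invfM mulrA mulrAC. Qed.

Lemma scale_commB (R : comNzRingType) (V : lmodType R) (r h : R) (A B : V) :
  r *: A - h *: (r *: B) = r *: (A - h *: B).
Proof. by rewrite scalerBr !scalerA mulrC. Qed.

Lemma pi_eq_scalar (F : fieldType) (x : F) k l : x != 0 ->
  x ^+ k / x ^+ l - (x - x^-1) * (x ^+ k / x ^+ l.+1) = x ^+ k / x ^+ l.+1 * x^-1.
Proof.
move=> x0; rewrite exprSr; move: (x ^+ k) (x ^+ l) (expf_neq0 l x0) => a b b0.
by field; rewrite x0 b0.
Qed.

Section TensorAction.

Variables n d : nat.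
Implicit Types (a b : d.-tuple 'I_n) (w x s : 'S_d) (i j : 'I_d).
Local Notation H := (hecke d).
Local Notation T := (tens n d).
Local Notation one := (Hb (1%g : 'S_d)).

Lemma dl_M a : dl a = M a. Proof. by []. Qed.

Lemma invt_up a i j : adjacent i j -> (av a i < av a j)%N ->
  invt (tact a (tperm i j)) = (invt a).+1.
Proof. by move=> adj lt; rewrite invt_tact inv_adj_up. Qed.

Lemma invt_down a i j : adjacent i j -> (av a j < av a i)%N ->
  invt a = (invt (tact a (tperm i j))).+1.
Proof. by move=> adj lt; rewrite invt_tact -inv_adj_down. Qed.

Lemma tact_eq a i j : av a i = av a j -> tact a (tperm i j) = a.
Proof.
move=> e; apply: eq_from_tnth => k; rewrite tactE.
by case: tpermP => // ->; apply: val_inj.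
Qed.

(** The action of H_s on M_a. The three cases of the definition are distinguished
    by the number of inversions of a . s, so that s need not be given as a
    transposition of two positions. *)
Definition tauM s a : T :=
  if (invt a < invt (tact a s))%N then M (tact a s)
  else if tact a s == a then q^-1 *: M a
  else M (tact a s) - hc *: M a.

Lemma tau_ex s : {f : T -> T | semilin ridq f & forall a, f (M a) = tauM s a}.
Proof. by exists (linext ridq (tauM s)); [exact: linext_semilin | exact: linext_dl]. Qed.

Definition tau s : T -> T := s2val (tau_ex s).
Lemma tau_lin s : semilin ridq (tau s). Proof. exact: s2valP. Qed.
Lemma tauE s a : tau s (M a) = tauM s a. Proof. exact: (s2valP' (tau_ex s)). Qed.

Lemma tauM_lt a i j : adjacent i j -> (av a i < av a j)%N ->
  tauM (tperm i j) a = M (tact a (tperm i j)).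
Proof. by move=> adj lt; rewrite /tauM (invt_up adj lt) ltnSn. Qed.

Lemma tauM_eq a i j : av a i = av a j -> tauM (tperm i j) a = q^-1 *: M a.
Proof. by move=> e; rewrite /tauM (tact_eq e) ltnn eqxx. Qed.

Lemma tauM_gt a i j : adjacent i j -> (av a j < av a i)%N ->
  tauM (tperm i j) a = M (tact a (tperm i j)) - hc *: M a.
Proof.
move=> adj lt; rewrite /tauM [invt a](invt_down adj lt) ltnNge leqnSn /=.
case: eqP => // e; have := invt_down adj lt; rewrite e; lia.
Qed.

Definition wmapc a0 x : Qq := q ^+ invt (tact a0 x) / q ^+ ell x.

Lemma wmap_ex a0 : {f : H -> T | semilin ridq f &
  forall x, f (Hb x) = wmapc a0 x *: M (tact a0 x)}.
Proof.
by exists (linext ridq (fun x => wmapc a0 x *: M (tact a0 x)));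
  [exact: linext_semilin | exact: linext_dl].
Qed.

(** The map h |-> M_(a0) h for a0 weakly increasing (see [wmap_hact]), by its
    values on the basis. *)
Definition wmap a0 : H -> T := s2val (wmap_ex a0).
Lemma wmap_lin a0 : semilin ridq (wmap a0). Proof. exact: s2valP. Qed.
Lemma wmapE a0 x : wmap a0 (Hb x) = wmapc a0 x *: M (tact a0 x).
Proof. exact: (s2valP' (wmap_ex a0)). Qed.

Lemma qX_neq0 k : q ^+ k != 0. Proof. by rewrite expf_neq0 // q_neq0. Qed.

(** If the letters at the two positions are equal then x and xs give the same
    word, and the image of the shorter one is q times that of the longer one; so
    right multiplication by H_s becomes the scalar q^-1. *)
Lemma wmap_Rop a0 s h : wincr a0 -> basic_transp s -> wmap a0 (Rop s h) = tau s (wmap a0 h).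
Proof.
move=> /wincrP wa bs; move: h; apply: (semilin_ext (semilin_idid (Rop_lin s) (wmap_lin a0))
  (semilin_idid (wmap_lin a0) (tau_lin s))) => x; rewrite dl_Hb /=.
rewrite RopE (semilinB (wmap_lin a0)) (linZ _ _ (wmap_lin a0)) !wmapE (linZ _ _ (tau_lin s)) tauE.
have [i [j [adj es]]] := elimT (basicP s) bs; rewrite -tactM.
have avx k : av (tact a0 x) k = av a0 (x k) by rewrite av_tact.
have lt1 : (av (tact a0 x) i < av (tact a0 x) j)%N -> (x i < x j)%N.
  rewrite !avx; case: (ltngtP (x i) (x j)) => [//|/wa|/val_inj ->]; last by rewrite ltnn.
  by rewrite ltnNge => ->.
have lt2 : (av (tact a0 x) j < av (tact a0 x) i)%N -> (x j < x i)%N.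
  rewrite !avx; case: (ltngtP (x i) (x j)) => [/wa|//|/val_inj ->]; last by rewrite ltnn.
  by rewrite ltnNge => ->.
have := ell_pmul_basic x bs.
rewrite /bR /wmapc -tactM es (ell_updown _ adj).
case: (ltngtP (av (tact a0 x) i) (av (tact a0 x) j)) => [lt|lt|e].
- rewrite (lt1 lt) => ->; rewrite (tauM_lt adj lt) (invt_up adj lt).
  by rewrite scale0r subr0 (expr_divS _ _ q_neq0).
- rewrite ltnNge (ltnW (lt2 lt)) /= => ->; rewrite (tauM_gt adj lt) (invt_down adj lt).
  by rewrite (expr_divS _ _ q_neq0) scale_commB.
- rewrite (tauM_eq e) (tact_eq e).
  case: ifP => _ ->; first by rewrite scale0r subr0 [in RHS]scalerA (expr_divSr _ _ q_neq0).
  by rewrite hcE [RHS]scalerA [X in _ - X]scalerA -scalerBl (pi_eq_scalar _ _ q_neq0).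
Qed.

(** The action along reduced words; it satisfies the axioms because each M_a is in
    the image of some [wmap a0], through which the action is right
    multiplication in the Hecke algebra. *)
Definition tact_op (v : T) (h : H) : T := linext ridq (fun w => wordop tau w v) h.

Lemma wordop_tau_lin w : semilin ridq (wordop tau w).
Proof.
elim/wordop_ind: w => [|w s bs e h [D Z]]; first by split=> [u v|c v]; rewrite !wordop1.
by split=> [u v|c v]; rewrite !h ?D ?Z ?(semiD _ _ (tau_lin s)) ?(linZ _ _ (tau_lin s)).
Qed.

Lemma tact_op_linr v : semilin ridq (tact_op v). Proof. exact: linext_semilin. Qed.

Lemma tact_op_linl h : semilin ridq (tact_op^~ h).
Proof.
rewrite /tact_op /linext; split=> [u v|c v].
  by rewrite -big_split; apply: eq_bigr => w _; rewrite (semiD _ _ (wordop_tau_lin w)) scalerDr.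
rewrite scaler_sumr; apply: eq_bigr => w _.
by rewrite (linZ _ _ (wordop_tau_lin w)) !scalerA mulrC.
Qed.

Lemma tact_op_Hb v w : tact_op v (Hb w) = wordop tau w v.
Proof. exact: (linext_dl ridq (fun w => wordop tau w v)). Qed.

Lemma wmap_hmul a0 h h' : wincr a0 -> wmap a0 (hmul h h') = tact_op (wmap a0 h) h'.
Proof.
move=> wa; move: h'; apply: (semilin_ext (semilin_idid (hmul_linr h) (wmap_lin a0))
  (tact_op_linr _)) => w; rewrite dl_Hb tact_op_Hb /=.
rewrite (hecke_product_uniq (hmulP d) (hprodP d)) hprod_dl.
elim/wordop_ind: w => [|w s bs e hw IH]; first by rewrite !wordop1.
by rewrite !hw (wmap_Rop _ wa bs) IH.
Qed.

Lemma M_wmap a : M a = wmap (sorta a) (Hb (std a)).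
Proof. by rewrite wmapE /wmapc sortaK ell_std divff ?qX_neq0 // scale1r. Qed.

Lemma tact_opP : is_hecke_action tact_op.
Proof.
split.
- by move=> h; apply/linear_semilin; exact: tact_op_linl.
- by move=> v; apply/linear_semilin; exact: tact_op_linr.
- by move=> v; rewrite tact_op_Hb wordop1.
- move=> v h h'; move: v; apply: (semilin_ext
    (semilin_idid (tact_op_linl h) (tact_op_linl h')) (tact_op_linl _)) => a.
  by rewrite dl_M M_wmap /= -!(wmap_hmul _ _ (wincr_sorta a)) hmulA.
move=> a i j adj; rewrite tact_op_Hb wordop_s ?adj_basic // tauE.
rewrite -[(tnth a i < _)%N]/(av a i < av a j)%N.
have -> : (tnth a i == tnth a j) = (av a i == av a j) by [].
case: (ltngtP (av a i) (av a j)) => [lt|lt|e].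
- exact: tauM_lt.
- by rewrite (tauM_gt adj lt) hcE.
- exact: tauM_eq.
Qed.

Lemma hactP : is_hecke_action (@hact n d).
Proof.
apply: (epsilon_spec (inhabits (fun v _ => v)) (@is_hecke_action n d)).
by exists tact_op; exact: tact_opP.
Qed.

Lemma hact_linl h : semilin ridq ((@hact n d)^~ h).
Proof. by apply/linear_semilin; case: hactP. Qed.
Lemma hact_linr (v : T) : semilin ridq (hact v).
Proof. by apply/linear_semilin; case: hactP. Qed.
Lemma hact1 (v : T) : hact v one = v. Proof. by case: hactP. Qed.
Lemma hactA (v : T) h h' : hact (hact v h) h' = hact v (hmul h h').
Proof. by case: hactP. Qed.

Lemma hact_s (v : T) s : basic_transp s -> hact v (Hb s) = tau s v.
Proof.
case/basicP => i [j [adj ->]]; move: v.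
apply: (semilin_ext (hact_linl (Hb (tperm i j))) (tau_lin (tperm i j))) => a.
rewrite dl_M tauE (act_gen hactP a adj).
rewrite -[(tnth a i < _)%N]/(av a i < av a j)%N.
have -> : (tnth a i == tnth a j) = (av a i == av a j) by [].
case: (ltngtP (av a i) (av a j)) => [lt|lt|e].
- by rewrite (tauM_lt adj lt).
- by rewrite (tauM_gt adj lt) hcE.
- by rewrite (tauM_eq e).
Qed.

Lemma wmap_hact a0 h : wincr a0 -> hact (M a0) h = wmap a0 h.
Proof.
move=> wa; move: h; apply: (semilin_ext (hact_linr _) (wmap_lin a0)) => w; rewrite dl_Hb.
elim/ell_ind: w => [|w s bs e IH].
  by rewrite hact1 wmapE /wmapc tact1 ell1 -[X in q ^+ X]ell_std (std_wincr wa) ell1 divr1 scale1r.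
have e2 : ell (pmul (pmul w s) s) = (ell (pmul w s)).+1 by rewrite (pmulK _ bs).
rewrite -[w](pmulK _ bs) -(mHb_up (hmulP d) bs e2) -hactA IH (mRop (hmulP d) _ bs).
by rewrite (hact_s _ bs) (wmap_Rop _ wa bs).
Qed.

Definition psiM a : T := hact (M (sorta a)) (Jb (std a)).
(** The bar involution: M_a = M_(a0) H_(d(a)) must be sent to M_(a0) times the bar
    conjugate of H_(d(a)). *)
Definition psi : T -> T := linext rbar psiM.
Lemma psi_lin : semilin rbar psi. Proof. exact: linext_semilin. Qed.
Lemma psiE a : psi (M a) = psiM a. Proof. exact: linext_dl. Qed.

Lemma psiM_up a i j : adjacent i j -> (av a i < av a j)%N ->
  psiM (tact a (tperm i j)) = hact (psiM a) (Jb (tperm i j)).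
Proof.
move=> adj lt; have ne : av a i != av a j by rewrite neq_ltn lt.
have up : ell (pmul (std a) (tperm i j)) = (ell (std a)).+1.
  by rewrite -(std_tact_adj adj ne) !ell_std invt_up.
by rewrite /psiM sorta_tact (std_tact_adj adj ne) hactA -(Jb_up (adj_basic adj) up).
Qed.

(** If the letters at the two positions differ this follows from d(a . s) = d(a) s.
    If they agree then d(a) s = s' d(a) for an adjacent transposition s' that
    fixes a0, and the bar conjugate of H_(s') acts on M_(a0) by q. *)
Lemma psi_s (v : T) s : basic_transp s -> psi (hact v (Hb s)) = hact (psi v) (Jb s).
Proof.
move=> bs; move: v; apply: (semilin_ext (semilin_idbar (hact_linl (Hb s)) psi_lin)
   (semilin_barid psi_lin (hact_linl (Jb s)))) => a; rewrite dl_M /=.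
rewrite (hact_s _ bs) tauE psiE; have [i [j [adj es]]] := elimT (basicP s) bs; rewrite es.
case: (ltngtP (av a i) (av a j)) => [lt|lt|e].
- by rewrite (tauM_lt adj lt) psiE (psiM_up adj lt).
- rewrite (tauM_gt adj lt) (semilinB psi_lin) (barZ _ _ psi_lin) !psiE fbar_hc.
  have up : (av (tact a (tperm i j)) i < av (tact a (tperm i j)) j)%N.
    by rewrite !av_tact /= tpermL tpermR.
  have e0 : tact (tact a (tperm i j)) (tperm i j) = a.
    by rewrite -{2}(tactK a (tperm i j)) tpermV.
  have e1 := psiM_up adj up; rewrite e0 in e1.
  rewrite [in RHS]e1 hactA (Jb_sq (adj_basic adj)).
  rewrite (semiD _ _ (hact_linr _)) (linZ _ _ (hact_linr _)) hact1 -e1.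
  by rewrite scaleNr opprK.
rewrite (tauM_eq e) (barZ _ _ psi_lin) psiE fmorphV /= fbar_q invrK /psiM hactA.
set k := std a i; set l := std a j.
have kl : adjacent k l by exact: std_adj_eq.
have up : ell (pmul (std a) (tperm i j)) = (ell (std a)).+1.
  by apply: ell_up => //; exact: adj_lt kl.
have up2 : ell (pmul (tperm k l) (std a)) = (ell (tperm k l) + ell (std a))%N.
  by rewrite -std_conj up (ell_basic (adj_basic kl)).
have e3 : hact (M (sorta a)) (Jb (tperm k l)) = q *: M (sorta a).
  have e4 : av (sorta a) k = av (sorta a) l by rewrite /sorta !av_tact /= !permK.
  rewrite (Jb_s (adj_basic kl)) (semiD _ _ (hact_linr _)) (linZ _ _ (hact_linr _)) hact1.
  rewrite (hact_s _ (adj_basic kl)) tauE (tauM_eq e4).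
  by rewrite -scalerDl hcE addrCA subrr addr0.
rewrite -(Jb_up (adj_basic adj) up) std_conj (Jb_mul up2) -hactA e3.
by rewrite (linZ _ _ (hact_linl _)).
Qed.

Lemma psi_hact (v : T) h : psi (hact v h) = hact (psi v) (hbar h).
Proof.
move: h; apply: (semilin_ext (semilin_idbar (hact_linr v) psi_lin)
   (semilin_barid (hbar_lin d) (hact_linr (psi v)))) => w; rewrite dl_Hb /= hbar_Hb.
elim/ell_ind: w => [|w s bs e IH]; first by rewrite Jb1 !hact1.
have e2 : ell (pmul (pmul w s) s) = (ell (pmul w s)).+1 by rewrite (pmulK _ bs).
rewrite (Jb_down bs e) -hactA -IH -(psi_s _ bs) hactA (mHb_up (hmulP d) bs e2).
by rewrite (pmulK _ bs).
Qed.

Lemma psi_wincr a : wincr a -> psi (M a) = M a.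
Proof. by move=> wa; rewrite psiE /psiM sorta_wincr // std_wincr // Jb1 hact1. Qed.

Lemma M_hact a : M a = hact (M (sorta a)) (Hb (std a)).
Proof. by rewrite (wmap_hact _ (wincr_sorta a)) -M_wmap. Qed.

Lemma psiP : is_tensor_bar psi.
Proof.
split; [by case: psi_lin | | exact: psi_wincr | exact: psi_hact].
apply: (semilin_ext (semilin_barbar psi_lin psi_lin) (semilin_id _)) => a; rewrite dl_M /=.
rewrite psiE /psiM psi_hact (psi_wincr (wincr_sorta a)) -hbar_Hb hbarK.
by rewrite -M_hact.
Qed.

Lemma tbarP : is_tensor_bar (@tbar n d).
Proof.
apply: (epsilon_spec (inhabits id) (@is_tensor_bar n d)).
by exists psi; exact: psiP.
Qed.

Lemma tbar_lin : semilin rbar (@tbar n d).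
Proof. by case: tbarP => -[D Z] _ _ _; split. Qed.

Lemma tbar_wmap a h : wincr a -> tbar (wmap a h) = wmap a (hbar h).
Proof. by move=> wa; rewrite -!(wmap_hact _ wa) (tbar_act tbarP) (tbar_wincr tbarP wa). Qed.

Lemma wmap_coef a0 h b : (wmap a0 h b : Qq) = \sum_(x | tact a0 x == b) (h x : Qq) * wmapc a0 x.
Proof.
rewrite {1}(ffun_dl h) (semilin_sum (wmap_lin a0)) sum_ffunE [RHS]big_mkcond.
apply: eq_bigr => x _; rewrite (linZ _ _ (wmap_lin a0)) dl_Hb wmapE !ffunE eq_sym.
rewrite -[LHS]/(_ * (_ * _)).
by case: eqP => _; rewrite ?mulr1 ?mulr0.
Qed.

Lemma tbar_coef a b : (tbar (M a) b : Qq) = wmap (sorta a) (Jb (std a)) b.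
Proof. by rewrite {1}M_wmap (tbar_wmap _ (wincr_sorta a)) hbar_Hb. Qed.

(** The bar involution is unitriangular for the number of inversions, because it
    is so on the Hecke algebra for the length and because l(x) is at least the
    number of inversions of a0 . x, with equality for x = d(a). *)
Lemma tbar_tri a b : (tbar (M a) b : Qq) != 0 ->
  b = a \/ ((invt b < invt a)%N /\ exists w, b = tact a w).
Proof.
rewrite tbar_coef wmap_coef => ne.
have [x /andP[/eqP xb nz]] : exists x, (tact (sorta a) x == b) && (Jb (std a) x != 0 :> Qq).
  apply/existsP; apply: contraNT ne; rewrite negb_exists => /forallP h.
  apply/eqP; apply: big1 => x xb; have := h x; rewrite xb /= negbK => /eqP ->.
  by rewrite mul0r.
have [e|lt] := Jb_tri nz; first by left; rewrite -xb e sortaK.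
right; rewrite -xb; split.
  by apply: leq_ltn_trans (invt_le_ell _ (wincr_sorta a)) _; rewrite -ell_std.
by exists (pmul ((std a)^-1)%g x); rewrite -tactM.
Qed.

Lemma tbar_diag a : (tbar (M a) a : Qq) = 1.
Proof.
rewrite tbar_coef wmap_coef (bigD1 (std a)) ?sortaK //= Jb_diag mul1r.
rewrite /wmapc sortaK ell_std divff ?qX_neq0 // big1 ?addr0 // => x /andP[/eqP xa ne].
have [->|nz] := eqVneq (Jb (std a) x : Qq) 0; first by rewrite mul0r.
have [e|lt] := Jb_tri nz; first by rewrite e eqxx in ne.
have := invt_le_ell x (wincr_sorta a); rewrite xa; move: lt; rewrite ell_std; lia.
Qed.

Lemma tbar_expand (v : T) a : (tbar v a : Qq) = \sum_b (tbar (M b) a : Qq) * fbar (v b).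
Proof.
rewrite {1}(ffun_dl v) (semilin_sum tbar_lin) sum_ffunE; apply: eq_bigr => b _.
by rewrite (barZ _ _ tbar_lin) dl_M !ffunE mulrC.
Qed.

End TensorAction.

(** * Two bar invariant bases of tensor space *)

Lemma kt_scalar (F : fieldType) (x : F) l y c : x != 0 ->
  (- x) ^+ l / (- x) ^+ y * (x ^+ c / x ^+ l) = (- x) ^+ c / (- x) ^+ y * ((-1) ^+ l * (-1) ^+ c).
Proof.
move=> x0; rewrite -[- x]mulN1r !exprMn.
rewrite (_ : ((-1) ^+ c * x ^+ c) = ((-1) ^+ c * x ^+ c)) //.
have s1 : (-1) ^+ c * (-1) ^+ c = 1 :> F by rewrite -exprMn mulrNN mulr1 expr1n.
have lx := expf_neq0 l x0; move: ((-1) ^+ y * x ^+ y)^-1 => Y.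
rewrite -!mulrA; rewrite [Y * _]mulrA.
transitivity ((-1) ^+ l * (x ^+ l / x ^+ l) * Y * x ^+ c); first by ring.
rewrite divff // mulr1.
transitivity (((-1) ^+ c * (-1) ^+ c) * ((-1) ^+ l * Y * x ^+ c)); last by ring.
by rewrite s1 mul1r.
Qed.

Lemma expr_div_sub (F : fieldType) (x : F) c l : x != 0 -> (c <= l)%N ->
  x ^+ c / x ^+ l = x ^- (l - c).
Proof.
by move=> x0 le; rewrite -{1}(subnKC le) exprD invfM mulrA divff ?mul1r // expf_neq0.
Qed.

Lemma scalar_shuffle (F : fieldType) (A B P Q : F) : A * A = 1 -> B * B = 1 ->
  A * (B * A * Q * P * B) = Q * P.
Proof.
move=> A1 B1; transitivity ((A * A) * (B * B) * (Q * P)); first by ring.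
by rewrite A1 B1 !mul1r.
Qed.

Lemma lt_scalar (F : fieldType) (x P : F) L c m z : x != 0 ->
  x ^+ L / x ^+ (z + c) * P * (x ^+ c / x ^+ (z + c))
  = x ^+ m * x ^- z.*2 * (x ^+ L / x ^+ (c + m) * P).
Proof.
move=> x0; rewrite -addnn !exprD.
move: (expf_neq0 z x0) (expf_neq0 c x0) (expf_neq0 m x0).
move: (x ^+ z) (x ^+ c) (x ^+ m) (x ^+ L) => Z C Mm LL z0 c0 m0.
by field; rewrite z0 c0 m0.
Qed.

Section TensorKL.

Variables n d : nat.
Implicit Types (a b c : d.-tuple 'I_n) (w x y z s u : 'S_d) (i j : 'I_d).
Local Notation H := (hecke d).
Local Notation T := (tens n d).

(** The image of C_y for y = d(b). *)
Definition Kt b : T := wmap (sorta b) (klC (@KL d) (std b)).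

Lemma Kt_bar b : tbar (Kt b) = Kt b.
Proof. by rewrite /Kt (tbar_wmap _ (wincr_sorta b)) (KL_bar (KLP d)). Qed.

Lemma Kt_sum b c : (Kt b c : Qq) = \sum_(w | tact (sorta b) w == c)
  kcf (std b) ((@KL d)^~ (std b)) w * wmapc (sorta b) w.
Proof. by rewrite /Kt wmap_coef klC_coef; apply: eq_bigr => w _; rewrite ffunE. Qed.

Lemma Kt_term b c w : tact (sorta b) w = c ->
  kcf (std b) ((@KL d)^~ (std b)) w * wmapc (sorta b) w
  = mqr (invt c) (invt b) * ((-1) ^+ ell w * (-1) ^+ invt c * peval (KL w (std b)) (q ^+ 2)).
Proof.
move=> e; rewrite /kcf /wmapc e mulrAC ell_std [RHS]mulrA; congr (_ * _).
exact: (kt_scalar _ _ _ q_neq0).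
Qed.

Lemma sorta_fiber b c : tact (sorta b) (std c) = c <-> sorta c = sorta b.
Proof.
split=> [<-|<-]; last exact: sortaK.
by rewrite sorta_tact sorta_wincr // wincr_sorta.
Qed.

(** The permutations that send the weakly increasing word to c form the coset of
    d(c) for the stabiliser of that word. *)
Lemma fiber_sum (R : nmodType) (F : 'S_d -> R) b c : sorta c = sorta b ->
  \sum_(w | tact (sorta b) w == c) F w
  = \sum_(z | tact (sorta b) z == sorta b) F (pmul z (std c)).
Proof.
move=> e; rewrite (reindex_inj (h := fun z => pmul z (std c))); last first.
  by move=> u v /(mulgI (std c)).
apply: eq_bigl => z; rewrite -tactM -{2}(sortaK c) e.
by rewrite (inj_eq (@tact_inj n d (std c))).
Qed.

Lemma Kt_coef b c : sorta c = sorta b ->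
  (Kt b c : Qq) = mqr (invt c) (invt b) *
     \sum_(z | tact (sorta b) z == sorta b) (-1) ^+ ell z * peval (KL (pmul z (std c)) (std b)) (q ^+ 2).
Proof.
move=> e; rewrite Kt_sum (fiber_sum _ e) mulr_sumr; apply: eq_bigr => z /eqP zs.
rewrite (Kt_term (c := c)); last by rewrite -tactM zs -e sortaK.
rewrite sign_ellM ell_std -[(-1) ^+ ell z * _ * _]mulrA -exprMn mulrNN mulr1 expr1n.
by rewrite mulr1.
Qed.

Lemma Kt_out b c : sorta c != sorta b -> (Kt b c : Qq) = 0.
Proof.
move=> ne; rewrite Kt_sum big_pred0 // => w; apply/negbTE; apply: contra ne => /eqP <-.
by rewrite sorta_tact sorta_wincr // wincr_sorta.
Qed.

(** The elements w of the coset of d(b) are at least as long as d(b), so that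
    P_(w,d(b)) = 0 unless w = d(b). *)
Lemma Kt_diag b : (Kt b b : Qq) = 1.
Proof.
rewrite Kt_sum (bigD1 (std b)) ?sortaK //= big1 ?addr0.
  rewrite (Kt_term (sortaK b)) mqr_refl mul1r (KL_diag (KLP d)) peval1 mulr1.
  by rewrite ell_std -exprMn mulrNN mulr1 expr1n.
move=> w /andP[/eqP wb ne].
rewrite /kcf (degcond_ge (good_deg (KL_good (std b))) ne) ?peval0 ?mulr0 ?mul0r //.
by rewrite ell_std -[X in invt X]wb; apply: invt_le_ell; exact: wincr_sorta.
Qed.

Lemma Kt_neg b c : c != b -> negZ (Kt b c).
Proof.
move=> ne; rewrite Kt_sum; apply: negZ_sum => w /eqP wc.
have nw : w != std b by apply: contra ne => /eqP e; rewrite -wc e sortaK.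
have le : (invt (tact (sorta b) w) <= ell w)%N by apply: invt_le_ell; exact: wincr_sorta.
rewrite /wmapc (expr_div_sub q_neq0 le) mulrC.
apply: negZ_exp; apply: deg_negZ => i.
exact: (good_deg (KL_good (std b)) nw).
Qed.

(** A descent of b is a descent of d(b). *)
Lemma Kt_eigen b i j : adjacent i j -> (av b j < av b i)%N ->
  hact (Kt b) (Hb (tperm i j)) = - q *: Kt b.
Proof.
move=> adj lt; rewrite /Kt -(wmap_hact _ (wincr_sorta b)) hactA.
rewrite (klC_eigen (adj_basic adj)); first by rewrite (linZ _ _ (hact_linr _)).
have e := ell_down (w := std b) adj; rewrite e //.
by rewrite std_lt /lexlt lt.
Qed.

(** The stabiliser of a weakly increasing word is generated by the adjacent
    transpositions of equal letters, and by reduced words in them: an element z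
    of the stabiliser other than 1 has a left descent, which is one of these. *)
Lemma stab_ind a (P : 'S_d -> Prop) : wincr a -> P 1%g ->
  (forall z i j, adjacent i j -> av a i = av a j -> ell z = (ell (pmul (tperm i j) z)).+1 ->
     tact a (pmul (tperm i j) z) = a -> P (pmul (tperm i j) z) -> P z) ->
  forall z, tact a z = a -> P z.
Proof.
move=> /wincrP wa P1 PS z; have [m] := ubnP (ell z); elim: m z => // m IH z lt_m sz.
have [->//|nz] := eqVneq z 1%g.
have nz' : (z^-1)%g != 1%g by rewrite invg_eq1.
have [i [j [adj lt]]] := perm_descent nz'.
have szV k : av a ((z^-1)%g k) = av a k.
  by rewrite -{1}sz av_tact /= permKV.
have e : av a i = av a j.
  apply/eqP; rewrite eqn_leq wa ?(adj_lt adj) //=.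
  by rewrite -(szV i) -(szV j); exact: wa.
have el : ell z = (ell (pmul (tperm i j) z)).+1.
  by rewrite (ell_left _ (adj_basic adj)) -ellV; exact: ell_down.
have st : tact a (pmul (tperm i j) z) = a by rewrite -tactM (tact_eq e).
by apply: (PS z i j) => //; apply: IH => //; rewrite -ltnS -el.
Qed.

(** Lengths add up in S_nu D_nu. *)
Lemma ell_stab_std b z : tact (sorta b) z = sorta b ->
  ell (pmul z (std b)) = (ell z + invt b)%N.
Proof.
move=> sz; move: z sz; apply: (stab_ind (wincr_sorta b)); first by rewrite pmul1l ell1 ell_std.
move=> z i j adj e el st IH.
have ez : pmul z (std b) = pmul (tperm i j) (pmul (pmul (tperm i j) z) (std b)).
  by rewrite !pmulA pmulKl // adj_basic.
set z' := pmul (tperm i j) z in el st IH ez *.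
have lt : ((z'^-1)%g i < (z'^-1)%g j)%N.
  rewrite -(ell_updown _ adj) -(ell_left _ (adj_basic adj)) ellV.
  by rewrite /z' pmulKl ?adj_basic // -/z' el ltnSn.
have szV k : av (sorta b) ((z'^-1)%g k) = av (sorta b) k.
  by rewrite -{1}st av_tact /= permKV.
have lt2 : (((pmul z' (std b))^-1)%g i < ((pmul z' (std b))^-1)%g j)%N.
  rewrite pmulV /pmul !permM; set p := (z'^-1)%g i in lt *; set r := (z'^-1)%g j in lt *.
  have : (std b (((std b)^-1)%g p) < std b (((std b)^-1)%g r))%N by rewrite !permKV.
  rewrite std_lt /lexlt.
  have pe k : av b (((std b)^-1)%g k) = av (sorta b) k by rewrite /sorta av_tact.
  by rewrite !pe !szV e ltnn eqxx.
rewrite ez (ell_left _ (adj_basic adj)) (ell_up adj lt2) ellV IH el.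
by rewrite addSn.
Qed.

(** The longest element x with a0 . x = b. It ranks equal letters from right to
    left, and it is obtained by reversing the word, standardising it and
    reversing the result. *)
Definition lng b : 'S_d := pmul (std (tact b (wlong d))) (wlong d).

Lemma wlongK : pmul (wlong d) (wlong d) = 1%g.
Proof. by apply/permP => i; rewrite permM !wlongE rev_ordK perm1. Qed.

Lemma lng_lt b i j : (lng b i < lng b j)%N = ((av b i < av b j) || ((av b i == av b j) && (j < i)))%N.
Proof.
rewrite /lng !permM !wlongE std_lt /lexlt !av_tact /= !wlongE !rev_ordK.
by congr (_ || (_ && _)); have := ltn_ord i; have := ltn_ord j; rewrite /=; lia.
Qed.

Lemma tact_lng b : tact (sorta b) (lng b) = b.
Proof.
have wb : wincr (tact b ((lng b)^-1)%g).
  apply/wincrP => i j ij; rewrite !av_tact /=.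
  have : (lng b ((lng b)^-1%g i) < lng b ((lng b)^-1%g j))%N by rewrite !permKV.
  by rewrite lng_lt => /orP[/ltnW //|/andP[/eqP -> _]].
by rewrite -(sorta_tact b ((lng b)^-1)%g) (sorta_wincr wb) tactKV.
Qed.

Lemma ell_lng b : (ell (lng b) + dpairs (av b) = dpairs (fun i : 'I_d => i) + invt b)%N.
Proof.
have := ell_wlong (std (tact b (wlong d))); rewrite -/(lng b) ell_std.
have := invt_dpairs b; lia.
Qed.

(** The adjacent transpositions in the stabiliser are left descents of the longest
    element of the coset. *)
Lemma KL_lng b z : tact (sorta b) z = sorta b ->
  forall x, KL (pmul z x) (lng b) = KL x (lng b).
Proof.
move=> sz; move: z sz; apply: (stab_ind (wincr_sorta b)) => [x|z i j adj ea el st IH x].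
  by rewrite pmul1l.
have lt : (((lng b)^-1)%g j < ((lng b)^-1)%g i)%N.
  set p := ((lng b)^-1)%g i; set r := ((lng b)^-1)%g j.
  have : (lng b p < lng b r)%N by rewrite !permKV adj_lt.
  have pe k : av b (((lng b)^-1)%g k) = av (sorta b) k.
    by rewrite -{1}(tact_lng b) av_tact /= permKV.
  by rewrite lng_lt !pe ea ltnn eqxx.
have lt' : (ell (pmul (tperm i j) (lng b)) < ell (lng b))%N.
  by rewrite (ell_left _ (adj_basic adj)) -[X in (_ < X)%N]ellV [X in (_ < X)%N](ell_down adj lt).
by rewrite -[RHS]IH -(KL_linv (pmul z x) (adj_basic adj) lt') pmulA.
Qed.

Definition qr (k l : nat) : Qq := q ^+ k / q ^+ l.

(** The coefficient at M_c for c in the orbit of b: the parabolic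
    Kazhdan-Lusztig polynomial P_(x,u)(q^-2) for the longest elements x and u of
    the cosets of c and b, normalised to be 1 at b. *)
Definition Lt b : T := [ffun c => if sorta c == sorta b
  then qr (ell (lng b)) (ell (lng c)) * peval (KL (lng c) (lng b)) (q ^- 2) else 0].

(** The element C'_u of Kazhdan and Lusztig. *)
Definition Cp u : H := (-1) ^+ ell u *: jop (klC (@KL d) u).

Lemma Cp_bar u : hbar (Cp u) = Cp u.
Proof.
rewrite /Cp (barZ _ _ (hbar_lin d)) fbar_sign hbar_jop (KL_bar (KLP d)).
by [].
Qed.

Lemma fbar_mqr k l : fbar (mqr k l) = (-1) ^+ k * (-1) ^+ l * qr l k.
Proof.
rewrite /mqr fmorph_div /= !rmorphXn /= rmorphN /= fbar_q -mulN1r !exprMn invfM.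
rewrite -[((-1) ^+ l)^-1]exprVn invrN1 !exprVn invrK /qr.
by rewrite [LHS](AC (2*2) ((1*3)*(4*2))).
Qed.

Lemma Cp_coef u x : (Cp u x : Qq) = qr (ell u) (ell x) * peval (KL x u) (q ^- 2).
Proof.
rewrite /Cp klC_coef Cel_sum (semilin_sum (jop_lin d)) scaler_sumr sum_ffunE (bigD1 x) //=.
rewrite big1 ?addr0; last first.
  move=> y ne; rewrite (barZ _ _ (jop_lin d)) jopE !ffunE eq_sym (negPf ne).
  by rewrite mulr0n !scaler0.
rewrite (barZ _ _ (jop_lin d)) jopE !ffunE eqxx.
rewrite -[LHS]/(_ * (_ * (_ * 1))) mulr1 /kcf rmorphM /= fbar_mqr fbar_peval rmorphXn /= fbar_q.
have sg k : (-1) ^+ k * (-1) ^+ k = 1 :> Qq by rewrite -exprMn mulrNN mulr1 expr1n.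
rewrite exprVn; move: (peval _ _) (qr _ _) (sg (ell u)) (sg (ell x)) => P Q.
move: ((-1) ^+ ell u) ((-1) ^+ ell x) => A B; exact: scalar_shuffle.
Qed.

(** The coefficients of the corresponding polynomial are non-negative and not all
    0, so that its value at 1 is not 0. *)
Lemma sum_neg_q_neq0 (S : {pred 'S_d}) : (0 < #|S|)%N -> \sum_(z in S) q ^- (ell z).*2 != 0.
Proof.
move=> S0; apply/eqP => e; pose F : {poly int} := \sum_(z in S) 'X^((ell z).*2).
have F0 : F = 0.
  apply: ratp_eq0; apply: (@evq_eq0 q^-1); first by right.
  rewrite -peval_evq /F peval_sum -[RHS]e; apply: eq_bigr => z _.
  by rewrite pevalXn exprVn.
have : F.[1] = #|S|%:R.
  rewrite /F horner_sum -sumr_const; apply: eq_bigr => z _.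
  by rewrite hornerXn expr1n.
rewrite F0 horner0 => /esym/eqP; rewrite Num.Theory.pnatr_eq0 => /eqP h.
by rewrite h in S0.
Qed.

(** The coefficient at M_c is a sum over the coset of c, on which P_(.,u) is
    constant by [KL_lng] and lengths are given by [ell_stab_std]. What remains is
    a power of q times the sum of q^(-2 l(z)) over the stabiliser, which does not
    depend on c. *)
Lemma wmap_Cp b : exists2 k : Qq, k != 0 & wmap (sorta b) (Cp (lng b)) = k *: Lt b.
Proof.
pose S := \sum_(z in [pred z | tact (sorta b) z == sorta b]) q ^- (ell z).*2.
have S0 : S != 0.
  by apply: sum_neg_q_neq0; apply/card_gt0P; exists 1%g; rewrite inE tact1.
pose N := (ell (lng b) - invt b)%N.
have NE c : sorta c = sorta b -> (ell (lng c) = invt c + N)%N.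
  have dE a : dpairs (av (sorta a)) = dpairs (av a).
    by rewrite -[in RHS](sortaK a) dpairs_tact.
  move=> e; have := ell_lng b; have := ell_lng c.
  have le : (invt b <= ell (lng b))%N.
    by rewrite -{1}(tact_lng b); apply: invt_le_ell; exact: wincr_sorta.
  by rewrite -(dE b) -(dE c) e /N; move: le; lia.
exists (q ^+ N * S); first exact: (mulf_neq0 (qX_neq0 N) S0).
apply/ffunP => c; rewrite wmap_coef !ffunE; case: eqP => [e|ne]; last first.
  rewrite big_pred0; first by rewrite [_ *: _]mulr0.
  move=> w; apply/negbTE/eqP => wc; apply: ne; rewrite -wc sorta_tact.
  by rewrite sorta_wincr // wincr_sorta.
rewrite (fiber_sum _ e) -[RHS]/(_ * _) /S mulr_sumr mulr_suml; apply: eq_bigr => z /eqP sz.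
have sc : tact (sorta b) (std c) = c by apply/sorta_fiber.
have zc : tact (sorta b) (pmul z (std c)) = c by rewrite -tactM sz sc.
have lc : lng c = pmul (pmul (lng c) ((std c)^-1)%g) (std c) by rewrite /pmul mulgA mulgV mul1g.
have sl : tact (sorta b) (pmul (lng c) ((std c)^-1)%g) = sorta b.
  by rewrite -tactM -e tact_lng.
have kE : KL (lng c) (lng b) = KL (std c) (lng b) by rewrite {1}lc (KL_lng sl).
have lz : ell (pmul z (std c)) = (ell z + invt c)%N.
  by have := @ell_stab_std c z; rewrite e sz; apply.
rewrite Cp_coef (KL_lng sz) kE /wmapc zc (NE _ e) lz.
exact: (lt_scalar _ _ _ _ _ q_neq0).
Qed.

Lemma Lt_diag b : (Lt b b : Qq) = 1.
Proof.
by rewrite ffunE eqxx (KL_diag (KLP d)) peval1 mulr1 /qr (divff (qX_neq0 _)).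
Qed.

Lemma Lt_supp b c : (Lt b c : Qq) != 0 -> c = b \/ (invt c < invt b)%N.
Proof.
rewrite ffunE; case: (sorta c =P sorta b) => [e|_]; last by rewrite eqxx.
have [->|ne] := eqVneq (KL (lng c) (lng b)) 0; first by rewrite peval0 mulr0 eqxx.
have nb : bruhat (lng c) (lng b) by apply: contraNT ne => /(KL_support (KLP d)) ->.
have dE a : dpairs (av (sorta a)) = dpairs (av a).
  by rewrite -[in RHS](sortaK a) dpairs_tact.
have [el|lt] := bruhat_ell nb; [left|right].
  by rewrite -(tact_lng c) e el tact_lng.
have := ell_lng b; have := ell_lng c; rewrite -(dE b) -(dE c) e; move: lt.
by lia.
Qed.

(** The bar involution maps k Lt b to itself, and the coefficient at b, which is 1
    on both sides by triangularity, gives fbar k = k. *)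
Lemma Lt_bar b : tbar (Lt b) = Lt b.
Proof.
have [k k0 e] := wmap_Cp b.
have eb : fbar k *: tbar (Lt b) = k *: Lt b.
  by rewrite -(barZ _ _ (tbar_lin n d)) -e (tbar_wmap _ (wincr_sorta b)) Cp_bar.
have tb : (tbar (Lt b) b : Qq) = 1.
  rewrite tbar_expand (bigD1 b) //= tbar_diag mul1r Lt_diag rmorph1 big1 ?addr0 // => c ne.
  have [->|lc] := eqVneq (Lt b c : Qq) 0; first by rewrite rmorph0 mulr0.
  have [->|tc] := eqVneq (tbar (M c) b : Qq) 0; first by rewrite mul0r.
  have [ec|l1] := Lt_supp lc; first by rewrite ec eqxx in ne.
  have [ec|[l2 _]] := tbar_tri tc; first by rewrite ec eqxx in ne.
  by have := ltn_trans l1 l2; rewrite ltnn.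
have kk : fbar k = k.
  have := congr1 (fun v : T => (v b : Qq)) eb; rewrite /= !ffunE.
  rewrite -[LHS]/(_ * _) -[RHS]/(_ * _) tb.
  by have := Lt_diag b; rewrite ffunE => ->; rewrite !mulr1.
by move: eb; rewrite kk => /(scalerI k0).
Qed.

End TensorKL.

(** * Fillings of a column diagram *)

Section Fillings.

Variables l n d : nat.
Variable mu : l.-tuple nat.
Hypothesis mu_d : sumn mu = d.
Local Notation filling := (filling n mu).
Local Notation gamma := (@gamma l n d mu mu_d).
Implicit Types (A B C : filling) (c : 'I_l).

Lemma nth_mu c : nth 0%N mu c = tnth mu c.
Proof. by rewrite (tnth_nth 0%N). Qed.

Definition posn c (r : 'I_(tnth mu c)) : nat := flatten_index mu c ((tnth mu c).-1 - r).

Lemma posn_lt c (r : 'I_(tnth mu c)) : (posn r < d)%N.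
Proof.
rewrite -mu_d; apply: flatten_indexP; rewrite nth_mu.
by have := ltn_ord r; lia.
Qed.

(** The position in the column reading of the box in row r of column c. Rows are
    numbered from the bottom and columns are read downwards, which explains the
    complement to [tnth mu c].-1. *)
Definition pos c (r : 'I_(tnth mu c)) : 'I_d := Ordinal (posn_lt r).

Lemma pos_index c (r : 'I_(tnth mu c)) : reshape_index mu (pos r) = c.
Proof. by apply: flatten_indexKl; rewrite nth_mu; have := ltn_ord r; lia. Qed.

Lemma pos_offset c (r : 'I_(tnth mu c)) : reshape_offset mu (pos r) = ((tnth mu c).-1 - r)%N.
Proof. by apply: flatten_indexKr; rewrite nth_mu; have := ltn_ord r; lia. Qed.

Lemma shape_colword A : shape [seq rev (A i : seq 'I_n) | i <- enum 'I_l] = mu.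
Proof.
rewrite /shape -map_comp -[RHS]map_tnth_enum; apply: eq_map => i /=.
by rewrite size_rev size_tuple.
Qed.

Lemma gamma_pos A c (r : 'I_(tnth mu c)) : tnth (gamma A) (pos r) = tnth (A c) r.
Proof.
have x0 := tnth (A c) r.
have -> : tnth (gamma A) (pos r) = nth x0 (colword A) (pos r) by exact: tnth_nth.
rewrite /colword nth_flatten shape_colword pos_index pos_offset.
rewrite (nth_map c) ?size_enum_ord // (nth_ord_enum c c) nth_rev ?size_tuple; last first.
  by have := ltn_ord r; lia.
by rewrite (tnth_nth x0); congr nth; have := ltn_ord r; lia.
Qed.

Lemma pos_cover (i : 'I_d) : exists c (r : 'I_(tnth mu c)), i = pos r.
Proof.
have hi : (i < sumn mu)%N by rewrite mu_d.
have hc : (reshape_index mu i < l)%N.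
  by rewrite -[X in (_ < X)%N](size_tuple mu) reshape_indexP.
pose c := Ordinal hc; have ho := reshape_offsetP hi.
have ec : nth 0%N mu (reshape_index mu i) = tnth mu c by rewrite -nth_mu.
have hr : ((tnth mu c).-1 - reshape_offset mu i < tnth mu c)%N.
  by move: ho; rewrite ec; lia.
exists c, (Ordinal hr); apply: val_inj => /=; rewrite /posn /=.
have -> : ((tnth mu c).-1 - ((tnth mu c).-1 - reshape_offset mu i))%N = reshape_offset mu i.
  by move: ho; rewrite ec; lia.
by rewrite reshape_indexK.
Qed.

Lemma pos_adj c (r r' : 'I_(tnth mu c)) : adjacent (pos r') (pos r) = adjacent r r'.
Proof.
rewrite /adjacent /= /posn /flatten_index; have := ltn_ord r; have := ltn_ord r'.
by move=> h1 h2; apply/eqP/eqP; lia.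
Qed.

Lemma pos_inj c : injective (@pos c).
Proof.
move=> r r' /(congr1 (fun i : 'I_d => reshape_offset mu i)); rewrite !pos_offset => e.
by apply: val_inj; have := ltn_ord r; have := ltn_ord r'; rewrite /=; lia.
Qed.

Lemma pos_col c c' (r : 'I_(tnth mu c)) (r' : 'I_(tnth mu c')) : pos r = pos r' -> c = c'.
Proof.
by move=> e; apply: val_inj; rewrite -[LHS](pos_index r) e pos_index.
Qed.

(** The filling with a given column reading; so words and fillings correspond
    bijectively. *)
Definition ginv (a : d.-tuple 'I_n) : filling :=
  [ffun c => [tuple tnth a (pos r) | r < tnth mu c]].

Lemma ginvE a c (r : 'I_(tnth mu c)) : tnth (ginv a c) r = tnth a (pos r).
Proof. by rewrite ffunE tnth_mktuple. Qed.

Lemma gammaK a : gamma (ginv a) = a.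
Proof.
apply: eq_from_tnth => i; have [c [r ->]] := pos_cover i.
by rewrite gamma_pos ginvE.
Qed.

Lemma fill_eq A B : (forall c r, tnth (A c) r = tnth (B c) r) -> A = B.
Proof. by move=> h; apply/ffunP => c; apply: eq_from_tnth. Qed.

Lemma gamma_inj : injective gamma.
Proof.
move=> A B e; apply: fill_eq => c r.
by rewrite -!gamma_pos e.
Qed.

Lemma ginvK A : ginv (gamma A) = A.
Proof. by apply: gamma_inj; rewrite gammaK. Qed.

(** The transposition of the positions of two boxes of a column. The reading goes
    down the column, so that the upper row r' comes first. *)
Definition cs c (r r' : 'I_(tnth mu c)) : 'S_d := tperm (pos r') (pos r).

Definition swp A c (r r' : 'I_(tnth mu c)) : filling := ginv (tact (gamma A) (cs r r')).

Lemma gamma_swp A c (r r' : 'I_(tnth mu c)) : gamma (swp A r r') = tact (gamma A) (cs r r').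
Proof. exact: gammaK. Qed.

Lemma swp_in A c (r r' k : 'I_(tnth mu c)) :
  tnth (swp A r r' c) k = tnth (A c) (tperm r r' k).
Proof.
rewrite ginvE tactE /cs -gamma_pos; congr (tnth _ _).
by rewrite tpermC; symmetry; apply: inj_tperm; exact: pos_inj.
Qed.

Lemma swp_out A c (r r' : 'I_(tnth mu c)) i : i != c -> swp A r r' i = A i.
Proof.
move=> ne; apply: eq_from_tnth => k; rewrite ginvE tactE -gamma_pos; congr (tnth _ _).
rewrite tpermD //; apply/negP => /eqP /pos_col e; by rewrite e eqxx in ne.
Qed.

Lemma swpK A c (r r' : 'I_(tnth mu c)) : swp (swp A r r') r r' = A.
Proof.
apply: gamma_inj; rewrite !gamma_swp tactM /pmul /cs tperm2; exact: tact1.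
Qed.

Lemma col_swapP A B : reflect (exists c (r r' : 'I_(tnth mu c)), adjacent r r' /\ B = swp A r r')
  (col_swap A B).
Proof.
apply: (iffP existsP) => [[c /existsP[r /existsP[r' /and3P[adj /forallP out /forallP inn]]]]|].
  exists c, r, r'; split=> //; apply: fill_eq => i k.
  have [e|ne] := eqVneq i c; last by rewrite swp_out // (eqP (implyP (out i) ne)).
  by move: k; rewrite e => k; rewrite swp_in; exact/eqP.
case=> c [r [r' [adj ->]]]; exists c; apply/existsP; exists r; apply/existsP; exists r'.
apply/and3P; split=> //; apply/forallP => i.
  by apply/implyP => ne; rewrite swp_out.
by rewrite swp_in.
Qed.

(** The columns increase strictly from bottom to top. *)
Definition strict A : bool := [forall i, sorted ltn (map val (A i))].

Lemma strictP A : reflect (forall c (r r' : 'I_(tnth mu c)), adjacent r r' ->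
    (tnth (A c) r < tnth (A c) r')%N) (strict A).
Proof.
have nthE c (r : 'I_(tnth mu c)) : nth 0%N (map val (A c)) r = tnth (A c) r.
  have x0 := tnth (A c) r.
  by rewrite (nth_map x0) ?size_tuple ?ltn_ord // (tnth_nth x0).
apply: (iffP forallP) => [h c r r' /eqP e|h c].
  have /sortedP - /(_ 0%N r) := h c.
  by rewrite size_map size_tuple -e ltn_ord !nthE; apply.
apply/(sortedP 0%N) => k; rewrite size_map size_tuple => hk.
have := h c (Ordinal (ltnW hk)) (Ordinal hk); rewrite -!nthE /=; apply.
by rewrite /adjacent.
Qed.

Lemma nstrict A : ~~ strict A -> exists c (r r' : 'I_(tnth mu c)),
  adjacent r r' /\ (tnth (A c) r' <= tnth (A c) r)%N.
Proof.
move=> ns; apply: NNPP => h; case/negP: ns; apply/strictP => c r r' adj.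
by rewrite ltnNge; apply/negP => le; apply: h; exists c, r, r'.
Qed.

(** Among the rearrangements of a filling within columns, the column strict one
    has the most inversions in its column reading. *)
Definition ht A : nat := invt (gamma A).

Lemma ht_swp_up A c (r r' : 'I_(tnth mu c)) : adjacent r r' ->
  (tnth (A c) r' < tnth (A c) r)%N -> ht (swp A r r') = (ht A).+1.
Proof.
move=> adj lt; rewrite /ht gamma_swp; apply: invt_up; first by rewrite pos_adj.
by rewrite /av !gamma_pos.
Qed.

Lemma ht_swp_down A c (r r' : 'I_(tnth mu c)) : adjacent r r' ->
  (tnth (A c) r < tnth (A c) r')%N -> ht A = (ht (swp A r r')).+1.
Proof.
move=> adj lt; rewrite /ht gamma_swp; apply: invt_down; first by rewrite pos_adj.
by rewrite /av !gamma_pos.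
Qed.

(** Straightening: a filling that is not column strict has two neighbours in a
    column that are equal or in the wrong order, and in the second case their
    exchange increases the number of inversions. *)
Lemma fill_ind (P : filling -> Prop) :
  (forall C, strict C -> P C) ->
  (forall C c (r r' : 'I_(tnth mu c)), adjacent r r' -> tnth (C c) r = tnth (C c) r' -> P C) ->
  (forall C c (r r' : 'I_(tnth mu c)), adjacent r r' -> (tnth (C c) r' < tnth (C c) r)%N ->
     ht (swp C r r') = (ht C).+1 -> P (swp C r r') -> P C) ->
  forall C, P C.
Proof.
move=> Ps Pe Pw C; pose top := \max_A ht A.
have [m] := ubnP (top - ht C); elim: m C => // m IH C lt_m.
have [sC|/nstrict [c [r [r' [adj]]]]] := boolP (strict C); first exact: Ps.
rewrite leq_eqVlt => /orP[/eqP/val_inj/esym e|lt]; first exact: Pe adj e.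
have e := ht_swp_up adj lt; apply: (Pw C c r r') => //; apply: IH.
have : (ht (swp C r r') <= top)%N by apply: leq_bigmax.
by move: lt_m; rewrite e; lia.
Qed.

Lemma col_sim_refl A : col_sim A A.
Proof. by apply/forallP => i. Qed.

Lemma col_sim_swp A C c (r r' : 'I_(tnth mu c)) : col_sim A (swp C r r') = col_sim A C.
Proof.
have h B : col_sim B (swp B r r').
  apply/forallP => i; have [e|ne] := eqVneq i c; last by rewrite swp_out.
  rewrite {}e perm_sym; apply/tuple_permP; exists (tperm r r'); congr val.
  by apply: eq_from_tnth => k; rewrite tnth_mktuple swp_in.
apply/forallP/forallP => s i; apply: perm_trans (s i) _; last by have /forallP := h C.
by rewrite perm_sym; have /forallP := h C.
Qed.

Lemma strict_sim A B : strict A -> strict B -> col_sim A B -> A = B.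
Proof.
move=> /forallP sA /forallP sB /forallP s; apply/ffunP => c; apply: val_inj.
apply: (inj_map val_inj); apply: (irr_sorted_eq ltn_trans ltnn (sA c) (sB c)).
by apply/perm_mem/perm_map/s.
Qed.

Lemma sim_neq A C c (r r' : 'I_(tnth mu c)) : strict A -> col_sim A C -> adjacent r r' ->
  tnth (C c) r != tnth (C c) r'.
Proof.
move=> /forallP sA /forallP s adj; have x0 := tnth (C c) r.
have uA : uniq (A c).
  by apply: (map_uniq (f := val)); apply: (sorted_uniq ltn_trans ltnn).
have uC : uniq (C c) by rewrite -(perm_uniq (s c)).
rewrite !(tnth_nth x0) nth_uniq ?size_tuple ?ltn_ord //.
by move: adj => /eqP ->; rewrite neq_ltn ltnSn.
Qed.

Lemma sim_ht A C : strict A -> col_sim A C -> (ht C <= ht A)%N.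
Proof.
move=> sA; elim/fill_ind: C => [C sC s|C c r r' adj e s|C c r r' adj lt eh IH s].
- by rewrite (strict_sim sA sC s).
- by have := sim_neq sA s adj; rewrite e eqxx.
- by have := IH; rewrite col_sim_swp s eh => /(_ isT); lia.
Qed.

(** The exchange of two neighbours in a column changes the number of inversions by
    one, and a rearrangement of A other than A is not column strict. *)
Lemma ellcolE A C : strict A -> col_sim A C -> ellcol A C = (ht A - ht C)%N.
Proof.
move=> sA; apply: (gdist_potential (P := fun C => col_sim A C) (f := fun C => (ht A - ht C)%N)).
- by rewrite subnn.
- exact: col_sim_refl.
- move=> U V sU /col_swapP [c [r [r' [adj ->]]]]; rewrite col_sim_swp; split=> //.
  have := sim_neq sA sU adj; rewrite -(inj_eq val_inj) /= neq_ltn => /orP[lt|lt].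
    by rewrite (ht_swp_down adj lt); lia.
  by rewrite (ht_swp_up adj lt); lia.
move=> Y sY ne; have nY : ~~ strict Y by apply: contra ne => h; rewrite (strict_sim sA h sY).
have [c [r [r' [adj le]]]] := nstrict nY.
have lt : (tnth (Y c) r' < tnth (Y c) r)%N.
  by rewrite ltn_neqAle le andbT eq_sym (inj_eq val_inj) (sim_neq sA sY adj).
have e := ht_swp_up adj lt; exists (swp Y r r'); split; first by rewrite col_sim_swp.
  by apply/col_swapP; exists c, r, r'; rewrite swpK.
have : (ht (swp Y r r') <= ht A)%N by apply: sim_ht; rewrite ?col_sim_swp.
by rewrite e; lia.
Qed.

Lemma cs_parab c (r r' : 'I_(tnth mu c)) : cs r r' \in parab d mu.
Proof.
rewrite inE; apply/forallP => i; rewrite /cs; case: tpermP => [->|->|_ _] //;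
  by rewrite !pos_index.
Qed.

Lemma parabM u v : u \in parab d mu -> v \in parab d mu -> pmul u v \in parab d mu.
Proof.
rewrite !inE => /forallP hu /forallP hv; apply/forallP => i; rewrite permM.
by rewrite (eqP (hu _)) hv.
Qed.

Lemma sim_parab A C : strict A -> col_sim A C ->
  exists2 w, w \in parab d mu & gamma C = tact (gamma A) w.
Proof.
move=> sA; elim/fill_ind: C => [C sC s|C c r r' adj e s|C c r r' adj lt eh IH s].
- rewrite (strict_sim sA sC s); exists 1%g; last by rewrite tact1.
  by rewrite inE; apply/forallP => i; rewrite perm1.
- by have := sim_neq sA s adj; rewrite e eqxx.
have [|w wp e] := IH; first by rewrite col_sim_swp.
exists (pmul w (cs r r')); first by rewrite parabM // cs_parab.
by rewrite -tactM -e gamma_swp tactM /pmul /cs tperm2 tact1.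
Qed.

Lemma reshape_index_mono (i j : nat) : (i <= j)%N -> (reshape_index mu i <= reshape_index mu j)%N.
Proof. by rewrite (reshape_leq mu) => /orP[/ltnW //|/andP[/eqP -> _]]. Qed.

(** S_mu preserves the columns: a descent of an element of S_mu exchanges
    neighbours in a column. *)
Lemma parab_sim A w : w \in parab d mu -> col_sim A (ginv (tact (gamma A) w)).
Proof.
have [m] := ubnP (ell w); elim: m w => // m IH w lt_m wp.
have [->|/perm_descent [i [j [adj lt]]]] := eqVneq w 1%g.
  by rewrite tact1 ginvK col_sim_refl.
have wb k : reshape_index mu (w k) = reshape_index mu k.
  by move: wp; rewrite inE => /forallP /(_ k) /eqP.
have eij : reshape_index mu i = reshape_index mu j.
  apply/eqP; rewrite eqn_leq reshape_index_mono ?(ltnW (adj_lt adj)) //=.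
  by rewrite -(wb i) -(wb j) reshape_index_mono // ltnW.
have [c [r' ei]] := pos_cover i; have [c' [r ej]] := pos_cover j.
have ec : c' = c by apply: val_inj => /=; rewrite -(pos_index r) -(pos_index r') -ei -ej eij.
subst c'; have es : tperm i j = cs r r' by rewrite /cs ei ej.
have -> : ginv (tact (gamma A) w) = swp (ginv (tact (gamma A) (pmul w (tperm i j)))) r r'.
  by rewrite /swp gammaK tactM -es pmulA /pmul tperm2 mul1g.
rewrite col_sim_swp; apply: IH.
  by rewrite -ltnS -(ell_down adj lt).
by rewrite parabM // es cs_parab.
Qed.

Lemma col_simP A C : strict A ->
  col_sim A C <-> exists2 w, w \in parab d mu & gamma C = tact (gamma A) w.
Proof.
move=> sA; split; first exact: sim_parab.
by case=> w wp e; rewrite -[C]ginvK e parab_sim.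
Qed.

Lemma count_gamma A (j : 'I_n) :
  count_mem j (gamma A) = (\sum_(i < l) count_mem j (A i))%N.
Proof.
rewrite /= /colword count_flatten -map_comp sumnE big_map big_enum /=.
by apply: eq_bigr => i _; rewrite count_rev.
Qed.

Lemma ColP (nu : n.-tuple nat) A : A \in Col mu nu <-> strict A /\ weight nu (gamma A).
Proof.
rewrite inE; split=> [/andP[sA /forallP w]|[sA w]].
  by split=> // j; rewrite count_gamma; exact/eqP.
by apply/andP; split=> //; apply/forallP => j; rewrite -count_gamma w.
Qed.

End Fillings.

(** * Exterior powers and the first formula *)

Lemma qVq_neq0 : q^-1 + q != 0.
Proof.
apply/eqP => e; have : peval ('X^2 + 1) q = 0.
  rewrite pevalD pevalXn peval1; transitivity (q * (q^-1 + q)); last by rewrite e mulr0.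
  by rewrite mulrDr mulfV ?q_neq0 // addrC.
rewrite peval_evq => h; have /ratp_eq0/polyP/(_ 0%N) := evq_eq0 (or_introl erefl) h.
by rewrite coefD coefXn coef1 coef0.
Qed.

Section TauCoef.
Variables n d : nat.
Implicit Types (a b : d.-tuple 'I_n) (i j : 'I_d) (v : tens n d).

Lemma tau_coef_eq v a i j : adjacent i j -> av a i = av a j ->
  (tau (tperm i j) v a : Qq) = q^-1 * v a.
Proof.
move=> adj e; rewrite {1}(ffun_dl v) (semilin_sum (@tau_lin n d _)) sum_ffunE (bigD1 a) //=.
rewrite big1 ?addr0.
  rewrite (linZ _ _ (@tau_lin n d _)) dl_M tauE (tauM_eq e) !ffunE eqxx.
  by rewrite -[LHS]/(_ * (_ * 1)) mulr1 mulrC.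
move=> b ne; rewrite (linZ _ _ (@tau_lin n d _)) dl_M tauE ffunE.
have ne2 : a != tact b (tperm i j).
  apply: contra ne => /eqP ea; have := tact_eq e; rewrite {1}ea tactM /pmul tperm2 tact1.
  by move=> ->.
rewrite eq_sym in ne; rewrite /tauM; case: ifP => _; last case: ifP => _.
- by rewrite !ffunE (negPf ne2) [_ *: _]mulr0.
- by rewrite !ffunE (negPf ne) mulr0n !scaler0.
- by rewrite !ffunE (negPf ne) (negPf ne2) mulr0n scaler0 subr0 scaler0.
Qed.

Lemma tau_coef_lt v a i j : adjacent i j -> (av a i < av a j)%N ->
  (tau (tperm i j) v a : Qq) = v (tact a (tperm i j)).
Proof.
move=> adj lt; set s := tperm i j; set a' := tact a s.
have a'K : tact a' s = a by rewrite /a' tactM /pmul tperm2 tact1.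
have gt : (av a' j < av a' i)%N by rewrite !av_tact /= tpermL tpermR.
have naa : a != a' by apply/eqP => e; move: gt; rewrite -e ltnNge (ltnW lt).
rewrite {1}(ffun_dl v) (semilin_sum (@tau_lin n d _)) sum_ffunE (bigD1 a') //=.
rewrite big1 ?addr0.
  rewrite (linZ _ _ (@tau_lin n d _)) dl_M tauE (tauM_gt adj gt) a'K !ffunE eqxx (negPf naa).
  by rewrite mulr0n scaler0 subr0 [LHS]mulr1.
move=> b ne; rewrite (linZ _ _ (@tau_lin n d _)) dl_M tauE ffunE.
have ne2 : a != tact b s.
  by apply: contra ne => /eqP ea; rewrite /a' ea tactM /pmul tperm2 tact1.
have [eb|nb] := eqVneq b a.
  by rewrite eb (tauM_lt adj lt) !ffunE (negPf naa) mulr0n scaler0.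
rewrite eq_sym in nb; rewrite /tauM; case: ifP => _; last case: ifP => _.
- by rewrite !ffunE (negPf ne2) [_ *: _]mulr0.
- by rewrite !ffunE (negPf nb) mulr0n !scaler0.
- by rewrite !ffunE (negPf nb) (negPf ne2) mulr0n scaler0 subr0 scaler0.
Qed.
End TauCoef.

Section Exterior.

Variables l n d : nat.
Variable mu : l.-tuple nat.
Hypothesis mu_d : sumn mu = d.
Local Notation filling := (filling n mu).
Local Notation gamma := (@gamma l n d mu mu_d).
Local Notation ht := (ht mu_d).
Local Notation Nbas := (@Nbas l n d mu mu_d).
Local Notation T := (tens n d).
Implicit Types (A B C : filling) (c : 'I_l) (v : T).

Lemma Nbas_coef A C : strict A ->
  (Nbas A (gamma C) : Qq) = if col_sim A C then mq ^- (ht A - ht C) else 0.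
Proof.
move=> sA; rewrite /Nbas sum_ffunE.
have e B : col_sim A B -> (((- q) ^- ellcol A B *: M (gamma B) : T) (gamma C) : Qq)
    = mq ^- (ht A - ht B) * (B == C)%:R.
  by move=> s; rewrite !ffunE (ellcolE mu_d sA s) (inj_eq (@gamma_inj _ _ _ _ mu_d)) eq_sym.
rewrite (eq_bigr _ e); case: ifP => s.
  rewrite (bigD1 C) //= eqxx mulr1 big1 ?addr0 // => B /andP[_ /negPf ->].
  by rewrite mulr0.
rewrite big1 // => B sB; have -> : (B == C) = false.
  by apply/eqP => eB; rewrite -eB sB in s.
by rewrite mulr0.
Qed.

Lemma mqXV_S k : mq ^- k.+1 = mq^-1 * mq ^- k.
Proof. by rewrite exprSr invfM mulrC. Qed.

(** The condition that characterises the exterior power in tensor space, stated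
    for the transpositions of neighbours in the columns. *)
Definition cs_eigen v := forall c (r r' : 'I_(tnth mu c)), adjacent r r' ->
  hact v (Hb (cs mu_d r r')) = - q *: v.

Lemma cs_adj c (r r' : 'I_(tnth mu c)) : adjacent r r' ->
  adjacent (pos mu_d r') (pos mu_d r).
Proof. by rewrite pos_adj. Qed.

(** Both sides are determined by straightening: for equal neighbours the
    eigenvalues q^-1 and -q differ, so that the coefficient vanishes, and the
    exchange of neighbours multiplies the coefficient by -q. *)
Lemma eigen_expand v : cs_eigen v ->
  v = \sum_(A | strict A) (v (gamma A) : Qq) *: Nbas A.
Proof.
move=> ev; apply/ffunP => a; rewrite -(gammaK mu_d a); move: (ginv mu_d a) => C {a}.
rewrite sum_ffunE.
have e A : strict A -> ((v (gamma A) : Qq) *: Nbas A : T) (gamma C)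
    = (v (gamma A) : Qq) * (if col_sim A C then mq ^- (ht A - ht C) else 0) :> Qq.
  by move=> sA; rewrite ffunE (Nbas_coef _ sA).
rewrite (eq_bigr _ e) {e}.
elim/(@fill_ind l n d mu mu_d): C => [C sC|C c r r' adj e|C c r r' adj lt eh IH].
- rewrite (bigD1 C) //= col_sim_refl subnn expr0 invr1 mulr1 big1 ?addr0 // => A /andP[sA ne].
  case: ifP => s; last by rewrite mulr0.
  by rewrite (strict_sim sA sC s) eqxx in ne.
- rewrite big1; last first.
    move=> A sA; case: ifP => s; last by rewrite mulr0.
    by have := sim_neq sA s adj; rewrite e eqxx.
  have := congr1 (fun u : T => (u (gamma C) : Qq)) (ev c r r' adj).
  rewrite (hact_s _ (adj_basic (cs_adj adj))) (tau_coef_eq _ (cs_adj adj)); last first.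
    by rewrite /av !gamma_pos e.
  rewrite ffunE => /eqP; rewrite -[X in _ == X]/(_ * _) -subr_eq0 -mulrBl mulf_eq0.
  case/orP => [|/eqP //]; rewrite opprK => /eqP qq.
  by have := qVq_neq0; rewrite qq eqxx.
have := congr1 (fun u : T => (u (gamma C) : Qq)) (ev c r r' adj).
rewrite (hact_s _ (adj_basic (cs_adj adj))) (tau_coef_lt _ (cs_adj adj)); last first.
  by rewrite /av !gamma_pos.
rewrite ffunE -[RHS]/(mq * _) -gamma_swp IH => h.
rewrite -[LHS](mulKf mq_neq0) -h mulr_sumr; apply: eq_bigr => A sA.
rewrite col_sim_swp mulrCA; congr (_ * _); case: ifP => s; last by rewrite mulr0.
have le : (ht (swp mu_d C r r') <= ht A)%N by apply: sim_ht => //; rewrite col_sim_swp.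
have -> : (ht A - ht C = (ht A - ht (swp mu_d C r r')).+1)%N by move: le; rewrite eh; lia.
by rewrite mqXV_S.
Qed.

Lemma Nbas_strict A C : strict A -> strict C -> (Nbas A (gamma C) : Qq) = (A == C)%:R.
Proof.
move=> sA sC; rewrite (Nbas_coef _ sA); case: ifP => s.
  by rewrite (strict_sim sA sC s) eqxx subnn expr0 invr1.
by case: eqP => // e; rewrite e col_sim_refl in s.
Qed.

Variable nu : n.-tuple nat.
Hypothesis nu_d : sumn nu = d.

Lemma Nbas_indep (k : filling -> Qq) (C : filling) : C \in Col mu nu ->
  ((\sum_(A in Col mu nu) k A *: Nbas A : T) (gamma C) : Qq) = k C.
Proof.
move=> hC; have [sC _] := (ColP mu_d nu C).1 hC; rewrite sum_ffunE.
have e A : A \in Col mu nu -> ((k A *: Nbas A : T) (gamma C) : Qq) = k A * (A == C)%:R.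
  by move=> hA; have [sA _] := (ColP mu_d nu A).1 hA; rewrite ffunE (Nbas_strict sA sC).
rewrite (eq_bigr _ e) (bigD1 C hC) /= eqxx mulr1 big1 ?addr0 // => A /andP[_ /negPf ->].
by rewrite mulr0.
Qed.

Lemma sorta_weight (a b : d.-tuple 'I_n) : weight nu b -> sorta a = sorta b -> weight nu a.
Proof.
move=> wb e; rewrite -(sortaK a) e; apply/weight_tact_iff.
by apply/weight_tact_iff.
Qed.

Lemma weight_sorta (a b : d.-tuple 'I_n) : weight nu a -> weight nu b -> sorta a = sorta b.
Proof.
move=> wa wb; apply: eq_from_tnth => i; apply: val_inj; rewrite -!/(av _ _) /=.
rewrite -/(av (sorta a) i) -/(av (sorta b) i).
by rewrite !(weight_wincr nu_d) ?wincr_sorta //; apply/weight_tact_iff.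
Qed.

Section WithB.

Variable B : filling.
Hypothesis hB : B \in Col mu nu.
Let sB : strict B := ((ColP mu_d nu B).1 hB).1.
Let wB : weight nu (gamma B) := ((ColP mu_d nu B).1 hB).2.

Lemma Kt_gamma_eigen : cs_eigen (Kt (gamma B)).
Proof.
move=> c r r' adj; apply: Kt_eigen; first exact: cs_adj.
by rewrite /av !gamma_pos; move/strictP: sB; apply.
Qed.

Lemma Kt_expand : Kt (gamma B) = \sum_(A in Col mu nu) (Kt (gamma B) (gamma A) : Qq) *: Nbas A.
Proof.
rewrite {1}(eigen_expand Kt_gamma_eigen) [RHS]big_mkcond [LHS]big_mkcond.
apply: eq_bigr => A _; case: (boolP (A \in _)) => [hA|nA].
  by have [-> _] := (ColP mu_d nu A).1 hA.
case: ifP => // sA; rewrite Kt_out ?scale0r //; apply: contra nA => /eqP e.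
by apply/(ColP mu_d nu A); split=> //; exact: (sorta_weight wB e).
Qed.

Lemma negZ_choose (F : filling -> Qq) : (forall A, negZ (F A)) ->
  exists f : filling -> {poly int}, forall A, F A = q^-1 * peval (f A) q^-1.
Proof.
move=> h; pose P A (p : {poly int}) := F A = q^-1 * peval p q^-1.
exists (fun A => epsilon (inhabits 0) (P A)) => A.
exact: (epsilon_spec (inhabits 0) (P A) (h A)).
Qed.

Lemma Kt_is_Kbas : is_Kbas mu_d nu B (Kt (gamma B)).
Proof.
split; first exact: Kt_bar.
pose F A : Qq := if A == B then 0 else Kt (gamma B) (gamma A).
have Fn A : negZ (F A).
  rewrite /F; case: eqP => [_|ne]; first exact: negZ0.
  by apply: Kt_neg; apply: contra_not_neq ne => /gamma_inj.
have [f fE] := negZ_choose Fn; exists f.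
rewrite {1}Kt_expand (bigD1 B hB) /= Kt_diag scale1r; congr (_ + _).
rewrite [RHS](bigD1 B hB) /= -fE {1}/F eqxx scale0r add0r.
by apply: eq_bigr => A /andP[_ ne]; rewrite -fE /F (negPf ne).
Qed.

Lemma Kbas_uniq v : is_Kbas mu_d nu B v -> v = Kt (gamma B).
Proof.
case=> bv [f ev]; have [bK [g eK]] := Kt_is_Kbas.
pose u := v - Kt (gamma B); suff u0 : forall a, (u a : Qq) = 0.
  by apply/eqP; rewrite -subr_eq0; apply/eqP/ffunP => a; rewrite [RHS]ffunE; exact: u0.
have un a : negZ (u a).
  rewrite -(gammaK mu_d a); move: (ginv mu_d a) => C {a}.
  have key (h : filling -> {poly int}) : negZ ((\sum_(A in Col mu nu)
      (q^-1 * peval (h A) q^-1) *: Nbas A : T) (gamma C)).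
    rewrite sum_ffunE; apply: negZ_sum => A hA; have [sA _] := (ColP mu_d nu A).1 hA.
    rewrite ffunE (Nbas_coef _ sA); case: ifP => _; last by rewrite [_ *: _]mulr0; exact: negZ0.
    rewrite [_ *: _]mulrC mqE exprMn invfM -exprVn invrN1 -mulrA.
    by apply/negZ_sign/negZ_exp; exists (h A).
  rewrite /u ev eK opprD addrACA subrr add0r !ffunE.
  by apply: negZD => //; apply: negZN.
apply: (bar_triangular_eq0 (h := @invt n d) (r := fun a b => (tbar (M b) a : Qq))
  (c := fun a => (u a : Qq))).
- exact: tbar_diag.
- by move=> a b /tbar_tri [->|[lt _]]; [left|right].
- move=> a; rewrite -tbar_expand; congr (_ _).
  by rewrite /u (semilinB (tbar_lin n d)) bv bK.
- by move=> a; apply: negZ_bar0.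
Qed.

Lemma KbasE : Kbas mu_d nu B = Kt (gamma B).
Proof.
apply: Kbas_uniq; apply: (epsilon_spec (inhabits 0) (is_Kbas mu_d nu B)).
by exists (Kt (gamma B)); exact: Kt_is_Kbas.
Qed.

Lemma kcoefE A : A \in Col mu nu -> kcoef mu_d nu A B = Kt (gamma B) (gamma A).
Proof.
move=> hA; rewrite /kcoef; set P := (fun k : filling -> Qq => _).
have Pk : P (epsilon (inhabits (fun=> 0)) P).
  apply: epsilon_spec; exists (fun A => Kt (gamma B) (gamma A) : Qq).
  by rewrite /P KbasE; exact: Kt_expand.
move: (epsilon _ _) Pk => k Pk.
by rewrite -KbasE Pk Nbas_indep.
Qed.

Lemma first_formula A : A \in Col mu nu ->
  let x := dperm nu (gamma A) in let y := dperm nu (gamma B) in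
  kcoef mu_d nu A B = (- q) ^ ((ell x)%:Z - (ell y)%:Z)
      * \sum_(z in parab d nu) (-1) ^+ ell z * peval (KL (pmul z x) y) (q ^+ 2).
Proof.
move=> hA x y; have [sA wA] := (ColP mu_d nu A).1 hA.
rewrite (kcoefE hA) Kt_coef; last exact: weight_sorta.
have ws : weight nu (sorta (gamma B)) by apply/weight_tact_iff.
rewrite /x /y !(dpermE nu_d) // -!ell_std; congr (_ * _).
  by rewrite /mqr expfzDr ?mq_neq0 // -exprnP exprnN.
by apply: eq_bigl => z; rewrite (parab_stab nu_d _ ws) ?wincr_sorta.
Qed.

End WithB.
End Exterior.

(** * Functionals on words that vanish on the kernel of the quotient map *)

(** Bracketings of products, stated for an abstract ring and applied as terms: a
    search for associativity in the tensor algebra unfolds its product. *)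
Lemma mulr_regroupl (A : pzRingType) (s a x t : A) : s * (a * x) * t = s * a * (x * t).
Proof. by rewrite !mulrA. Qed.

Lemma mulr_regroupr (A : pzRingType) (s a x t : A) : s * (x * a) * t = s * x * a * t.
Proof. by rewrite !mulrA. Qed.

Lemma mulr_bracketl (A : pzRingType) (a x b : A) : a * x * b = 1 * a * (x * b).
Proof. by rewrite mul1r mulrA. Qed.

Lemma mulr_bracketr (A : pzRingType) (a x b : A) : 1 * a * (x * b) = (a * x) * b * 1.
Proof. by rewrite mul1r mulr1 mulrA. Qed.

Lemma mulr_bracketD (A : pzRingType) (a x y b : A) : a * (x + y) * b = a * x * b + a * y * b.
Proof. by rewrite mulrDr mulrDl. Qed.

Section FreeAlgebra.

Variables (R : comNzRingType) (I : choiceType).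
Local Notation alg := {malg R[{fmonom I}]}.
Implicit Types (a b x : alg) (s t : seq I).

Definition fword s : alg := << FMonom s >>.

Lemma fwordM s t : fword s * fword t = fword (s ++ t).
Proof.
rewrite malgM_def /fword fgmulUU mulr1; congr mkmalgU.
by apply/eqP; rewrite fmP fmM.
Qed.

(** The free algebra over a commutative ring is an algebra on both sides:
    scalars are multiples of the empty word, which commute with everything. *)
Lemma malg_scaleAr (c : R) a b : a * (c *: b) = c *: (a * b).
Proof.
have comm : a * c%:MP = c%:MP * a.
  rewrite !malgM_def fgmulgU fgmulUg; apply: eq_bigr => k _.
  by rewrite mulrC mul1m mulm1.
by rewrite -(mul_malgC c b) mulrA comm -mulrA mul_malgC.
Qed.

Lemma fword_expand a : a = \sum_(k <- msupp a) a@_k *: fword k.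
Proof.
rewrite {1}(monalgE a); apply: eq_bigr => k _.
apply/malgP => k'; rewrite mcoeffZ !mcoeffU fmK.
by rewrite mulr_natr.
Qed.

Fact fapply_key : unit. Proof. exact tt. Qed.

(** The linear extension to the free algebra of a function on words. It is locked
    because it is a sum over the support, which would otherwise be confused with
    other sums. *)
Definition fapply (f : seq I -> R) : alg -> R :=
  locked_with fapply_key (mmap (idfun : {additive R -> R}) (fun k : {fmonom I} => f k)).

Lemma fapplyD f a b : fapply f (a + b) = fapply f a + fapply f b.
Proof. by rewrite /fapply unlock mmapD. Qed.

Lemma fapplyZ f c a : fapply f (c *: a) = c * fapply f a.
Proof.
rewrite /fapply unlock (mmapEw (msuppZ_le c a)) mmapE mulr_sumr.
by apply: eq_bigr => k _; rewrite mcoeffZ mulrA.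
Qed.

Lemma fapply0 f : fapply f 0 = 0.
Proof. by rewrite -(scale0r 0) fapplyZ mul0r. Qed.

Lemma fapply_sum f (J : Type) (r : seq J) (P : pred J) (F : J -> alg) :
  fapply f (\sum_(j <- r | P j) F j) = \sum_(j <- r | P j) fapply f (F j).
Proof. by apply: (big_morph _ (fapplyD f) (fapply0 f)). Qed.

Lemma fapply_word f s : fapply f (fword s) = f s.
Proof. by rewrite /fapply unlock mmapU mul1r. Qed.

Lemma fapply_rel f s t u1 u2 (c : R) :
  fapply f (fword s * (fword u1 + c *: fword u2) * fword t)
  = f (s ++ u1 ++ t) + c * f (s ++ u2 ++ t).
Proof.
rewrite mulrDr malg_scaleAr mulrDl -scalerAl !fwordM fapplyD fapplyZ !fapply_word.
by rewrite -!catA.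
Qed.

Lemma fapply_mul_sum f (J : Type) (r : seq J) (c : J -> R) (w : J -> alg) y z :
  fapply f (y * (\sum_(j <- r) c j *: w j) * z) = \sum_(j <- r) c j * fapply f (y * w j * z).
Proof.
elim: r => [|j r IH]; first by rewrite !big_nil mulr0 mul0r fapply0.
rewrite [in LHS]big_cons [in RHS]big_cons mulrDr mulrDl fapplyD.
apply: (f_equal2 +%R _ IH); rewrite malg_scaleAr -scalerAl; exact: fapplyZ.
Qed.

Lemma fapply_expandl f s a x t : fapply f (fword s * (a * x) * fword t)
  = \sum_(k <- msupp a) a@_k * fapply f (fword (s ++ k) * x * fword t).
Proof.
apply: etrans (congr1 _ (mulr_regroupl _ _ _ _)) _.
apply: etrans (congr1 (fun z => fapply f (fword s * z * _)) (fword_expand a)) _.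
apply: etrans (fapply_mul_sum _ _ _ _ _ _) _; apply: eq_bigr => k _.
apply: congr1; apply: congr1; apply: etrans (mulrA _ _ _) _.
by apply: (congr1 (fun z => z * x * _)); exact: fwordM.
Qed.

Lemma fapply_expandr f s a x t : fapply f (fword s * (x * a) * fword t)
  = \sum_(k <- msupp a) a@_k * fapply f (fword s * x * fword (k ++ t)).
Proof.
apply: etrans (congr1 _ (mulr_regroupr _ _ _ _)) _.
apply: etrans (congr1 (fun z => fapply f (_ * z * fword t)) (fword_expand a)) _.
apply: etrans (fapply_mul_sum _ _ _ _ _ _) _; apply: eq_bigr => k _.
apply: congr1; apply: congr1; apply: etrans (esym (mulrA _ _ _)) _.
by apply: congr1; exact: fwordM.
Qed.

Lemma fapply_sum3 f (J K : finType) (a : J -> R) (b : K -> R) (s : J -> seq I) (t : K -> seq I) x :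
  fapply f ((\sum_j a j *: fword (s j)) * x * (\sum_k b k *: fword (t k)))
  = \sum_j a j * (\sum_k b k * fapply f (fword (s j) * x * fword (t k))).
Proof.
apply: etrans (congr1 _ (mulr_bracketl _ _ _)) _.
apply: etrans (fapply_mul_sum _ _ _ _ _ _) _; apply: eq_bigr => j _.
apply: congr1; apply: etrans (congr1 _ (mulr_bracketr _ _ _)) _.
apply: etrans (fapply_mul_sum _ _ _ _ _ _) _; apply: eq_bigr => k _.
by apply: congr1; apply: congr1; exact: mulr1.
Qed.

End FreeAlgebra.

Section Quotient.

Variables l n d : nat.
Variable mu : l.-tuple nat.
Hypothesis mu_d : sumn mu = d.
Local Notation filling := (filling n mu).
Local Notation gamma := (@gamma l n d mu mu_d).
Local Notation ht := (ht mu_d).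
Local Notation pos := (@pos l d mu mu_d _).
Local Notation swp := (swp mu_d).
Local Notation T := (tens n d).
Local Notation TA := (talg n).
Implicit Types (A B C : filling) (c : 'I_l) (u v : T) (s t : seq 'I_n).

Lemma twordE s : tword s = fword Qq s. Proof. by []. Qed.

Lemma twordM s t : tword s * tword t = tword (s ++ t).
Proof. exact: fwordM. Qed.

Lemma temb_lin (k : nat) : semilin ridq (@temb n k : tens n k -> TA).
Proof. exact: (linext_semilin ridq (fun a : k.-tuple 'I_n => (tword a : TA))). Qed.

Lemma temb_M (k : nat) (a : k.-tuple 'I_n) : temb (M a) = tword a.
Proof. exact: (linext_dl ridq (fun a : k.-tuple 'I_n => (tword a : TA))). Qed.

(** The word that represents N*_C. *)
Definition revg C : d.-tuple 'I_n := [tuple of rev (gamma C)].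

Lemma revgE C : revg C = tact (gamma C) (wlong d).
Proof. exact: rev_tuple_wlong. Qed.

Lemma revg_inj : injective revg.
Proof. by move=> A B; rewrite !revgE => /tact_inj /gamma_inj. Qed.

Definition unrev (a : d.-tuple 'I_n) : filling := ginv mu_d (tact a (wlong d)).

Lemma unrevK a : revg (unrev a) = a.
Proof. by rewrite revgE gammaK tactM wlongK tact1. Qed.

(** The position in the reversed reading of the box in row r of column c; now rows
    are read upwards, and the columns from right to left. *)
Definition rp c (r : 'I_(tnth mu c)) : 'I_d := rev_ord (pos r).

Lemma rp_val c (r : 'I_(tnth mu c)) : rp r = (sumn (drop c.+1 mu) + r)%N :> nat.
Proof.
rewrite /rp /= /posn /flatten_index.
have sz : (c < size mu)%N by rewrite size_tuple.
have := congr1 sumn (cat_take_drop c mu); rewrite (drop_nth 0%N sz) sumn_cat /= nth_mu mu_d.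
by have := ltn_ord r; lia.
Qed.

Lemma rp_adj c (r r' : 'I_(tnth mu c)) : adjacent r r' -> adjacent (rp r) (rp r').
Proof. by rewrite /adjacent !rp_val => /eqP ->; rewrite addnS. Qed.

Lemma revg_rp C c (r : 'I_(tnth mu c)) : tnth (revg C) (rp r) = tnth (C c) r.
Proof. by rewrite revgE tactE wlongE /rp rev_ordK gamma_pos. Qed.

Definition rs c (r r' : 'I_(tnth mu c)) : 'S_d := tperm (rp r) (rp r').

Lemma revg_swp C c (r r' : 'I_(tnth mu c)) : revg (swp C r r') = tact (revg C) (rs r r').
Proof.
rewrite !revgE gamma_swp !tactM; congr tact; apply/permP => k.
rewrite !permM !wlongE /cs /rs /rp (inj_tperm _ _ _ (@rev_ord_inj d)) !rev_ordK.
by rewrite tpermC.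
Qed.

Lemma swap_word (a : d.-tuple 'I_n) pre x y post (i j : 'I_d) :
    a = pre ++ x :: y :: post :> seq 'I_n -> i = size pre :> nat -> adjacent i j ->
  [/\ tnth a i = x, tnth a j = y & tact a (tperm i j) = pre ++ y :: x :: post :> seq 'I_n].
Proof.
move=> ea ei /eqP ej; rewrite ei in ej.
have ai : tnth a i = x.
  by rewrite (tnth_nth x) ea ei nth_cat ltnn subnn.
have aj : tnth a j = y.
  by rewrite (tnth_nth x) ea ej nth_cat ltnNge leqnSn /= subSnn.
split=> //; apply: (@eq_from_nth _ x).
  by rewrite size_tuple -(size_tuple a) ea !size_cat.
move=> k; rewrite size_tuple => kd; pose kk := Ordinal kd.
have -> : nth x (tact a (tperm i j)) k = tnth a (tperm i j kk).
  by rewrite -tactE (tnth_nth x).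
case: tpermP => [e|e|/eqP ni /eqP nj].
- have -> : k = size pre by rewrite -ei -e.
  by rewrite aj nth_cat ltnn subnn.
- have -> : k = (size pre).+1 by rewrite -ej -e.
  by rewrite ai nth_cat ltnNge leqnSn /= subSnn.
rewrite (tnth_nth x) ea /= !nth_cat; case: ltnP => // le.
rewrite -!(inj_eq val_inj) /= ei ej in ni nj.
case e : (k - size pre)%N => [|[|m]] //.
  by move: ni le e; lia.
by move: nj le e; lia.
Qed.

(** The coefficient of N*_A in the image of the word s: the reversed reading of a
    rearrangement C of A straightens to (-q)^(ht A - ht C) N*_A, and the other
    words do not contribute. It is a function on words of any length so that it
    extends to the tensor algebra. *)
Definition fA A s : Qq :=
  \sum_(C | col_sim A C) (s == revg C :> seq 'I_n)%:R * mq ^+ (ht A - ht C).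

(** The same functional on tensor space. *)
Definition phi A u : Qq := \sum_(C | col_sim A C) (u (revg C) : Qq) * mq ^+ (ht A - ht C).

Lemma fA_revg A C : fA A (revg C) = if col_sim A C then mq ^+ (ht A - ht C) else 0.
Proof.
rewrite /fA; case: ifP => h.
  rewrite (bigD1 C) //= eqxx mul1r big1 ?addr0 // => B /andP[_ ne].
  have -> : (rev (gamma C) == rev (gamma B)) = false.
    by apply/negbTE; apply: contra ne => /eqP e; apply/eqP/revg_inj/val_inj.
  by rewrite mul0r.
rewrite big1 // => B sB; have -> : (revg C == revg B :> seq 'I_n) = false.
  by apply/negbTE/eqP => e; move: h; rewrite (revg_inj (val_inj e)) sB.
by rewrite mul0r.
Qed.

Lemma fA_size A s : size s != d -> fA A s = 0.
Proof.
move=> ne; rewrite /fA big1 // => C _; have -> : (s == revg C :> seq 'I_n) = false.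
  by apply/negbTE; apply: contra ne => /eqP ->; rewrite size_tuple.
by rewrite mul0r.
Qed.

Lemma phi_lin A : semilin ridq (phi A : T -> Qq^o).
Proof.
split=> [u v|k v]; rewrite /phi.
  by rewrite -big_split; apply: eq_bigr => C _; rewrite ffunE mulrDl.
rewrite scaler_sumr; apply: eq_bigr => C _; rewrite ffunE.
by rewrite -[k *: (v (revg C) : Qq^o)]/(k * _) -[RHS]/(_ * (_ * _)) mulrA.
Qed.

Lemma phi_M A (a : d.-tuple 'I_n) : phi A (M a) = fA A a.
Proof. by apply: eq_bigr => C _; rewrite ffunE eq_sym. Qed.

Lemma fapply_temb A u : fapply (fA A) (temb u) = phi A u.
Proof.
rewrite /temb fapply_sum [in RHS](ffun_dl u) (semilin_sum (phi_lin A)).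
by apply: eq_bigr => a _; rewrite fapplyZ twordE fapply_word (linZ _ _ (phi_lin A)) dl_M phi_M.
Qed.

Section FixA.

Variable A : filling.
Hypothesis sA : strict A.

(** The defining relations of the exterior algebra, in the block of a word that
    belongs to the column c: a word with equal neighbours goes to 0, and the
    exchange of neighbours y < x gives a factor -q. *)
Lemma fA_pair c (s1 s2 pre post : seq 'I_n) (x y : 'I_n) :
    size pre = sumn (drop c.+1 mu) -> size post = sumn (take c mu) ->
  (x = y -> fA A (pre ++ (s1 ++ x :: y :: s2) ++ post) = 0) /\
  ((y < x)%N -> fA A (pre ++ (s1 ++ x :: y :: s2) ++ post)
      = mq * fA A (pre ++ (s1 ++ y :: x :: s2) ++ post)).
Proof.
move=> h1 h2; set w := pre ++ _ ++ post.
have szw z z' : size (pre ++ (s1 ++ z :: z' :: s2) ++ post) = size w by rewrite /w !size_cat.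
have [szd|ne] := eqVneq (size w) d; last by rewrite !fA_size ?szw // mulr0.
have sz : (c < size mu)%N by rewrite size_tuple.
have := congr1 sumn (cat_take_drop c mu); rewrite (drop_nth 0%N sz) sumn_cat /= nth_mu mu_d => emu.
have szs : (size s1 + (size s2).+2)%N = tnth mu c.
  by move: szd; rewrite /w !size_cat /= h1 h2; move: emu; lia.
have hr : (size s1 < tnth mu c)%N by move: szs; lia.
have hr' : ((size s1).+1 < tnth mu c)%N by move: szs; lia.
pose r := Ordinal hr; pose r' := Ordinal hr'; have adj : adjacent r r' by rewrite /adjacent.
have /eqP szd' := szd; pose a : d.-tuple 'I_n := Tuple szd'.
pose C := unrev a; have ea : revg C = a by exact: unrevK.
have aE : a = (pre ++ s1) ++ x :: y :: (s2 ++ post) :> seq 'I_n by rewrite /= /w -!catA.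
have [|ax ay asw] := swap_word aE (_ : rp r = _ :> nat) (rp_adj adj).
  by rewrite rp_val size_cat h1.
have Cx : tnth (C c) r = x by rewrite -revg_rp ea.
have Cy : tnth (C c) r' = y by rewrite -revg_rp ea.
have wE : w = revg C by rewrite ea.
have w2E : pre ++ (s1 ++ y :: x :: s2) ++ post = revg (swp C r r').
  by rewrite revg_swp ea /rs asw -!catA.
rewrite w2E wE !fA_revg col_sim_swp; split=> [exy|lt].
  case: ifP => // h; have := sim_neq sA h adj; by rewrite Cx Cy exy eqxx.
case: ifP => h; last by rewrite mulr0.
have e : ht (swp C r r') = (ht C).+1 by apply: ht_swp_up; rewrite ?Cx ?Cy.
have le : (ht (swp C r r') <= ht A)%N by apply: sim_ht; rewrite ?col_sim_swp.
by rewrite -exprS; congr (_ ^+ _); move: le; rewrite e; lia.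
Qed.

(** Induction on the ideal. The statement allows for arbitrary words on both sides
    of the element within the block, so that it passes to multiples. *)
Lemma Jideal_fA c (pre post : seq 'I_n) (x : TA) :
    size pre = sumn (drop c.+1 mu) -> size post = sumn (take c mu) -> Jideal x ->
  forall s1 s2, fapply (fA A) (tword (pre ++ s1) * x * tword (s2 ++ post)) = 0.
Proof.
move=> h1 h2; elim=> [i j lt|i||x' y' _ IH1 _ IH2|a x' _ IH|x' a _ IH] s1 s2.
- have [_ /(_ lt) e] := fA_pair s1 s2 j i h1 h2.
  have r2 (k m : 'I_n) : tword [:: k] * tword [:: m] = tword [:: k; m] by exact: twordM.
  apply: etrans (congr1 (fun z => fapply _ (_ * z * _)) (f_equal2 (fun y z => y + q *: z) (r2 _ _) (r2 _ _))) _.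
  apply: etrans (fapply_rel (fA A) _ _ _ _ _) _.
  move: e; rewrite -!catA /= => ->.
  by rewrite -mulrDl /mq addNr mul0r.
- have [/(_ erefl) e _] := fA_pair s1 s2 i i h1 h2.
  have r3 (s t u : seq 'I_n) : tword s * tword t * tword u = tword (s ++ t ++ u).
    by apply: etrans (congr1 (fun z => z * _) (twordM _ _)) _; rewrite catA; exact: twordM.
  have r2 : tword [:: i] * tword [:: i] = tword [:: i; i] by exact: twordM.
  apply: etrans (congr1 (fun z => fapply _ (_ * z * _)) r2) _.
  apply: etrans (congr1 _ (r3 _ _ _)) _.
  by apply: etrans (fapply_word _ _) _; rewrite -e -!catA.
- by rewrite mulr0 mul0r fapply0.
- apply: etrans (congr1 _ (mulr_bracketD _ _ _ _)) _.
  by apply: etrans (fapplyD _ _ _) _; apply: etrans (f_equal2 +%R (IH1 _ _) (IH2 _ _)) (addr0 _).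
- apply: etrans (fapply_expandl _ _ _ _ _) _; apply: big1 => k _.
  by rewrite -catA; apply: etrans (congr1 _ (IH _ _)) (mulr0 _).
apply: etrans (fapply_expandr _ _ _ _ _) _; apply: big1 => k _.
by rewrite catA; apply: etrans (congr1 _ (IH _ _)) (mulr0 _).
Qed.

Lemma extker_fA x : extker mu x -> fapply (fA A) x = 0.
Proof.
elim=> [i a y b hi [u ->] Jy _ [v ->]||y z _ h1 _ h2].
- have hl : (i < l)%N by rewrite -(size_tuple mu).
  apply: etrans (fapply_sum3 (fA A) _ _ _ _ _) _.
  apply: big1 => s _; rewrite big1 ?mulr0 // => t _.
  have h1 : size s = sumn (drop (Ordinal hl).+1 mu) by rewrite size_tuple.
  have h2 : size t = sumn (take (Ordinal hl) mu) by rewrite size_tuple.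
  have := Jideal_fA h1 h2 Jy [::] [::]; rewrite cats0 cat0s => e.
  by apply: etrans (congr1 _ e) (mulr0 _).
- exact: fapply0.
- by apply: etrans (fapplyD _ _ _) _; apply: etrans (f_equal2 +%R h1 h2) (addr0 _).
Qed.

End FixA.
End Quotient.

(** * Straightening *)

Section Relations.

Variables l n d : nat.
Variable mu : l.-tuple nat.
Hypothesis mu_d : sumn mu = d.
Local Notation filling := (filling n mu).
Local Notation gamma := (@gamma l n d mu mu_d).
Local Notation ht := (ht mu_d).
Local Notation rp := (rp mu_d).
Local Notation rs := (rs mu_d).
Local Notation revg := (revg mu_d).
Local Notation swp := (swp mu_d).
Local Notation phi := (@phi l n d mu mu_d).
Local Notation fA := (@fA l n d mu mu_d).
Local Notation Nstar := (@Nstar l n d mu mu_d).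
Local Notation T := (tens n d).
Implicit Types (A B C : filling) (c : 'I_l) (u v : T) (s t : seq 'I_n).

(** The span of the v (H_s + q) with s internal to a column. It turns out to be the
    kernel of the quotient map, in a form in which its stability under the bar
    involution is visible. *)
Inductive Wsp : T -> Prop :=
| W_gen v c (r r' : 'I_(tnth mu c)) : adjacent r r' ->
    Wsp (hact v (Hb (rs r r')) + q *: v)
| W_zero : Wsp 0
| W_add u v : Wsp u -> Wsp v -> Wsp (u + v).

Lemma W_scale (k : Qq) v : Wsp v -> Wsp (k *: v).
Proof.
elim=> [u c r r' adj||u w _ h1 _ h2]; last 2 first.
- by rewrite scaler0; exact: W_zero.
- by rewrite scalerDr; exact: W_add.
rewrite scalerDr scalerA mulrC -scalerA -(linZ k u (hact_linl n (Hb (rs r r')))).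
exact: W_gen.
Qed.

Lemma rs_basic c (r r' : 'I_(tnth mu c)) : adjacent r r' -> basic_transp (rs r r').
Proof. by move=> adj; apply/adj_basic/rp_adj. Qed.

Lemma av_revg C c (r : 'I_(tnth mu c)) : av (revg C) (rp r) = tnth (C c) r.
Proof. by rewrite /av revg_rp. Qed.

Lemma scale_addK (R : comNzRingType) (V : lmodType R) (a b k : R) (v : V) :
  (a + b) * k = 1 -> a *: (k *: v) + b *: (k *: v) = v.
Proof. by move=> e; rewrite !scalerA -scalerDl -mulrDl e scale1r. Qed.

Lemma scale_comm (R : comNzRingType) (V : lmodType R) (a b : R) (v : V) :
  a *: (b *: v) = b *: (a *: v).
Proof. by rewrite !scalerA mulrC. Qed.

(** If v = M_a with a . s = a then v (H_s + q) = (q^-1 + q) v. *)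
Lemma W_equal C c (r r' : 'I_(tnth mu c)) : adjacent r r' ->
  tnth (C c) r = tnth (C c) r' -> Wsp (Nstar C).
Proof.
move=> adj e; pose v : T := (q^-1 + q)^-1 *: M (revg C).
have ta : tauM (rs r r') (revg C) = q^-1 *: M (revg C).
  by apply: tauM_eq; rewrite !av_revg e.
have hv : hact v (Hb (rs r r')) = q^-1 *: v.
  rewrite (hact_s _ (rs_basic adj)) (linZ _ _ (@tau_lin n d _)) tauE ta.
  exact: scale_comm.
have := W_gen v adj; rewrite hv scale_addK; first exact.
exact: mulfV qVq_neq0.
Qed.

Lemma W_swap C c (r r' : 'I_(tnth mu c)) : adjacent r r' ->
  (tnth (C c) r' < tnth (C c) r)%N -> Wsp (Nstar C + q *: Nstar (swp C r r')).
Proof.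
move=> adj lt; have := W_gen (Nstar (swp C r r')) adj.
rewrite (hact_s _ (rs_basic adj)) tauE tauM_lt.
- by rewrite -revg_swp swpK.
- exact: rp_adj.
by rewrite !av_revg !swp_in tpermL tpermR.
Qed.

Lemma phi_strict A C : strict A -> strict C -> phi A (Nstar C) = (A == C)%:R.
Proof.
move=> sA sC; rewrite phi_M fA_revg; case: ifP => s.
  by rewrite (strict_sim sA sC s) eqxx subnn expr0.
by case: eqP => // e; rewrite e col_sim_refl in s.
Qed.

Lemma phi_equal A C c (r r' : 'I_(tnth mu c)) : strict A -> adjacent r r' ->
  tnth (C c) r = tnth (C c) r' -> phi A (Nstar C) = 0.
Proof.
move=> sA adj e; rewrite phi_M fA_revg; case: ifP => // s.
by have := sim_neq sA s adj; rewrite e eqxx.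
Qed.

Lemma phi_swap A C c (r r' : 'I_(tnth mu c)) : strict A -> adjacent r r' ->
    (tnth (C c) r' < tnth (C c) r)%N ->
  phi A (Nstar C) = - q * phi A (Nstar (swp C r r')).
Proof.
move=> sA adj lt; rewrite !phi_M !fA_revg col_sim_swp.
case: ifP => s; last by rewrite mulr0.
have e : ht (swp C r r') = (ht C).+1 by apply: ht_swp_up.
have le : (ht (swp C r r') <= ht A)%N by apply: sim_ht; rewrite ?col_sim_swp.
by rewrite -exprS; congr (_ ^+ _); move: le; rewrite e; lia.
Qed.

(** The normal form of v modulo the span. *)
Definition red v : T := \sum_(A | strict A) phi A v *: Nstar A.

Lemma red_lin : semilin ridq red.
Proof.
split=> [u v|k v]; rewrite /red.
  by rewrite -big_split; apply: eq_bigr => A _; rewrite (semiD _ _ (phi_lin mu_d A)) scalerDl.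
rewrite scaler_sumr; apply: eq_bigr => A _.
by rewrite (linZ _ _ (phi_lin mu_d A)) scalerA.
Qed.

Lemma scaleNaddK (V : lmodType Qq) (k : Qq) (x y z : V) :
  (x + k *: y) + (- k) *: (y - z) = x - (- k) *: z.
Proof. by rewrite scalerBr addrA scaleNr addrK. Qed.

Lemma W_straighten_M C : Wsp (Nstar C - red (Nstar C)).
Proof.
elim/(@fill_ind l n d mu mu_d): C => [C sC|C c r r' adj e|C c r r' adj lt eh IH].
- have -> : red (Nstar C) = Nstar C.
    rewrite /red (bigD1 C) //= (phi_strict sC sC) eqxx scale1r big1 ?addr0 // => A /andP[sA ne].
    by rewrite (phi_strict sA sC) (negPf ne) scale0r.
  by rewrite subrr; exact: W_zero.
- have -> : red (Nstar C) = 0.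
    by apply: big1 => A sA; rewrite (phi_equal sA adj e) scale0r.
  by rewrite subr0; exact: (W_equal adj e).
have -> : red (Nstar C) = - q *: red (Nstar (swp C r r')).
  rewrite /red scaler_sumr; apply: eq_bigr => A sA.
  by rewrite (phi_swap sA adj lt) scalerA.
have := W_add (W_swap adj lt) (W_scale (- q) IH).
by rewrite scaleNaddK.
Qed.

Lemma W_sum (J : Type) (r : seq J) (P : pred J) (F : J -> T) :
  (forall j, P j -> Wsp (F j)) -> Wsp (\sum_(j <- r | P j) F j).
Proof. by move=> h; apply: (big_ind Wsp W_zero W_add). Qed.

Lemma W_straighten v : Wsp (v - red v).
Proof.
have -> : v - red v = \sum_b (v b : Qq) *: (M b - red (M b)).
  rewrite {1 2}(ffun_dl v) (semilin_sum red_lin) -sumrB; apply: eq_bigr => b _.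
  by rewrite (linZ _ _ red_lin) scalerBr dl_M.
apply: W_sum => b _; apply: W_scale; rewrite -(unrevK mu_d b).
exact: W_straighten_M.
Qed.

Lemma W_phi0 v : (forall A, strict A -> phi A v = 0) -> Wsp v.
Proof.
move=> h; have := W_straighten v.
by have -> : red v = 0; [apply: big1 => A sA; rewrite h ?scale0r|rewrite subr0].
Qed.

Lemma scale_hc (V : lmodType Qq) (x y : V) : x + hc *: y + q^-1 *: y = x + q *: y.
Proof. by rewrite -addrA -scalerDl hcE subrK. Qed.

(** The bar conjugate of H_s + q is H_s + (q - q^-1) + q^-1 = H_s + q. *)
Lemma W_tbar v : Wsp v -> Wsp (tbar v).
Proof.
elim=> [u c r r' adj||u w _ h1 _ h2]; last 2 first.
- by rewrite (semilin0 (tbar_lin n d)); exact: W_zero.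
- by rewrite (semiD _ _ (tbar_lin n d)); exact: W_add.
rewrite (semiD _ _ (tbar_lin n d)) (barZ _ _ (tbar_lin n d)) (tbar_act (tbarP n d)) hbar_Hb.
rewrite (Jb_s (rs_basic adj)) (semiD _ _ (hact_linr _)) (linZ _ _ (hact_linr _)) hact1 fbar_q.
by rewrite scale_hc; exact: W_gen.
Qed.

End Relations.

(** * Equality in the quotient *)

Lemma fword_two (R : comNzRingType) (I : choiceType) (s t u1 u2 : seq I) (a1 a2 : R) :
  fword R s * (a1 *: fword R u1 + a2 *: fword R u2) * fword R t
  = a1 *: fword R (s ++ u1 ++ t) + a2 *: fword R (s ++ u2 ++ t).
Proof.
rewrite mulrDr mulrDl; apply: (f_equal2 +%R).
  by rewrite malg_scaleAr -scalerAl; apply: congr1; rewrite !fwordM catA.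
by rewrite malg_scaleAr -scalerAl; apply: congr1; rewrite !fwordM catA.
Qed.

Section Kernel.

Variable n : nat.
Local Notation TA := (talg n).
Implicit Types (s t : seq 'I_n) (x y : 'I_n).

Lemma Jideal_scale (k : Qq) (z : TA) : Jideal z -> Jideal (k *: z).
Proof.
move=> Jz; have e : k%:MP * z = k *: z by exact: mul_malgC.
by rewrite -e; exact: J_mull.
Qed.

Lemma temb_scale m (k : Qq) (u : tens n m) : temb (k *: u) = k *: temb u.
Proof. exact: (linZ k u (temb_lin n m)). Qed.

Lemma temb_add m (u v : tens n m) : temb (u + v) = temb u + temb v.
Proof. exact: (semiD u v (temb_lin n m)). Qed.

Lemma extker_scale (mu : seq nat) (k : Qq) (z : TA) : extker mu z -> extker mu (k *: z).
Proof.
elim=> [i a x b hi [u ->] Jx hx hb||u w _ h1 _ h2].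
- have e : k *: (temb u * x * b) = temb (k *: u) * x * b.
    by rewrite temb_scale; apply: etrans (scalerAl _ _ _) _;
       apply: (congr1 (fun z => z * b)); exact: scalerAl.
  by rewrite e; apply: (extker_block hi _ Jx hx hb); exists (k *: u).
- by rewrite scaler0; exact: extker_zero.
- by rewrite scalerDr; exact: extker_add.
Qed.

Lemma in_tens_word s : in_tens (size s) (tword s).
Proof. by exists (M (in_tuple s)); rewrite temb_M. Qed.

Lemma in_tens_two m s t (a1 a2 : Qq) : size s = m -> size t = m ->
  in_tens m (a1 *: tword s + a2 *: tword t).
Proof.
move=> /eqP hs /eqP ht; exists (a1 *: M (Tuple hs) + a2 *: M (Tuple ht)).
apply/esym; apply: etrans (temb_add _ _) _; apply: (f_equal2 +%R).
  by apply: etrans (temb_scale _ _) _; apply: congr1; exact: temb_M.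
by apply: etrans (temb_scale _ _) _; apply: congr1; exact: temb_M.
Qed.

Lemma extker_two (mu : seq nat) c pre s1 s2 post x y (a1 a2 : Qq) : (c < size mu)%N ->
    size pre = sumn (drop c.+1 mu) -> size post = sumn (take c mu) ->
    size (s1 ++ x :: y :: s2) = nth 0%N mu c ->
    Jideal (a1 *: tword [:: x; y] + a2 *: tword [:: y; x]) ->
  extker mu (a1 *: tword (pre ++ (s1 ++ x :: y :: s2) ++ post)
           + a2 *: tword (pre ++ (s1 ++ y :: x :: s2) ++ post)).
Proof.
move=> hc hp hq hs J.
have e := fword_two pre post (s1 ++ x :: y :: s2) (s1 ++ y :: x :: s2) a1 a2.
apply: (eq_ind _ (extker mu) _ _ e).
apply: (extker_block hc).
- by rewrite -hp; exact: in_tens_word.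
- have e' := fword_two s1 s2 [:: x; y] [:: y; x] a1 a2.
  apply: (eq_ind _ (@Jideal n) _ _ e'); apply: J_mulr; exact: J_mull.
- by apply: in_tens_two; rewrite -hs !size_cat.
by rewrite -hq; exact: in_tens_word.
Qed.

Lemma Jideal_lt x y : (x < y)%N -> Jideal (1 *: tword [:: y; x] + q *: tword [:: x; y]).
Proof.
move=> /J_lt h.
have r2 (k m : 'I_n) : tword [:: k] * tword [:: m] = tword [:: k; m] by exact: twordM.
apply: (eq_ind _ (@Jideal n) h).
by apply: (f_equal2 +%R); [rewrite scale1r; exact: r2|apply: congr1; exact: r2].
Qed.

Lemma Jideal_eq x (a b : Qq) : Jideal (a *: tword [:: x; x] + b *: tword [:: x; x]).
Proof.
have r2 : tword [:: x] * tword [:: x] = tword [:: x; x] by exact: twordM.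
by rewrite -scalerDl -r2; apply: Jideal_scale; exact: J_eq.
Qed.

End Kernel.

Lemma hc_relation (V : lmodType Qq) (x y : V) :
  x - hc *: y + q *: y = q^-1 *: (1 *: y + q *: x).
Proof.
rewrite scale1r scalerDr scalerA (mulVf q_neq0) scale1r -addrA -scaleNr -scalerDl hcE.
by rewrite opprB subrK addrC.
Qed.

Section KernelW.

Variables l n d : nat.
Variable mu : l.-tuple nat.
Hypothesis mu_d : sumn mu = d.
Local Notation filling := (filling n mu).
Local Notation gamma := (@gamma l n d mu mu_d).
Local Notation ht := (ht mu_d).
Local Notation rp := (rp mu_d).
Local Notation rs := (rs mu_d).
Local Notation phi := (@phi l n d mu mu_d).
Local Notation Wsp := (@Wsp l n d mu mu_d).
Local Notation Nstar := (@Nstar l n d mu mu_d).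
Local Notation T := (tens n d).
Implicit Types (A B C : filling) (c : 'I_l) (u v : T) (b : d.-tuple 'I_n).

(** The letters of the reversed reading that belong to the column c form a block,
    which contains the letters of the rows r and r' as neighbours. *)
Lemma block_split b c (r r' : 'I_(tnth mu c)) : adjacent r r' ->
  exists pre s1 s2 post, [/\ size pre = sumn (drop c.+1 mu), size post = sumn (take c mu),
    size (s1 ++ tnth b (rp r) :: tnth b (rp r') :: s2) = tnth mu c, size s1 = r
    & b = pre ++ (s1 ++ tnth b (rp r) :: tnth b (rp r') :: s2) ++ post :> seq 'I_n].
Proof.
move=> /eqP adj; have hr' := ltn_ord r'; rewrite adj in hr'.
have sz : (c < size mu)%N by rewrite size_tuple.
have := congr1 sumn (cat_take_drop c mu); rewrite (drop_nth 0%N sz) sumn_cat /= nth_mu mu_d => emu.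
set K := sumn (drop c.+1 mu) in emu *; set x := tnth b (rp r); set y := tnth b (rp r').
pose blk := take (tnth mu c) (drop K b).
have sblk : size blk = tnth mu c.
  by rewrite size_takel // size_drop size_tuple; move: emu; lia.
have nblk k : (k < tnth mu c)%N -> nth x blk k = nth x b (K + k) by move=> h; rewrite nth_take // nth_drop.
have ex : nth x blk r = x.
  by rewrite nblk ?(ltnW hr') //; apply: etrans _ (esym (tnth_nth x _ _)); rewrite rp_val.
have ey : nth x blk r.+1 = y.
  by rewrite nblk //; apply: etrans _ (esym (tnth_nth x _ _)); rewrite rp_val adj.
have eb : blk = take r blk ++ x :: y :: drop r.+2 blk.
  rewrite -ey -[X in X :: _]ex -!drop_nth ?sblk ?(ltnW hr') //.
  by rewrite cat_take_drop.
exists (take K b), (take r blk), (drop r.+2 blk), (drop (tnth mu c) (drop K b)).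
rewrite -eb; split=> //.
- by rewrite size_takel // size_tuple; move: emu; lia.
- by rewrite !size_drop size_tuple; move: emu; lia.
- by rewrite size_takel // sblk; lia.
by rewrite !cat_take_drop.
Qed.

(** Up to a scalar, M_b (H_s + q) is a defining relation of the exterior algebra
    multiplied by words on both sides, in each of the three cases of the action. *)
Lemma W_extker_M b c (r r' : 'I_(tnth mu c)) : adjacent r r' ->
  extker mu (temb (tau (rs r r') (M b) + q *: M b)).
Proof.
move=> adj; have [pre [s1 [s2 [post [hp hq hs h1 eb]]]]] := block_split b adj.
set x := tnth b (rp r) in hs eb; set y := tnth b (rp r') in hs eb.
have eb' : b = (pre ++ s1) ++ x :: y :: (s2 ++ post) :> seq 'I_n by rewrite {1}eb -!catA.
have [|_ _ esw] := swap_word mu_d eb' (_ : rp r = _ :> nat) (rp_adj mu_d adj).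
  by rewrite rp_val size_cat hp h1.
have {}esw : tact b (rs r r') = pre ++ (s1 ++ y :: x :: s2) ++ post :> seq 'I_n.
  by rewrite esw -!catA.
have hc : (c < size mu)%N by rewrite size_tuple.
have hs' : size (s1 ++ x :: y :: s2) = nth 0%N mu c by rewrite nth_mu.
have main (a1 a2 : Qq) : Jideal (a1 *: tword [:: x; y] + a2 *: tword [:: y; x]) ->
    extker mu (temb (a1 *: M b + a2 *: M (tact b (rs r r')))).
  move=> /(extker_two hc hp hq hs'); rewrite -eb -esw => h.
  apply: (eq_ind _ (extker mu) h); apply/esym; apply: etrans (temb_add _ _) _.
  apply: (f_equal2 +%R); apply: etrans (temb_scale _ _) _; apply: congr1; exact: temb_M.
have [lt|gt|e] := ltngtP x y.
- rewrite tauE (tauM_lt (rp_adj mu_d adj) lt) addrC -[M (tact _ _)]scale1r.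
  by apply: main; rewrite addrC; exact: Jideal_lt.
- rewrite tauE (tauM_gt (rp_adj mu_d adj) gt).
  rewrite hc_relation.
  rewrite temb_scale; apply: extker_scale; apply: main; exact: Jideal_lt.
have exy : x = y by exact: val_inj.
have eav : av b (rp r) = av b (rp r') by exact: e.
rewrite tauE (tauM_eq eav).
have -> : q^-1 *: M b + q *: M b = q^-1 *: M b + q *: M (tact b (rs r r')) :> T.
  by rewrite (tact_eq eav).
by apply: main; rewrite exy; exact: Jideal_eq.
Qed.

Lemma W_extker v : Wsp v -> extker mu (temb v).
Proof.
elim=> [u c r r' adj||u w _ h1 _ h2]; last 2 first.
- by rewrite (semilin0 (temb_lin n d)); exact: extker_zero.
- by rewrite temb_add; exact: extker_add.
have -> : hact u (Hb (rs r r')) + q *: u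
    = \sum_b (u b : Qq) *: (tau (rs r r') (M b) + q *: M b).
  rewrite (hact_s _ (rs_basic mu_d adj)) {1 2}(ffun_dl u) (semilin_sum (@tau_lin n d _)).
  rewrite scaler_sumr -big_split; apply: eq_bigr => b _ /=.
  by rewrite (linZ _ _ (@tau_lin n d _)) dl_M scalerDr; apply: (f_equal2 +%R); last exact: scale_comm.
rewrite (semilin_sum (temb_lin n d)); apply: (big_ind (extker mu)).
- exact: extker_zero.
- exact: extker_add.
by move=> b _; rewrite temb_scale; apply: extker_scale; exact: W_extker_M.
Qed.

(** The functionals vanish on the kernel, and a vector on which all of them vanish
    lies in the span of the v (H_s + q), hence in the kernel. *)
Lemma ext_eqP u v : ext_eq mu u v <-> forall A, strict A -> phi A u = phi A v.
Proof.
have B A : phi A (u - v) = phi A u - phi A v by exact: (semilinB (phi_lin mu_d A)).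
split=> [h A sA|h]; last first.
  by apply: W_extker; apply: W_phi0 => A sA; rewrite B h // subrr.
apply/eqP; rewrite -subr_eq0 -B -fapply_temb; apply/eqP; exact: (extker_fA mu_d sA h).
Qed.

Lemma phi_tbar0 u : (forall A, strict A -> phi A u = 0) ->
  forall A, strict A -> phi A (tbar u) = 0.
Proof.
move=> /W_phi0 /W_tbar /W_extker h A sA.
by rewrite -fapply_temb; exact: (extker_fA mu_d sA h).
Qed.

End KernelW.

(** * Uniqueness of bar invariant elements of the quotient *)

Lemma posZ_bar_iff c : posZ c <-> negZ (fbar c).
Proof. by split=> [/posZ_bar|/posZ_negZ]. Qed.

Lemma posZ0 : posZ 0.
Proof. by apply/posZ_bar_iff; rewrite rmorph0; exact: negZ0. Qed.

Lemma posZ_sum (I : Type) (s : seq I) (P : pred I) F :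
  (forall i, P i -> posZ (F i)) -> posZ (\sum_(i <- s | P i) F i).
Proof.
move=> h; apply/posZ_bar_iff; rewrite (raddf_sum fbar).
by apply: negZ_sum => i /h /posZ_bar_iff.
Qed.

Lemma posZB x y : posZ x -> posZ y -> posZ (x - y).
Proof.
move=> /posZ_bar_iff hx /posZ_bar_iff hy; apply/posZ_bar_iff; rewrite rmorphB.
by apply: negZD => //; apply: negZN.
Qed.

Lemma posZ_mqX k x : posZ x -> posZ (x * mq ^+ k).
Proof.
move=> /posZ_bar_iff h; apply/posZ_bar_iff.
have e : fbar mq = -1 * q^-1 by rewrite /mq rmorphN /= fbar_q mulN1r.
rewrite rmorphM /= rmorphXn /= e exprMn exprVn mulrC -mulrA.
exact/negZ_sign/negZ_exp.
Qed.

Lemma posZ_choose (T : Type) (F : T -> Qq) : (forall A, posZ (F A)) ->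
  exists f : T -> {poly int}, forall A, F A = q * peval (f A) q.
Proof.
move=> h; pose P A (p : {poly int}) := F A = q * peval p q.
exists (fun A => epsilon (inhabits 0) (P A)) => A.
exact: (epsilon_spec (inhabits 0) (P A) (h A)).
Qed.

Lemma signs_cancel (R : pzRingType) k m (x : R) :
  (-1) ^+ m * ((-1) ^+ k * ((-1) ^+ m * (-1) ^+ k * x)) = x.
Proof. rewrite -(signr_odd _ k) -(signr_odd _ m);
  by case: (odd k) (odd m) => [] []; rewrite ?expr0 ?expr1 ?mul1r ?mulr1 ?mulN1r ?opprK ?mulrN1 ?mulNr ?mul1r ?opprK. Qed.

Lemma fbar_qr k m : fbar (qr k m) = (-1) ^+ m * ((-1) ^+ k * mqr m k).
Proof.
apply: (inv_inj fbarK); rewrite fbarK [in RHS]rmorphM [in RHS]rmorphM /= !fbar_sign fbar_mqr.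
exact/esym/signs_cancel.
Qed.

(** The degree bound for Kazhdan-Lusztig polynomials, after the substitution of
    q^-1 for q. *)
Lemma Lt_pos n d (b c : d.-tuple 'I_n) : c != b -> posZ (Lt b c).
Proof.
move=> ne; rewrite ffunE; case: (sorta c =P sorta b) => [e|_]; last exact: posZ0.
have nl : lng c != lng b.
  by apply: contra ne => /eqP el; rewrite -(tact_lng c) e el tact_lng.
apply/posZ_bar_iff; rewrite rmorphM /= fbar_peval.
have -> : fbar (q ^- 2) = q ^+ 2 by rewrite fmorphV /= rmorphXn /= fbar_q exprVn invrK.
rewrite fbar_qr -2!mulrA; do 2 apply: negZ_sign; apply: deg_negZ => i.
exact: (good_deg (KL_good (lng b)) nl).
Qed.

Section DualBasis.

Variables l n d : nat.
Variable mu : l.-tuple nat.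
Hypothesis mu_d : sumn mu = d.
Local Notation filling := (filling n mu).
Local Notation gamma := (@gamma l n d mu mu_d).
Local Notation ht := (ht mu_d).
Local Notation phi := (@phi l n d mu mu_d).
Local Notation red := (@red l n d mu mu_d).
Local Notation revg := (revg mu_d).
Local Notation Nstar := (@Nstar l n d mu mu_d).
Local Notation T := (tens n d).
Implicit Types (A B C : filling) (c : 'I_l) (u v : T) (b : d.-tuple 'I_n).

Lemma revg_ht A C : strict A -> col_sim A C ->
  (invt (revg C) + ht C = invt (revg A) + ht A)%N.
Proof.
move=> sA s; rewrite !revgE !invt_dpairs.
by have [w _ ->] := sim_parab mu_d sA s; rewrite dpairs_tact.
Qed.

(** Reversal exchanges inversions and non-inversions, so that a column strict
    filling has the fewest inversions in its reversed reading. *)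
Lemma revg_min A C : strict A -> col_sim A C -> (invt (revg A) <= invt (revg C))%N.
Proof. by move=> sA s; have := revg_ht sA s; have := sim_ht mu_d sA s; lia. Qed.

Lemma phi_lead A v : strict A ->
    (forall C, col_sim A C -> C != A -> (v (revg C) : Qq) = 0) ->
  phi A v = v (revg A).
Proof.
move=> sA h; rewrite /phi (bigD1 A) ?col_sim_refl //= subnn expr0 mulr1 big1 ?addr0 //.
by move=> C /andP[s ne]; rewrite h // mul0r.
Qed.

Lemma phi_neq0 A v : phi A v != 0 -> exists2 C, col_sim A C & (v (revg C) : Qq) != 0.
Proof.
have [/existsP[C /andP[s e]] _|/existsPn h] :=
  boolP [exists C, col_sim A C && ((v (revg C) : Qq) != 0)]; first by exists C.
rewrite /phi big1 ?eqxx // => C s; have := h C; rewrite s /= negbK => /eqP ->.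
by rewrite mul0r.
Qed.

Lemma phi_comb A (P : pred filling) (k : filling -> Qq) : strict A ->
    (forall C, P C -> strict C) ->
  phi A (\sum_(C | P C) k C *: Nstar C) = if P A then k A else 0.
Proof.
move=> sA sP; rewrite (semilin_sum (phi_lin mu_d A)).
have e C : P C -> phi A (k C *: Nstar C) = k C * (A == C)%:R.
  by move=> /sP sC; rewrite (linZ _ _ (phi_lin mu_d A)) (phi_strict mu_d sA sC).
rewrite (eq_bigr _ e); case: ifP => h.
  rewrite (bigD1 A) //= eqxx mulr1 big1 ?addr0 // => C /andP[_ ne].
  by rewrite eq_sym (negPf ne) mulr0.
by rewrite big1 // => C hC; case: eqP => [eA|_]; [rewrite eA hC in h|rewrite mulr0].
Qed.

Lemma phi_tbar_diag A : strict A -> phi A (tbar (Nstar A)) = 1.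
Proof.
move=> sA; rewrite phi_lead; [exact: tbar_diag|exact: sA|].
move=> C s ne; apply/eqP; apply: contraT => /tbar_tri [/revg_inj e|[lt _]].
  by rewrite e eqxx in ne.
by have := revg_min sA s; rewrite leqNgt lt.
Qed.

(** Unitriangularity of the bar involution passes to the quotient, because the
    rearrangements of A have reversed readings with at least as many inversions
    as that of A. *)
Lemma phi_tbar_tri A C : strict A -> strict C -> phi A (tbar (Nstar C)) != 0 ->
  A = C \/ (invt (revg A) < invt (revg C))%N.
Proof.
move=> sA sC /phi_neq0 [D s /tbar_tri [/revg_inj e|[lt _]]]; [left|right].
  by apply: strict_sim => //; rewrite -e.
exact: leq_ltn_trans (revg_min sA s) lt.
Qed.

(** The coordinates of the bar conjugate depend only on those of v, because the
    bar involution preserves the kernel. *)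
Lemma phi_tbar_red A v : strict A ->
  phi A (tbar v) = \sum_(C | strict C) phi A (tbar (Nstar C)) * fbar (phi C v).
Proof.
move=> sA; have h C : strict C -> phi C (v - red v) = 0.
  move=> sC; rewrite (semilinB (phi_lin mu_d C)) [in X in _ - X](phi_comb _ sC) //.
  by rewrite sC subrr.
have := phi_tbar0 h sA; rewrite (semilinB (tbar_lin n d)) (semilinB (phi_lin mu_d A)).
move/eqP; rewrite subr_eq0 => /eqP ->.
rewrite (semilin_sum (tbar_lin n d)) (semilin_sum (phi_lin mu_d A)).
apply: eq_bigr => C _; rewrite (barZ _ _ (tbar_lin n d)) (linZ _ _ (phi_lin mu_d A)).
exact: mulrC.
Qed.

(** Uniqueness of canonical bases in the quotient: [bar_triangular_eq0] for the
    coordinates [phi A], extended by 0 to the fillings that are not column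
    strict. *)
Lemma phi_bar_eq0 u : (forall A, strict A -> phi A (tbar u) = phi A u) ->
    (forall A, strict A -> posZ (phi A u)) ->
  forall A, strict A -> phi A u = 0.
Proof.
move=> hb hp; pose c A : Qq := if strict A then phi A u else 0.
pose r A C : Qq := if strict A && strict C then phi A (tbar (Nstar C)) else (A == C)%:R.
suff h : forall A, c A = 0 by move=> A sA; have := h A; rewrite /c sA.
apply: (bar_triangular_eq0 (h := fun A => invt (revg A)) (r := r)).
- by move=> A; rewrite /r; case: ifP => [/andP[sA _]|_]; [exact: phi_tbar_diag|rewrite eqxx].
- move=> A C; rewrite /r; case: ifP => [/andP[sA sC]|_]; first exact: phi_tbar_tri.
  by case: (A =P C) => [->|_]; [left|rewrite eqxx].
- move=> A; rewrite /c; case: ifP => sA.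
    rewrite -hb // phi_tbar_red // [LHS]big_mkcond; apply: eq_bigr => C _.
    by rewrite /r sA /=; case: ifP => // _; rewrite rmorph0 mulr0.
  rewrite big1 // => C _; rewrite /r sA /=; case: (A =P C) => [<-|_]; last by rewrite mul0r.
  by rewrite sA rmorph0 mulr0.
by move=> A; apply: posZ_bar0; rewrite /c; case: ifP => [sA|_]; [exact: hp|exact: posZ0].
Qed.

End DualBasis.

(** * The second formula *)

Lemma qr_scalar (R : fieldType) (t p : R) (D m x y z : nat) : t != 0 ->
  (m + y = D)%N -> (D - z + z = D)%N -> (z <= x)%N ->
  t ^+ m / t ^+ (D - z) * p * (- t) ^+ (x - z)
  = (- t) ^+ x / (- t) ^+ y * ((-1) ^+ (z + y) * p).
Proof.
move=> t0 <- e le.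
have tm k : t ^+ k != 0 by exact: expf_neq0.
move: e; set k := (_ - z)%N => e; rewrite -{2}(subnK le); move: (x - z)%N => j.
have -> : t ^+ m / t ^+ k = t ^+ z / t ^+ y.
  by apply/eqP; rewrite eqr_div // -!exprD -e addnC.
rewrite !(exprNn t) (exprD (-1)) (exprD (-1)) (exprD t).
have := sqrr_sign R z; have sy : (-1) ^+ y != 0 :> R by rewrite signr_eq0.
move: (tm y) sy; move: ((-1) ^+ z) ((-1) ^+ y) ((-1) ^+ j) (t ^+ z) (t ^+ y) (t ^+ j).
move=> a b c w v u v0 b0 a2; rewrite -[LHS]mul1r -a2.
by field; rewrite v0 b0.
Qed.

Lemma subD2l (V : zmodType) (a x y : V) : (a + x) - (a + y) = x - y.
Proof. by rewrite opprD addrACA subrr add0r. Qed.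

Section SecondFormula.

Variables l n d : nat.
Variable mu : l.-tuple nat.
Hypothesis mu_d : sumn mu = d.
Local Notation filling := (filling n mu).
Local Notation gamma := (@gamma l n d mu mu_d).
Local Notation ht := (ht mu_d).
Local Notation phi := (@phi l n d mu mu_d).
Local Notation revg := (revg mu_d).
Local Notation Nstar := (@Nstar l n d mu mu_d).
Local Notation T := (tens n d).
Implicit Types (A B C : filling) (c : 'I_l) (u v : T) (b : d.-tuple 'I_n).

Variable nu : n.-tuple nat.
Hypothesis nu_d : sumn nu = d.
Variable B : filling.
Hypothesis hB : B \in Col mu nu.
Let sB : strict B := ((ColP mu_d nu B).1 hB).1.
Let wB : weight nu (gamma B) := ((ColP mu_d nu B).1 hB).2.
Let wrB : weight nu (revg B).
Proof. by rewrite revgE; apply/weight_tact_iff. Qed.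

Lemma Col_strict C : C \in Col mu nu -> strict C.
Proof. by case/(ColP mu_d nu C). Qed.

(** Rearrangements have the same weight, and [Lt] is supported on one orbit. *)
Lemma phi_Lt_out A : strict A -> A \notin Col mu nu -> phi A (Lt (revg B)) = 0.
Proof.
move=> sA nA; apply/eqP; apply: contraNT nA => /phi_neq0 [C s ne].
apply/(ColP mu_d nu A); split=> //; have [w _ e] := sim_parab mu_d sA s.
apply/(weight_tact_iff nu (gamma A) w); rewrite -e.
apply/(weight_tact_iff nu (gamma C) (wlong d)); rewrite -revgE.
apply: (sorta_weight wrB); move: ne; rewrite ffunE.
by case: (sorta (revg C) =P sorta (revg B)) => // _; rewrite eqxx.
Qed.

(** The proper rearrangements of B have more inversions in their reversed readings
    than B has, so that [Lt] vanishes there. *)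
Lemma phi_Lt_diag : phi B (Lt (revg B)) = 1.
Proof.
rewrite phi_lead; [exact: Lt_diag|exact: sB|].
move=> C s ne; apply/eqP; apply: contraT => /Lt_supp [/revg_inj e|lt].
  by rewrite e eqxx in ne.
by have := revg_min mu_d sB s; rewrite leqNgt lt.
Qed.

Lemma phi_Lt_pos A : strict A -> A != B -> posZ (phi A (Lt (revg B))).
Proof.
move=> sA ne; apply: posZ_sum => C s; apply: posZ_mqX; apply: Lt_pos.
apply: contra ne => /eqP /revg_inj e; apply/eqP; apply: (strict_sim sA sB).
by rewrite -e.
Qed.

Lemma phi_Col_comb A (k : filling -> Qq) : strict A ->
  phi A (\sum_(C in Col mu nu) k C *: Nstar C) = if A \in Col mu nu then k A else 0.
Proof. by move=> sA; apply: phi_comb => // C; exact: Col_strict. Qed.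

Lemma phi_Kstar_form A (f : filling -> Qq) : strict A ->
  phi A (Nstar B + \sum_(C in Col mu nu) f C *: Nstar C)
  = (A == B)%:R + if A \in Col mu nu then f A else 0.
Proof.
move=> sA; rewrite (semiD _ _ (phi_lin mu_d A)) (phi_strict mu_d sA sB).
by apply: congr1; exact: phi_Col_comb.
Qed.

Lemma Lt_is_Kstar : is_Kstar mu_d nu B (Lt (revg B)).
Proof.
split; first by apply/ext_eqP => A _; rewrite Lt_bar.
pose F A : Qq := if strict A && (A != B) then phi A (Lt (revg B)) else 0.
have Fp A : posZ (F A).
  by rewrite /F; case: ifP => [/andP[]|_]; [exact: phi_Lt_pos|exact: posZ0].
have [f fE] := posZ_choose Fp; exists f.
apply/(ext_eqP mu_d) => A sA; rewrite phi_Kstar_form // -fE /F sA /=.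
case: eqVneq => [->|ne] /=; first by rewrite hB addr0 phi_Lt_diag.
by case: ifP => [//|/negbT nA]; rewrite ?add0r // phi_Lt_out.
Qed.

Lemma Kstar_uniq v : is_Kstar mu_d nu B v ->
  forall A, strict A -> phi A v = phi A (Lt (revg B)).
Proof.
case=> bv [f ev] A sA; have [bL [g eL]] := Lt_is_Kstar.
apply/eqP; rewrite -subr_eq0; apply/eqP; rewrite -(semilinB (phi_lin mu_d A)).
apply: phi_bar_eq0 A sA => A sA.
  rewrite (semilinB (tbar_lin n d)) 2!(semilinB (phi_lin mu_d A)).
  by rewrite ((ext_eqP mu_d _ _).1 bv A sA) ((ext_eqP mu_d _ _).1 bL A sA).
have e1 := etrans ((ext_eqP mu_d _ _).1 ev A sA) (phi_Kstar_form (fun C => q * peval (f C) q) sA).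
have e2 := etrans ((ext_eqP mu_d _ _).1 eL A sA) (phi_Kstar_form (fun C => q * peval (g C) q) sA).
rewrite (semilinB (phi_lin mu_d A)) e1 e2 subD2l.
case: ifP => _; last by rewrite subr0; exact: posZ0.
by apply: posZB; [exists (f A)|exists (g A)].
Qed.

Lemma KstarE A : strict A -> phi A (Kstar mu_d nu B) = phi A (Lt (revg B)).
Proof.
move=> sA; apply: Kstar_uniq => //; apply: (epsilon_spec (inhabits 0) (is_Kstar mu_d nu B)).
by exists (Lt (revg B)); exact: Lt_is_Kstar.
Qed.

Lemma kstarE A : A \in Col mu nu -> kstar mu_d nu A B = phi A (Lt (revg B)).
Proof.
move=> hA; have sA := Col_strict hA; rewrite /kstar; set P := (fun k : filling -> Qq => _).
have Pk : P (epsilon (inhabits (fun=> 0)) P).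
  apply: epsilon_spec; exists (fun C => phi C (Lt (revg B))).
  apply/(ext_eqP mu_d) => C sC; rewrite KstarE // phi_Col_comb //.
  by case: ifP => // /negbT; exact: phi_Lt_out.
move: (epsilon _ _) Pk => k /(ext_eqP mu_d) /(_ A sA).
by rewrite KstarE // phi_Col_comb // hA => ->.
Qed.

(** The rearrangements of A within columns are the fillings whose reading is
    a0 . (x w) with w in S_mu, and z = d(a0 . z) is the element of D_nu in the
    coset S_nu x w. *)
Lemma sim_mincoset A C (a0 := sorta (gamma B)) : A \in Col mu nu ->
  forall z, (col_sim A (ginv mu_d (tact a0 z)) && (std (gamma (ginv mu_d (tact a0 z))) == z))
    = (z \in mincoset d nu :&: dblcoset nu (std (gamma A)) mu).
Proof.
move=> hA z; have [sA wA] := (ColP mu_d nu A).1 hA.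
have wa0 : weight nu a0 by apply/weight_tact_iff.
have ia0 : wincr a0 by exact: wincr_sorta.
have eA : tact a0 (std (gamma A)) = gamma A.
  by rewrite /a0 -(weight_sorta nu_d wA wB) sortaK.
rewrite gammaK inE; apply/andP/andP => [[s /eqP ez]|[hz /imset2P[w w' hw hw' ez]]].
  split; first by rewrite -ez; apply: std_mincoset => //; apply/weight_tact_iff.
  have [w' hw' e] := (col_simP mu_d _ sA).1 s; rewrite gammaK -eA tactM in e.
  set x := pmul _ w' in e.
  apply/imset2P; exists (pmul z x^-1%g) w' => //.
    by rewrite (parab_stab nu_d _ wa0) // -tactM e tactK.
  by rewrite pmulA -/x /pmul mulgA mulgV mul1g.
split; last by apply/eqP/esym; exact: (mincoset_std nu_d wa0 ia0 hz).
have -> : tact a0 z = tact (gamma A) w'.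
  rewrite ez -2!tactM; move: hw; rewrite (parab_stab nu_d _ wa0) // => /eqP ->.
  by rewrite eA.
exact: parab_sim.
Qed.

(** The longest element for the reversed reading is d(gamma C) w_d, which accounts
    for w_d in the formula. *)
Lemma lng_revg C : lng (revg C) = pmul (std (gamma C)) (wlong d).
Proof. by rewrite /lng revgE tactM wlongK tact1. Qed.

Lemma Lt_term A C (x := std (gamma A)) (y := std (gamma B)) (z := std (gamma C)) :
    strict A -> col_sim A C -> sorta (gamma C) = sorta (gamma B) ->
  (Lt (revg B) (revg C) : Qq) * mq ^+ (ht A - ht C)
  = (- q) ^ ((ell x)%:Z - (ell y)%:Z) * ((-1) ^+ (ell z + ell y)
      * peval (KL (pmul z (wlong d)) (pmul y (wlong d))) (q ^- 2)).
Proof.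
move=> sA s eC; have es : sorta (revg C) = sorta (revg B) by rewrite !revgE !sorta_tact.
have le := sim_ht mu_d sA s; rewrite /ht -!ell_std -/x -/z in le *.
rewrite ffunE es eqxx !lng_revg /qr.
have ey := ell_wlong y; have ez := ell_wlong z.
have -> : ell (pmul z (wlong d)) = (dpairs (fun i : 'I_d => i) - ell z)%N by rewrite -ez addnK.
rewrite (qr_scalar _ q_neq0 ey _ le); last by rewrite -ez addnK.
by rewrite expfzDr ?mq_neq0 // -exprnP exprnN.
Qed.

Lemma second_formula A : A \in Col mu nu ->
  let x := dperm nu (gamma A) in let y := dperm nu (gamma B) in
  kstar mu_d nu A B = (- q) ^ ((ell x)%:Z - (ell y)%:Z)
      * \sum_(z in mincoset d nu :&: dblcoset nu x mu)
          (-1) ^+ (ell z + ell y)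
            * peval (KL (pmul z (wlong d)) (pmul y (wlong d))) (q ^- 2).
Proof.
move=> hA x y; have [sA wA] := (ColP mu_d nu A).1 hA.
rewrite (kstarE hA) /x /y !(dpermE nu_d) // /phi.
pose h z := ginv mu_d (tact (sorta (gamma B)) z).
have weq C : col_sim A C -> sorta (gamma C) = sorta (gamma B).
  move=> s; apply: (weight_sorta nu_d _ wB); have [w _ ->] := sim_parab mu_d sA s.
  exact/weight_tact_iff.
rewrite (reindex_onto h (fun C => std (gamma C))); last first.
  by move=> C s; rewrite /h -(weq C s) sortaK ginvK.
rewrite mulr_sumr; apply: eq_big => [z|z /andP[s /eqP ez]]; first exact: sim_mincoset.
by move: (h z) s ez => C s <-; apply: Lt_term => //; exact: weq.
Qed.

End SecondFormula.

Theorem mainTheorem2 (l n d : nat) (mu : l.-tuple nat) (nu : n.-tuple nat)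
    (mu_d : sumn mu = d) (nu_d : sumn nu = d) (A B : filling n mu)
    (A_col : A \in Col mu nu) (B_col : B \in Col mu nu) :
  let x : 'S_d := dperm nu (gamma mu_d A) in
  let y : 'S_d := dperm nu (gamma mu_d B) in
  kcoef mu_d nu A B =
    (- q) ^ ((ell x)%:Z - (ell y)%:Z)
      * \sum_(z in parab d nu) (-1) ^+ ell z * peval (KL (pmul z x) y) (q ^+ 2)
  /\
  kstar mu_d nu A B =
    (- q) ^ ((ell x)%:Z - (ell y)%:Z)
      * \sum_(z in mincoset d nu :&: dblcoset nu x mu)
          (-1) ^+ (ell z + ell y)
            * peval (KL (pmul z (wlong d)) (pmul y (wlong d))) (q ^- 2).
Proof.
move=> x y; split; first exact: (first_formula mu_d nu_d B_col A_col).
exact: (second_formula mu_d nu_d B_col A_col).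
Qed.
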